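(* Let $(M^n,g_{ij},f)$ be a compact gradient shrinking Ricci soliton, $R_{ij}+\nabla_i\nabla_j f=\frac1{2\tau}g_{ij}$ with $\tau>0$ constant, where $(4\pi\tau)^{-n/2}\int_M e^{-f}\,dV=1$. Let $h$ be a smooth symmetric 2-tensor, $g(s)=g+sh$, and let $(f(s),\tau(s))$ be a smooth family of pairs realizing $\nu(g(s))$, with $(f(0),\tau(0))=(f,\tau)$. Then $\delta\tau:=\frac{d}{ds}\big|_{s=0}\tau(s)$ is given by $$\delta\tau=\tau\,\frac{\int_M\langle Rc,h\rangle e^{-f}\,dV}{\int_M R\,e^{-f}\,dV}.$$
   Context: $Rc=(R_{ij})$ is the Ricci tensor and $R$ the scalar curvature of $g$. Perelman's functional on a compact manifold $M^n$ is $\mathcal W(g,f,\tau)=\int_M[\tau(R+|\nabla f|^2)+f-n](4\pi\tau)^{-n/2}e^{-f}\,dV$, for a metric $g$, a smooth function $f$ and $\tau>0$. The $\nu$-entropy is $$\nu(g)=\inf\Big\{\mathcal W(g,f,\tau): f\in C^\infty(M),\ \tau>0,\ (4\pi\tau)^{-n/2}\int_M e^{-f}\,dV=1\Big\}.$$ A pair $(f,\tau)$ realizing $\nu(g)$ satisfies the constraint $(4\pi\tau)^{-n/2}\int_M e^{-f}\,dV=1$ and the equations $$\tau(-2\Delta f+|\nabla f|^2-R)-f+n+\nu(g)=0,\qquad (4\pi\tau)^{-n/2}\int_M f e^{-f}\,dV=\frac n2+\nu(g).$$ *)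

(* Defs.v *)
From HB Require Import structures.
From mathcomp Require Import all_boot all_order all_algebra.
From mathcomp Require Import all_classical all_reals all_analysis.

Set Implicit Arguments.
Unset Strict Implicit.
Unset Printing Implicit Defensive.

Import Order.TTheory GRing.Theory Num.Theory.
Import numFieldNormedType.Exports.

Local Open Scope classical_set_scope.
Local Open Scope ring_scope.

(* C^infinity on an open set A of a finite-dimensional space: every iterated
   directional derivative is (Frechet) differentiable, hence continuous, at
   every point of A. *)
Definition smooth_on (R : realType) (V W : normedModType R) (A : set V)
    (F : V -> W) : Prop :=
  forall (vs : seq V) (x : V), A x ->
    differentiable (foldr (fun v (G : V -> W) => fun y => 'D_v G y) F vs) x.

(* An n-dimensional smooth atlas on M.  The values of [chart_map c] off [chart_dom c] and
   of [chart_inv c] off [chart_map c @` chart_dom c] are irrelevant. *)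
Record smooth_atlas (R : realType) (n : nat) (M : topologicalType) :=
  SmoothAtlas {
    chart : Type;
    chart_dom : chart -> set M;
    chart_map : chart -> M -> 'rV[R]_n;
    chart_inv : chart -> 'rV[R]_n -> M;
    chart_at : M -> chart;
    chart_dom_open : forall c, open (chart_dom c);
    chart_image_open : forall c, open (chart_map c @` chart_dom c);
    chart_mapK : forall c p, chart_dom c p -> chart_inv c (chart_map c p) = p;
    chart_map_continuous : forall c, {within chart_dom c, continuous (chart_map c)};
    chart_inv_continuous :
      forall c, {within chart_map c @` chart_dom c, continuous (chart_inv c)};
    chart_atP : forall p, chart_dom (chart_at p) p;
    transition_smooth : forall c d,
      smooth_on (chart_map c @` (chart_dom c `&` chart_dom d)) (chart_map d \o chart_inv c)
  }.
Arguments chart {R n M} _.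
Arguments chart_dom {R n M s} _ _.
Arguments chart_map {R n M s} _ _.
Arguments chart_inv {R n M s} _ _.
Arguments chart_at {R n M} _ _.

(* Riemannian geometry in coordinates: G x is the matrix (g_ij) at x. *)
Section Coordinates.
Variables (R : realType) (n : nat).
Implicit Types (G : 'rV[R]_n -> 'M[R]_n) (u : 'rV[R]_n -> R) (x : 'rV[R]_n).
Implicit Types (i j k l : 'I_n).

Definition pderiv i u x : R := 'D_(delta_mx 0 i) u x.

Definition ginv G i j x : R := invmx (G x) i j.

(* Gamma^k_ij *)
Definition christoffel G k i j x : R :=
  2^-1 * \sum_l ginv G k l x *
    (pderiv i (fun y => G y j l) x + pderiv j (fun y => G y i l) x
     - pderiv l (fun y => G y i j) x).

(* R_ij, with the sign for which round spheres have positive curvature *)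
Definition ricci G i j x : R :=
  \sum_k (pderiv k (christoffel G k i j) x
          - pderiv j (christoffel G k i k) x
          + \sum_l (christoffel G k k l x * christoffel G l i j x
                    - christoffel G k j l x * christoffel G l i k x)).

Definition scalar_coord G x : R := \sum_i \sum_j ginv G i j x * ricci G i j x.

(* nabla_i nabla_j u *)
Definition hessian G u i j x : R :=
  pderiv i (pderiv j u) x - \sum_k christoffel G k i j x * pderiv k u x.

Definition grad_sq G u x : R :=
  \sum_i \sum_j ginv G i j x * pderiv i u x * pderiv j u x.

(* <A, B> = g^ik g^jl A_ij B_kl *)
Definition inner2 G (A B : 'I_n -> 'I_n -> R) x : R :=
  \sum_i \sum_j \sum_k \sum_l
    ginv G i k x * ginv G j l x * A i j * B k l.

End Coordinates.

(* Iterated Lebesgue integral over R^n. *)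
Fixpoint integral_rV (R : realType) (n : nat) : ('rV[R]_n -> R) -> R :=
  match n with
  | 0 => fun F => F 0
  | m.+1 => fun F => \int[@lebesgue_measure R]_t
              integral_rV (fun y : 'rV[R]_m => F (row_mx (const_mx t : 'rV_1) y))
  end.

(* The distinguished point that M carries as a ptopologicalType plays no role. *)
Definition borel (M : ptopologicalType) := g_sigma_algebraType (@open M).

Section Manifold.
Variables (R : realType) (n : nat) (M : ptopologicalType).
Variable A : smooth_atlas R n M.

Definition smooth_fun (u : M -> R) : Prop :=
  forall c : chart A, smooth_on (chart_map c @` chart_dom c) (u \o chart_inv c).

(* A 2-tensor is given by its component matrices (T_ij) in all charts. *)
Definition tensor2 := chart A -> M -> 'M[R]_n.

Definition smooth_sym_tensor (T : tensor2) : Prop :=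
  [/\ forall c p, chart_dom c p -> (T c p)^T = T c p,
      forall c i j,
        smooth_on (chart_map c @` chart_dom c) (fun x => T c (chart_inv c x) i j)
    & forall c d p, chart_dom c p -> chart_dom d p ->
        let J := jacobian (chart_map d \o chart_inv c) (chart_map c p) in
        T c p = J *m T d p *m J^T].

Definition riemannian_metric (g : tensor2) : Prop :=
  smooth_sym_tensor g /\
  forall c p, chart_dom c p ->
    forall v : 'rV[R]_n, v != 0 -> 0 < (v *m g c p *m v^T) 0 0.

Definition perturb (g h : tensor2) (s : R) : tensor2 :=
  fun c p => g c p + s *: h c p.

Definition local_metric (g : tensor2) (c : chart A) : 'rV[R]_n -> 'M[R]_n :=
  g c \o chart_inv c.

Definition scalar_curvature (g : tensor2) (p : M) : R :=
  let c := chart_at A p in scalar_coord (local_metric g c) (chart_map c p).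

Definition norm_grad_sq (g : tensor2) (u : M -> R) (p : M) : R :=
  let c := chart_at A p in
  grad_sq (local_metric g c) (u \o chart_inv c) (chart_map c p).

Definition ricci_inner (g h : tensor2) (p : M) : R :=
  let c := chart_at A p in
  inner2 (local_metric g c)
    (fun i j => ricci (local_metric g c) i j (chart_map c p)) (h c p) (chart_map c p).

(* dV = sqrt(det g) dx in every chart, tested on continuous functions with
   compact support in the chart; on a compact M this determines mu. *)
Definition riemannian_measure (g : tensor2)
    (mu : {measure set (borel M) -> \bar R}) : Prop :=
  forall (c : chart A) (K : set M) (u : M -> R),
    compact K -> K `<=` chart_dom c -> continuous u ->
    (forall p, ~ K p -> u p = 0) ->
    (\int[mu]_p (u p)%:E)%E =
    (integral_rV (fun x => if x \in chart_map c @` chart_dom c then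
        u (chart_inv c x) * Num.sqrt (\det (g c (chart_inv c x))) else 0))%:E.

Definition gradient_shrinking_soliton (g : tensor2) (f : M -> R) (tau : R) :
    Prop :=
  forall (c : chart A) (p : M) (i j : 'I_n), chart_dom c p ->
    ricci (local_metric g c) i j (chart_map c p)
    + hessian (local_metric g c) (f \o chart_inv c) i j (chart_map c p)
    = 1 / (2 * tau) * g c p i j.

Section Entropy.
Variable dV : tensor2 -> {measure set (borel M) -> \bar R}.

Definition normalized (g : tensor2) (f : M -> R) (tau : R) : Prop :=
  (4 * pi * tau) `^ (- (n%:R / 2)) * \int[dV g]_p expR (- f p) = 1.

Definition W_functional (g : tensor2) (f : M -> R) (tau : R) : R :=
  \int[dV g]_p ((tau * (scalar_curvature g p + norm_grad_sq g f p)
                 + f p - n%:R)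
                * (4 * pi * tau) `^ (- (n%:R / 2)) * expR (- f p)).

(* Extended-real valued, as the infimum may be -oo. *)
Definition nu_entropy (g : tensor2) : \bar R :=
  ereal_inf [set w : \bar R | exists f tau,
    [/\ smooth_fun f, 0 < tau, normalized g f tau
      & w = (W_functional g f tau)%:E]].

Definition realizes_nu (g : tensor2) (f : M -> R) (tau : R) : Prop :=
  [/\ smooth_fun f, 0 < tau, normalized g f tau
    & (W_functional g f tau)%:E = nu_entropy g].

End Entropy.

(* Joint smoothness of (s, p) |-> f(s)(p) and of s |-> tau(s), |s| < eps. *)
Definition smooth_family (eps : R) (f : R -> M -> R) (tau : R -> R) : Prop :=
  (forall c : chart A,
     smooth_on [set z : R * 'rV[R]_n | `|z.1| < eps /\
                                       (chart_map c @` chart_dom c) z.2]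
               (fun z => f z.1 (chart_inv c z.2)))
  /\ smooth_on [set s : R | `|s| < eps] tau.

End Manifold.

(* Main.v *)
(* Write u = e^-f (normalised), <F> for the integral of F u, and q = |grad f|^2.  Comparing a
   minimiser with nearby pairs gives <R + q> = n / 2 tau and a weak equation for f which, on a
   soliton, holds pointwise: tau (R + q) = f - nu.  Differentiate along g + s h the constraint,
   the tau-equation, and the f-equation tested with the fixed function f; eliminate the
   variation R' of the scalar curvature by
     int R' psi = int (- <Rc, h> psi + <h, Hess psi> - tr h Lap psi),
   and integrate by parts.  All terms cancel except (delta tau) <R> = tau < <Rc, h> >.
   If <R> vanished, the weighted Bochner formula would give <|Hess f|^2> = n / 4 tau^2, so by
   Cauchy-Schwarz Lap f would have variance 0, i.e. be the constant n / 2 tau, against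
   int Lap f = 0.
   The tensor identities are proved in the ring of smooth functions on a chart, with s as an
   additional coordinate; a partition of unity reduces each integral identity to a chart, where
   it says that the coordinate divergence of a compactly supported field has integral 0. *)

(* The quantity to be removed is the variation of f, for which no formula is available. On a soliton
   the pointwise equation and the trace of the soliton equation say that f minus its mean is an
   eigenfunction, with eigenvalue -1/tau, of the drift Laplacian Lap - <grad f, grad .>. Integration
   by parts against f thus turns gradients of the unknown into polynomials in f, which is why f is
   the right test function. Along the family the f-equation stays in weak form: it contains only
   first derivatives of f(s), so its s-derivative involves no variation of a Hessian. The entropy of
   g(s) is expressed through the mean of f(s) before differentiating, so its own dependence on s
   never has to be studied. Curvature and gradients at a point are defined through a chart chosen
   for that point, so even their continuity rests on chart independence. A commutative ring with
   commuting derivations frees the tensor calculus from differentiability side conditions, and makes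
   the variation of the metric one more derivation that commutes with the others. *)
Require Import Defs.
From HB Require Import structures.
From mathcomp Require Import all_boot all_order all_algebra.
From mathcomp Require Import all_classical all_reals all_analysis.
From mathcomp Require Import ring lra.

Set Implicit Arguments.
Unset Strict Implicit.
Unset Printing Implicit Defensive.

Import Order.TTheory GRing.Theory Num.Theory.
Import numFieldNormedType.Exports.

Local Open Scope classical_set_scope.
Local Open Scope ring_scope.

(** * Smooth functions *)

Section DirectionalCalculus.
Variable R : realType.
Implicit Types V W U : normedModType R.

Lemma near_eq_differentiable V W (F G : V -> W) (x : V) :
  (\near x, F x = G x) -> differentiable F x -> differentiable G x.
Proof.
move=> FG dF; have [cF eF] := (diff_locallyP x F).1 dF.
have eG : G \o shift x = cst (G x) + 'd F x +o_0 id.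
  apply/eqaddoP => e e0.
  have /eqaddoP/(_ e e0) := eF.
  have FG0 : \forall h \near 0, F (h + x) = G (h + x).
    by rewrite (near_shift x) /=; near=> y; rewrite /= sub0r subrK; near: y.
  apply: filterS2 FG0 => h /= Fh.
  by rewrite !fctE /= /cst -(nbhs_singleton FG) -Fh.
have dGF := diff_unique cF eG.
by apply/diff_locallyP; rewrite dGF.
Unshelve. all: by end_near. Qed.

Lemma derive_line V W (F : V -> W) (v y : V) (s : R) :
  'D_1 (fun t : R => F (t *: v + y)) s = 'D_v F (s *: v + y).
Proof.
rewrite /derive; congr (lim _).
suff -> : (fun h : R => h^-1 *: (F ((h *: 1 + s) *: v + y) - F (s *: v + y))) =
          (fun h : R => h^-1 *: (F (h *: v + (s *: v + y)) - F (s *: v + y))) by [].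
by apply/funext => h; rewrite scalerDl addrA [h *: 1]mulr1.
Qed.

Lemma is_derive_line V W (F : V -> W) (v y : V) (s : R) :
  differentiable F (s *: v + y) ->
  is_derive s 1 (fun t : R => F (t *: v + y)) ('D_v F (s *: v + y)).
Proof.
move=> /diff_derivable dF.
apply: DeriveDef; last exact: derive_line.
have {}dF := dF v; rewrite /derivable in dF *.
suff -> : (fun h : R => h^-1 *: (F ((h *: 1 + s) *: v + y) - F (s *: v + y))) =
          (fun h : R => h^-1 *: (F (h *: v + (s *: v + y)) - F (s *: v + y))) by [].
by apply/funext => h; rewrite scalerDl addrA [h *: 1]mulr1.
Qed.

(** The mean value theorem along [v], applied to the increment of [F] in the direction [w], leaves a
    difference of two values of ['D_v F]. Its expansion at [x] alone then suffices: no continuity of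
    mixed second derivatives is assumed. *)
Lemma second_difference_derive V (A : set V) (F : V -> R) (v w x : V) (e : R) :
  open A -> A x -> (forall y, A y -> differentiable F y) ->
  differentiable (fun y => 'D_v F y) x -> 0 < e ->
  \forall t \near 0^'+,
    `|F (t *: v + (t *: w + x)) - F (t *: w + x) - F (t *: v + x) + F x
      - t ^+ 2 * 'D_w (fun y => 'D_v F y) x| <= e * t ^+ 2.
Proof.
move=> oA Ax dF dDF e0.
set D := fun y => 'D_v F y.
(* The two points where ['D_v F] is expanded are at distance at most t(|v| + |w|) and t|v| from [x].
   [C] dominates the sum of these factors, and the summand 1 keeps it positive when both vectors
   vanish. *)
pose C := 2 * (`|v| + `|w|) + `|v| + `|w| + 1.
have C0 : 0 < C by rewrite /C; have := normr_ge0 v; have := normr_ge0 w; lra.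
have [r r0 rD] : exists2 r, 0 < r & forall h, `|h| < r ->
    `|D (h + x) - D x - 'd D x h| <= e / C * `|h|.
  have [_ /eqaddoP/(_ (e / C))] := (diff_locallyP x D).1 dDF.
  rewrite divr_gt0// => /(_ isT)/nbhs_normP[r /= r0 rP]; exists r => // h hr.
  have := rP h; rewrite /= sub0r normrN => /(_ hr); rewrite !fctE /= /cst opprD addrA.
  exact.
have [q q0 qA] : exists2 q, 0 < q & forall h, `|h| < q -> A (h + x).
  have /nbhs_normP[q q0 qA] := open_nbhs_nbhs (conj oA Ax).
  by exists q => // h hq; apply: qA; rewrite /= opprD addrCA subrr addr0 normrN.
near=> t.
have t0 : 0 < t by near: t; exact: nbhs_right_gt.
have tr : t * C < r.
  by rewrite -ltr_pdivlMr//; near: t; apply: nbhs_right_lt; rewrite divr_gt0.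
have tq : t * C < q.
  by rewrite -ltr_pdivlMr//; near: t; apply: nbhs_right_lt; rewrite divr_gt0.
have small1 s : 0 <= s <= t -> `|s *: v + t *: w| <= t * (`|v| + `|w|).
  move=> /andP[s0 st]; rewrite (le_trans (ler_normD _ _))// !normrZ mulrDr.
  by rewrite (ger0_norm s0) (gtr0_norm t0) lerD2r ler_wpM2r.
have small2 s : 0 <= s <= t -> `|s *: v| <= t * `|v|.
  by move=> /andP[s0 st]; rewrite normrZ (ger0_norm s0) ler_wpM2r.
have vwC : t * (`|v| + `|w|) < t * C.
  by rewrite ltr_pM2l// /C; have := normr_ge0 v; have := normr_ge0 w; lra.
have vC : t * `|v| <= t * (`|v| + `|w|) by rewrite ler_pM2l// lerDl.
pose g (s : R) := F (s *: v + (t *: w + x)) - F (s *: v + x).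
have Dg s : 0 <= s <= t ->
    is_derive s 1 g (D (s *: v + (t *: w + x)) - D (s *: v + x)).
  move=> st; apply: is_deriveB; apply: is_derive_line; apply: dF.
    by rewrite addrA; apply: qA; rewrite (le_lt_trans (small1 _ st))// (lt_trans vwC).
  apply: qA; rewrite (le_lt_trans (small2 _ st))// (le_lt_trans vC)//.
  exact: lt_trans tq.
have [||c ct gE] := @MVT_segment R g
    (fun s => D (s *: v + (t *: w + x)) - D (s *: v + x)) 0 t (ltW t0).
- by move=> s; rewrite in_itv/= => /andP[s0 st]; apply: Dg; rewrite !ltW.
- apply: derivable_within_continuous => s; rewrite in_itv/= => st.
  by have [] := Dg _ st.
rewrite in_itv/= in ct.
have -> : F (t *: v + (t *: w + x)) - F (t *: w + x) - F (t *: v + x) + F x =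
    g t - g 0 by rewrite /g !scale0r !add0r; ring.
rewrite gE subr0 deriveE// -/D.
have -> : (D (c *: v + (t *: w + x)) - D (c *: v + x)) * t - t ^+ 2 * 'd D x w =
    t * ((D ((c *: v + t *: w) + x) - D x - 'd D x (c *: v + t *: w))
         - (D (c *: v + x) - D x - 'd D x (c *: v))).
  have -> : 'd D x (c *: v + t *: w) = 'd D x (c *: v) + t * 'd D x w.
    by rewrite linearD; congr (_ + _); exact: linearZ.
  by rewrite addrA; ring.
rewrite normrM (gtr0_norm t0) expr2 mulrCA ler_pM2l//.
apply: (le_trans (ler_normB _ _)).
have h1 := rD (c *: v + t *: w).
have h2 := rD (c *: v).
apply: (le_trans (lerD (h1 _) (h2 _))).
- by rewrite (le_lt_trans (small1 _ ct))// (lt_trans vwC).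
- by rewrite (le_lt_trans (small2 _ ct))// (le_lt_trans vC)// (lt_trans vwC).
rewrite -mulrDr -mulrA ler_pM2l// mulrC ler_pdivrMr// (le_trans (lerD (small1 _ ct) (small2 _ ct)))//.
rewrite -mulrDr ler_pM2l// /C.
by have := normr_ge0 v; have := normr_ge0 w; lra.
Unshelve. all: by end_near. Qed.

(** The second difference is symmetric in [v] and [w], so both mixed derivatives, times t^2, lie
    within (e/2) t^2 of the same number. *)
Lemma derive_swap V (A : set V) (F : V -> R) (v w x : V) :
  open A -> A x -> (forall y, A y -> differentiable F y) ->
  differentiable (fun y => 'D_v F y) x -> differentiable (fun y => 'D_w F y) x ->
  'D_w (fun y => 'D_v F y) x = 'D_v (fun y => 'D_w F y) x.
Proof.
move=> oA Ax dF dv dw; apply/eqP; rewrite -subr_eq0 -normr_le0.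
apply/ler_addgt0Pr => e e0; rewrite add0r.
have e20 : 0 < e / 2 by rewrite divr_gt0.
have h1 := second_difference_derive w oA Ax dF dv e20.
have h2 := second_difference_derive v oA Ax dF dw e20.
have h3 : \forall t \near (0 : R)^'+, 0 < t by exact: nbhs_right_gt.
have [t [k1 [k2 t0]]] := filter_ex (filterI h1 (filterI h2 h3)).
rewrite -(@ler_pM2r _ (t ^+ 2)) ?exprn_gt0//.
rewrite -[X in _ * X <= _]ger0_norm ?exprn_ge0 ?(ltW t0)// -normrM.
move: k1 k2; rewrite [t *: w + (_ + _)]addrCA.
move: (F _) (F _) (F _) (F _) ('D_w _ x) ('D_v _ x) (t^+2) => a b c d p q s.
rewrite !ler_norml => /andP[k1 k2] /andP[k3 k4]; apply/andP; split; lra.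
Qed.

End DirectionalCalculus.

Section SmoothClasses.
Variable R : realType.
Implicit Types V W U : normedModType R.

Lemma near_open_eq V (W : Type) (A : set V) (F G : V -> W) (x : V) :
  open A -> A x -> (forall y, A y -> F y = G y) -> \near x, F x = G x.
Proof. by move=> oA Ax FG; apply: filterS FG _; exact: open_nbhs_nbhs. Qed.

(* C^(k+1) in the sense of [smooth_on]: up to [k] directional derivatives are taken before
   differentiability is required. *)
Definition smooth_upto (k : nat) V W (A : set V) (F : V -> W) : Prop :=
  forall (vs : seq V) (x : V), (size vs <= k)%N -> A x ->
    differentiable (foldr (fun v (G : V -> W) => fun y => 'D_v G y) F vs) x.

Lemma smooth_onP V W (A : set V) (F : V -> W) :
  smooth_on A F <-> forall k, smooth_upto k A F.
Proof. by split=> [sF k vs x _|sF vs x]; [exact: sF|exact: (sF (size vs))]. Qed.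

Lemma smooth_upto0 V W (A : set V) (F : V -> W) :
  smooth_upto 0 A F <-> forall x, A x -> differentiable F x.
Proof.
split=> [sF x|sF [|//] x _]; [exact: (sF [::])|exact: sF].
Qed.

(** The last vector of the list is the innermost derivative, so peeling the list from its right end
    replaces [F] by ['D_v F]. Inductions on the order of smoothness run through this form. *)
Lemma smooth_uptoS k V W (A : set V) (F : V -> W) :
  smooth_upto k.+1 A F <-> (forall x, A x -> differentiable F x) /\
    forall v, smooth_upto k A (fun y => 'D_v F y).
Proof.
split=> [sF|[dF sF] vs x].
  split=> [x|v vs x vsk Ax]; first exact: (sF [::]).
  by have := sF (rcons vs v) x; rewrite size_rcons foldr_rcons => /(_ vsk Ax).
case/lastP: vs => [|vs v] /=; first by move=> _; exact: dF.
by rewrite size_rcons foldr_rcons; exact: sF.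
Qed.

Lemma smooth_upto_diff k V W (A : set V) (F : V -> W) x :
  smooth_upto k A F -> A x -> differentiable F x.
Proof. by move=> sF; exact: (sF [::]). Qed.

Lemma smooth_upto_le k l V W (A : set V) (F : V -> W) :
  (k <= l)%N -> smooth_upto l A F -> smooth_upto k A F.
Proof. by move=> kl sF vs x vsk; apply: sF; exact: leq_trans kl. Qed.

Lemma smooth_uptoW k V W (A : set V) (F : V -> W) :
  smooth_upto k.+1 A F -> smooth_upto k A F.
Proof. exact: smooth_upto_le. Qed.

Lemma eq_smooth_upto k V W (A : set V) (F G : V -> W) :
  open A -> (forall x, A x -> F x = G x) -> smooth_upto k A F -> smooth_upto k A G.
Proof.
move=> oA; elim: k F G => [|k IH] F G FG.
  rewrite !smooth_upto0 => dF x Ax; apply: (@near_eq_differentiable _ _ _ F); last exact: dF.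
  exact: near_open_eq oA Ax FG.
rewrite !smooth_uptoS => -[dF sF]; split.
  move=> x Ax; apply: (@near_eq_differentiable _ _ _ F); last exact: dF.
  exact: near_open_eq oA Ax FG.
move=> v; apply: IH (sF v) => x Ax; apply: near_eq_derive.
exact: near_open_eq oA Ax FG.
Qed.

Lemma smooth_upto_cst k V W (A : set V) (c : W) : smooth_upto k A (fun _ : V => c).
Proof.
elim: k c => [|k IH] c; first by rewrite smooth_upto0.
rewrite smooth_uptoS; split=> // v.
by rewrite [X in smooth_upto _ _ X](_ : _ = fun _ => 0)//; apply/funext => y; exact: derive_cst.
Qed.

Lemma smooth_upto_lin k V W (A : set V) (L : {linear V -> W}) :
  continuous L -> smooth_upto k A L.
Proof.
move=> cL; have dL x : differentiable L x by exact: linear_differentiable.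
case: k => [|k]; first by rewrite smooth_upto0.
rewrite smooth_uptoS; split=> // v.
rewrite [X in smooth_upto _ _ X](_ : _ = fun _ => L v); first exact: smooth_upto_cst.
by apply/funext => y; rewrite deriveE// diff_lin.
Qed.

Lemma smooth_uptoD k V W (A : set V) (F G : V -> W) : open A ->
  smooth_upto k A F -> smooth_upto k A G -> smooth_upto k A (fun x => F x + G x).
Proof.
move=> oA; elim: k F G => [|k IH] F G.
  by rewrite !smooth_upto0 => dF dG x Ax; apply: differentiableD; [exact: dF|exact: dG].
rewrite !smooth_uptoS => -[dF sF] [dG sG]; split.
  by move=> x Ax; apply: differentiableD; [exact: dF|exact: dG].
move=> v; apply: (@eq_smooth_upto _ _ _ _ _ _ oA _ (IH _ _ (sF v) (sG v))) => x Ax.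
by rewrite [RHS]deriveD//; apply: diff_derivable; [exact: dF|exact: dG].
Qed.

Lemma smooth_uptoM k V (A : set V) (F G : V -> R) : open A ->
  smooth_upto k A F -> smooth_upto k A G -> smooth_upto k A (fun x => F x * G x).
Proof.
move=> oA; elim: k F G => [|k IH] F G.
  by rewrite !smooth_upto0 => dF dG x Ax; apply: differentiableM; [exact: dF|exact: dG].
move=> sF sG; have := sF; have := sG; rewrite !smooth_uptoS => -[dG s'G] [dF s'F]; split.
  by move=> x Ax; apply: differentiableM; [exact: dF|exact: dG].
move=> v; have s1 := IH _ _ (smooth_uptoW sF) (s'G v).
have s2 := IH _ _ (smooth_uptoW sG) (s'F v).
apply: (@eq_smooth_upto _ _ _ _ _ _ oA _ (smooth_uptoD oA s1 s2)) => x Ax.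
by rewrite [RHS]deriveM//; apply: diff_derivable; [exact: dF|exact: dG].
Qed.

Lemma smooth_upto_linl k V W U (A : set V) (F : V -> W) (L : {linear W -> U}) :
  open A -> continuous L -> smooth_upto k A F -> smooth_upto k A (fun x => L (F x)).
Proof.
move=> oA cL; have dL x : differentiable L x by exact: linear_differentiable.
elim: k F => [|k IH] F.
  by rewrite !smooth_upto0 => dF x Ax; apply: differentiable_comp => //; exact: dF.
rewrite !smooth_uptoS => -[dF sF]; split.
  by move=> x Ax; apply: differentiable_comp => //; exact: dF.
move=> v; apply: (@eq_smooth_upto _ _ _ _ _ _ oA _ (IH _ (sF v))) => x Ax.
rewrite [RHS](deriveE _ (differentiable_comp (dF _ Ax) (dL _))) diff_comp//=; last exact: dF.
by rewrite (deriveE _ (dF _ Ax)) diff_lin.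
Qed.

Lemma smooth_upto_linr k V W U (A : set V) (B : set W) (F : W -> U) (L : {linear V -> W}) :
  open A -> continuous L -> (forall x, A x -> B (L x)) ->
  smooth_upto k B F -> smooth_upto k A (fun x => F (L x)).
Proof.
move=> oA cL AB; have dL x : differentiable L x by exact: linear_differentiable.
elim: k F => [|k IH] F.
  by rewrite !smooth_upto0 => dF x Ax; apply: differentiable_comp => //; exact/dF/AB.
rewrite !smooth_uptoS => -[dF sF]; split.
  by move=> x Ax; apply: differentiable_comp => //; exact/dF/AB.
move=> v; apply: (@eq_smooth_upto _ _ _ _ _ _ oA _ (IH _ (sF (L v)))) => x Ax.
have dFx := dF _ (AB _ Ax).
by rewrite [RHS](deriveE _ (differentiable_comp (dL x) dFx)) diff_comp//= (deriveE _ dFx) diff_lin.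
Qed.

(** Finite dimension in the form that the chain rule needs: an expansion with continuous
    coefficients. The instances are the line, row vectors, and the product of the line with row
    vectors. *)
Definition coordinates U (I : finType) (e : I -> U) (l : I -> {linear U -> R}) :=
  (forall a, continuous (l a)) /\ forall u, u = \sum_a l a u *: e a.

Lemma smooth_upto_sum k V (I : finType) (A : set V) (F : I -> V -> R) : open A ->
  (forall i, smooth_upto k A (F i)) -> smooth_upto k A (fun x => \sum_i F i x).
Proof.
move=> oA sF; rewrite -[index_enum I]/(index_enum I).
elim: (index_enum I) => [|i r IH].
  by rewrite [X in smooth_upto _ _ X](_ : _ = fun _ => 0); [exact: smooth_upto_cst|apply/funext => x; rewrite big_nil].
rewrite [X in smooth_upto _ _ X](_ : _ = fun x => F i x + \sum_(j <- r) F j x); first exact: smooth_uptoD.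
by apply/funext => x; rewrite big_cons.
Qed.

Lemma differentiable_coordinates V U (I : finType) (e : I -> U) l (T : V -> U) x :
  coordinates e l -> (forall a, differentiable (fun y => l a (T y)) x) ->
  differentiable T x.
Proof.
move=> [cl lE] dT; rewrite (_ : T = fun y => \sum_a l a (T y) *: e a); last first.
  by apply/funext => y; rewrite -lE.
elim: (index_enum I) => [|i r IH].
  by rewrite (_ : (fun y => _) = fun _ => 0)//; apply/funext => y; rewrite big_nil.
rewrite (_ : (fun y => _) = fun y => l i (T y) *: e i + \sum_(j <- r) l j (T y) *: e j).
  by apply: differentiableD => //; apply: differentiableZl.
by apply/funext => y; rewrite big_cons.
Qed.

Lemma derive_comp_coordinates V U (I : finType) (e : I -> U) l (T : V -> U) (F : U -> R) x v :
  coordinates e l -> (forall a, differentiable (fun y => l a (T y)) x) ->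
  differentiable F (T x) ->
  'D_v (fun y => F (T y)) x =
  \sum_a 'D_v (fun y => l a (T y)) x * 'D_(e a) F (T x).
Proof.
move=> ce dlT dF; have dT := differentiable_coordinates ce dlT.
rewrite (deriveE _ (differentiable_comp dT dF)) diff_comp//=.
rewrite [in LHS](ce.2 ('d T x v)) linear_sum/=; apply: eq_bigr => a _.
have dla : differentiable (l a) (T x) by apply: linear_differentiable; exact: ce.1.
rewrite linearZ/= (deriveE _ (dlT a)) (diff_comp dT dla)/= diff_lin; last exact: ce.1.
by rewrite deriveE.
Qed.

(** The derivative of the composite is a sum of products of a derivative of a component of [T] with
    a derivative of [F] composed with [T]. The latter is again a composite, of one order less, so
    the induction is over all [F]. *)
Lemma smooth_upto_comp k V U (I : finType) (e : I -> U) l (A : set V) (B : set U)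
    (T : V -> U) (F : U -> R) :
  coordinates e l -> open A -> (forall x, A x -> B (T x)) ->
  (forall a, smooth_upto k A (fun y => l a (T y))) -> smooth_upto k B F ->
  smooth_upto k A (fun x => F (T x)).
Proof.
move=> ce oA AB; elim: k F => [|k IH] F sT.
  rewrite !smooth_upto0 => dF x Ax; apply: differentiable_comp; last exact/dF/AB.
  by apply: (differentiable_coordinates ce) => a; exact: (smooth_upto_diff (sT a)).
rewrite !smooth_uptoS => -[dF sF].
have dT x a : A x -> differentiable (fun y => l a (T y)) x by exact: (smooth_upto_diff (sT a)).
split.
  move=> x Ax; apply: differentiable_comp; last exact/dF/AB.
  by apply: (differentiable_coordinates ce) => a; exact: dT.
move=> v; apply: (@eq_smooth_upto _ _ _ _ (fun x =>
    \sum_a 'D_v (fun y => l a (T y)) x * 'D_(e a) F (T x)) _ oA).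
  move=> x Ax; rewrite (derive_comp_coordinates _ ce)//; first by move=> a; exact: dT.
  exact/dF/AB.
apply: smooth_upto_sum => // a; apply: smooth_uptoM => //.
  by have /smooth_uptoS[_] := sT a; exact.
by apply: (IH (fun y => 'D_(e a) F y)) => // b; exact: smooth_uptoW (sT b).
Qed.

Lemma coordinates_real : coordinates (fun _ : 'I_1 => 1 : R) (fun _ => idfun).
Proof. by split=> [_ ? //|u]; rewrite big_ord1 [_ *: _]mulr1. Qed.

End SmoothClasses.

Section RealSmoothFunctions.
Variable R : realType.
Implicit Types (F : R -> R) (A : set R).

Lemma derive_real F (t d v : R) : is_derive t 1 F d -> 'D_v F t = d * v.
Proof.
move=> [dF dE]; have dF' : differentiable F t by exact/derivable1_diffP.
rewrite deriveE// -[v in LHS]mulr1 -[v * 1]/(v *: (1 : R)) linearZ/= -deriveE// dE.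
by rewrite [RHS]mulrC.
Qed.

(** Bootstrapping: the functions below have derivatives built from functions of the same kind, so
    the order of smoothness rises by one at each pass. *)
Lemma smooth_upto_real k A F (F' : R -> R) : open A ->
  (forall t, A t -> is_derive t 1 F (F' t)) -> smooth_upto k A F' ->
  smooth_upto k.+1 A F.
Proof.
move=> oA dF sF'; rewrite smooth_uptoS; split.
  by move=> t /dF[/derivable1_diffP].
move=> v; have := smooth_uptoM oA sF' (@smooth_upto_cst R k _ _ A v).
by apply: eq_smooth_upto => // t /dF /derive_real->.
Qed.

Lemma smooth_upto_real0 A F (F' : R -> R) :
  (forall t, A t -> is_derive t 1 F (F' t)) -> smooth_upto 0 A F.
Proof. by rewrite smooth_upto0 => dF t /dF[/derivable1_diffP]. Qed.

Lemma smooth_expR : smooth_on [set: R] (@expR R).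
Proof.
apply/smooth_onP; elim=> [|k IH].
  by apply: smooth_upto_real0 => t _; exact: is_derive_expR.
by apply: (smooth_upto_real openT) IH => t _; exact: is_derive_expR.
Qed.

Lemma smooth_inv : smooth_on [set t : R | t != 0] (fun t : R => t^-1).
Proof.
have oA : open [set t : R | t != 0] by exact: open_neq.
have dV (t : R) : t != 0 -> is_derive t 1 (fun t : R => t^-1) (- 1 * (t^-1 * t^-1)).
  move=> t0; apply: is_derive_eq; first exact: is_deriveV.
  by rewrite /= [_ *: _]mulr1 -invrM ?unitfE// mulN1r.
apply/smooth_onP; elim=> [|k IH]; first exact: smooth_upto_real0 dV.
apply: (smooth_upto_real oA dV).
by apply: smooth_uptoM => //; [exact: smooth_upto_cst|exact: smooth_uptoM].
Qed.

Lemma smooth_sqrt : smooth_on [set t : R | 0 < t] (@Num.sqrt R).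
Proof.
have oA : open [set t : R | 0 < t] by exact: open_gt.
have dV (t : R) : 0 < t -> is_derive t 1 (@Num.sqrt R) ((2 * Num.sqrt t)^-1).
  by move=> t0; exact: is_derive1_sqrt.
apply/smooth_onP; elim=> [|k IH]; first exact: smooth_upto_real0 dV.
apply: (smooth_upto_real oA dV).
have /smooth_onP/(_ k) sV := smooth_inv.
apply: (smooth_upto_comp (coordinates_real R) oA _ _ sV) => /= [x x0|_].
  by rewrite mulf_neq0// sqrtr_eq0 -ltNge.
by apply: smooth_uptoM => //; exact: smooth_upto_cst.
Qed.

(** The case m = 0 is the classical function flat at 0. The powers of 1/t are included to make the
    family closed under differentiation. *)
Definition flat_exp (m : nat) (t : R) : R :=
  if 0 < t then t ^- m * expR (- t^-1) else 0.

Lemma flat_exp_ge0 m t : 0 <= flat_exp m t.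
Proof.
by rewrite /flat_exp; case: ifP => // t0; rewrite mulr_ge0 ?expR_ge0// invr_ge0 exprn_ge0 ?ltW.
Qed.

(** One term of the exponential series at 1/t, of degree m + 2, beats the factor t^-m and leaves
    t^2. A quadratic bound is what makes the derivative at 0 vanish. *)
Lemma flat_exp_quadratic m t : flat_exp m t <= (m.+2)`!%:R * t ^+ 2.
Proof.
rewrite /flat_exp; case: ifP => [t0|_]; last by rewrite mulr_ge0 ?sqr_ge0.
have N0 : 0 < (m.+2)`!%:R :> R by rewrite ltr0n fact_gt0.
have tV0 : 0 <= t^-1 by rewrite invr_ge0 ltW.
have h : t ^- (m.+2) / (m.+2)`!%:R <= expR t^-1.
  have := expR_ge1Dxn m.+1 tV0; rewrite -exprVn; apply: le_trans.
  by rewrite lerDr.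
rewrite expRN -exprVn ler_pdivrMr ?expR_gt0//.
rewrite (le_trans _ (ler_wpM2l _ h))//; last by rewrite mulr_ge0 ?sqr_ge0 ?ltW.
rewrite -exprVn -addn2 exprD le_eqVlt; apply/orP; left; apply/eqP; field.
by rewrite !gt_eqF// ltr0n fact_gt0.
Qed.

Lemma flat_exp_derive m (t : R) :
  is_derive t 1 (flat_exp m) (flat_exp m.+2 t - m%:R * flat_exp m.+1 t).
Proof.
have [t0|t0|<-] := ltgtP 0 t.
- have dV : is_derive t 1 (fun s : R => s ^- m * expR (- s^-1))
      (flat_exp m.+2 t - m%:R * flat_exp m.+1 t).
    have tn0 : t != 0 by rewrite gt_eqF.
    have d1 : is_derive t 1 (fun s : R => s^-1) (- (t ^- 2)).
      apply: is_derive_eq; first exact: is_deriveV.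
      by rewrite /= [_ *: _]mulr1.
    have d2 : is_derive t 1 (fun s : R => expR (- s^-1)) (t ^- 2 * expR (- t^-1)).
      have d2 : is_derive t 1 (fun s : R => - s^-1) (t ^- 2).
        by apply: is_derive_eq; rewrite opprK.
      rewrite mulrC.
      exact: (@is_derive1_comp R expR (fun s => - s^-1) t _ _ (is_derive_expR (- t^-1)) d2).
    have -> : (fun s : R => s ^- m * expR (- s^-1)) =
        ((fun s : R => s^-1) ^+ m) * (fun s : R => expR (- s^-1)).
      by apply/funext => s; rewrite !fctE -exprVn.
    apply: is_derive_eq.
    rewrite /flat_exp t0 exprfctE -!exprVn /GRing.scale/=.
    by case: (m) => [|k] /=; rewrite ?exprS; ring.
  apply: near_eq_is_derive dV; near=> s; rewrite /flat_exp.
  suff -> : 0 < s by [].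
  by near: s; exact: lt_nbhsr.
- have dV : is_derive t 1 (fun s : R => 0 : R) (flat_exp m.+2 t - m%:R * flat_exp m.+1 t).
    by apply: is_derive_eq; rewrite /flat_exp ltNge (ltW t0)/= mulr0 subr0.
  apply: near_eq_is_derive dV; near=> s; rewrite /flat_exp ltNge.
  suff -> : s <= 0 by [].
  by apply: ltW; near: s; exact: lt_nbhsl.
have -> : flat_exp m.+2 0 - m%:R * flat_exp m.+1 0 = 0 :> R.
  by rewrite /flat_exp ltxx mulr0 subr0.
have cv : h^-1 *: (flat_exp m (h *: 1 + 0) - flat_exp m 0) @[h --> 0^'] --> (0 : R).
  apply/cvgr0Pnorm_le => e e0; near=> h.
  have h0 : h != 0 by near: h; exact: nbhs_dnbhs_neq.
  rewrite {2}/flat_exp ltxx subr0 addr0 [h *: 1]mulr1 normrM normfV.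
  rewrite ler_pdivrMl ?normr_gt0// (ger0_norm (flat_exp_ge0 _ _)).
  rewrite (le_trans (flat_exp_quadratic _ _))// -real_normK ?num_real// expr2 mulrA mulrC.
  rewrite ler_pM2l ?normr_gt0// mulrC -ler_pdivlMr ?ltr0n ?fact_gt0//.
  near: h; apply: dnbhs0_le; rewrite divr_gt0// ltr0n fact_gt0 //.
apply: DeriveDef; first by apply/cvg_ex; exists 0.
exact/cvg_lim.
Unshelve. all: by end_near. Qed.

Lemma smooth_flat_exp m : smooth_on [set: R] (flat_exp m).
Proof.
apply/smooth_onP => k; elim: k m => [|k IH] m.
  by apply: smooth_upto_real0 => t _; exact: flat_exp_derive.
apply: (smooth_upto_real openT) => [t _|]; first exact: flat_exp_derive.
have oT := @openT R.
have -> : (fun t => flat_exp m.+2 t - m%:R * flat_exp m.+1 t) =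
    (fun t => flat_exp m.+2 t + (- m%:R) * flat_exp m.+1 t).
  by apply/funext => t; rewrite mulNr.
apply: smooth_uptoD => //; apply: smooth_uptoM => //; exact: smooth_upto_cst.
Qed.

End RealSmoothFunctions.

Section SmoothOn.
Variables (R : realType) (V : normedModType R).
Implicit Types (A : set V) (F G : V -> R).

Lemma smooth_on_cst (W : normedModType R) A (c : W) : smooth_on A (fun _ : V => c).
Proof. by apply/smooth_onP => k; exact: smooth_upto_cst. Qed.

Lemma eq_smooth_on (W : normedModType R) A (F G : V -> W) :
  open A -> (forall x, A x -> F x = G x) -> smooth_on A F -> smooth_on A G.
Proof.
move=> oA FG /smooth_onP sF; apply/smooth_onP => k.
exact: eq_smooth_upto oA FG (sF k).
Qed.

Lemma smooth_on_sub (W : normedModType R) A (B : set V) (F : V -> W) :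
  A `<=` B -> smooth_on B F -> smooth_on A F.
Proof. by move=> AB sF vs x /AB; exact: sF. Qed.

Lemma smooth_on_derive (W : normedModType R) A (F : V -> W) v :
  smooth_on A F -> smooth_on A (fun x => 'D_v F x).
Proof.
move=> /smooth_onP sF; apply/smooth_onP => k.
by have /smooth_uptoS[_] := sF k.+1; exact.
Qed.

Lemma smooth_on_differentiable (W : normedModType R) A (F : V -> W) x :
  smooth_on A F -> A x -> differentiable F x.
Proof. by move=> sF; exact: (sF [::]). Qed.

Lemma smooth_onD A F G : open A ->
  smooth_on A F -> smooth_on A G -> smooth_on A (fun x => F x + G x).
Proof.
move=> oA /smooth_onP sF /smooth_onP sG; apply/smooth_onP => k.
exact: smooth_uptoD.
Qed.

Lemma smooth_onM A F G : open A ->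
  smooth_on A F -> smooth_on A G -> smooth_on A (fun x => F x * G x).
Proof.
move=> oA /smooth_onP sF /smooth_onP sG; apply/smooth_onP => k.
exact: smooth_uptoM.
Qed.

Lemma smooth_on_comp (U : normedModType R) (I : finType) (e : I -> U) l A (B : set U)
    (T : V -> U) (F : U -> R) :
  coordinates e l -> open A -> (forall x, A x -> B (T x)) ->
  (forall a, smooth_on A (fun y => l a (T y))) -> smooth_on B F ->
  smooth_on A (fun x => F (T x)).
Proof.
move=> ce oA AB sT /smooth_onP sF; apply/smooth_onP => k.
by apply: (smooth_upto_comp ce oA AB) => // a; have /smooth_onP := sT a.
Qed.

Lemma smooth_on_comp_real A (B : set R) F (p : R -> R) : open A ->
  (forall x, A x -> B (F x)) -> smooth_on A F -> smooth_on B p ->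
  smooth_on A (fun x => p (F x)).
Proof.
move=> oA AB sF sp.
exact: (smooth_on_comp (coordinates_real R) oA AB (fun=> sF) sp).
Qed.

End SmoothOn.

(** * The ring of smooth functions on an open set *)

Record open_domain (R : realType) (V : normedModType R) :=
  OpenDomain { open_domain_set :> set V; open_domainP : open open_domain_set }.

Section SmoothRing.
Variables (R : realType) (V : normedModType R) (O : open_domain V).
Local Notation OO := (open_domain_set O).

(* Vanishing off [O] makes functions that agree on [O] equal; the unit is the indicator of [O]. *)
Definition smooth_ring_pred : {pred V -> R} :=
  fun F => `[< smooth_on OO F /\ forall x, ~ OO x -> F x = 0 >].

Record sfun := SFun { sfun_val :> V -> R; sfun_valP : sfun_val \in smooth_ring_pred }.

HB.instance Definition _ := [isSub for sfun_val].
HB.instance Definition _ := [Choice of sfun by <:].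

Lemma sfun_smooth (a : sfun) : smooth_on OO a.
Proof. by have /asboolP[] := sfun_valP a. Qed.

Lemma sfun_off (a : sfun) x : ~ OO x -> a x = 0.
Proof. by have /asboolP[_] := sfun_valP a; exact. Qed.

Lemma sfun_eq (a b : sfun) : (forall x, OO x -> a x = b x) -> a = b.
Proof.
move=> ab; apply/val_inj/funext => x /=; have [/ab//|nOx] := pselect (OO x).
by rewrite !sfun_off.
Qed.

Lemma patch_smooth_ring (F : V -> R) : smooth_on OO F ->
  patch (fun _ => 0) OO F \in smooth_ring_pred.
Proof.
move=> sF; apply/asboolP; split; last by move=> x nOx; rewrite patchN// notin_setE.
apply/smooth_onP => k; apply: (@eq_smooth_upto _ _ _ _ _ F); first exact: open_domainP.
  by move=> x Ox; rewrite patchT// inE.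
by move/smooth_onP: sF; exact.
Qed.

(** Smoothness is placed inside the existential to make [to_sfun] total: matrices of ring elements
    can be written down first and their entries justified later. On a function that is not smooth
    the value is arbitrary. *)
Fact to_sfun_subproof (F : V -> R) :
  exists a : sfun, smooth_on OO F -> forall x, OO x -> a x = F x.
Proof.
have [sF|nsF] := pselect (smooth_on OO F).
  by exists (SFun (patch_smooth_ring sF)) => _ x Ox; rewrite /= patchT// inE.
by exists (SFun (patch_smooth_ring (@smooth_on_cst R V _ OO (0 : R)))).
Qed.

Definition to_sfun (F : V -> R) : sfun := sval (cid (to_sfun_subproof F)).

Lemma to_sfunE F x : smooth_on OO F -> OO x -> to_sfun F x = F x.
Proof. by rewrite /to_sfun; case: cid => a aP /= /aP; exact. Qed.

Lemma smooth_ring_zmod_closed : GRing.zmod_closed smooth_ring_pred.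
Proof.
split=> [|F G /asboolP[sF F0] /asboolP[sG G0]].
  by apply/asboolP; split=> //; exact: smooth_on_cst.
apply/asboolP; split; last by move=> x nOx; rewrite !fctE F0// G0// subr0.
apply/smooth_onP => k; move/smooth_onP: sF => /(_ k) sF; move/smooth_onP: sG => /(_ k) sG.
have oO := open_domainP O.
apply: (@eq_smooth_upto _ _ _ _ _ (fun x => F x + (-1) * G x)) => //.
  by move=> x _; rewrite mulN1r.
by apply: smooth_uptoD => //; apply: smooth_uptoM => //; exact: smooth_upto_cst.
Qed.
HB.instance Definition _ := GRing.isZmodClosed.Build _ smooth_ring_pred smooth_ring_zmod_closed.
HB.instance Definition _ := [SubChoice_isSubZmodule of sfun by <:].

Lemma sfun_one_subproof : patch (fun _ => 0) OO (fun _ => 1 : R) \in smooth_ring_pred.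
Proof. by apply: patch_smooth_ring; exact: smooth_on_cst. Qed.
Definition sfun_one := SFun sfun_one_subproof.

Lemma sfun_mul_subproof (a b : sfun) : (fun x => a x * b x) \in smooth_ring_pred.
Proof.
apply/asboolP; split; last by move=> x nOx; rewrite sfun_off// mul0r.
apply/smooth_onP => k; apply: smooth_uptoM; first exact: open_domainP.
  by have /smooth_onP := sfun_smooth a; exact.
by have /smooth_onP := sfun_smooth b; exact.
Qed.
Definition sfun_mul a b := SFun (sfun_mul_subproof a b).

Lemma sfun_mulA : associative sfun_mul.
Proof. by move=> a b c; apply: sfun_eq => x _ /=; rewrite mulrA. Qed.
Lemma sfun_mulC : commutative sfun_mul.
Proof. by move=> a b; apply: sfun_eq => x _ /=; rewrite mulrC. Qed.
Lemma sfun_mul1 : left_id sfun_one sfun_mul.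
Proof. by move=> a; apply: sfun_eq => x Ox /=; rewrite patchT ?mul1r// inE. Qed.
Lemma sfun_mulDl : left_distributive sfun_mul +%R.
Proof. by move=> a b c; apply: sfun_eq => x _ /=; rewrite -mulrDl. Qed.
(** The domain may be empty, as for the overlap of two disjoint charts; then 1 = 0, so only a
    possibly zero ring can be declared. *)
HB.instance Definition _ := GRing.Zmodule_isComPzRing.Build sfun
  sfun_mulA sfun_mulC sfun_mul1 sfun_mulDl.

Lemma sfunD (a b : sfun) x : (a + b) x = a x + b x. Proof. by []. Qed.
Lemma sfunN (a : sfun) x : (- a) x = - a x. Proof. by []. Qed.
Lemma sfunB (a b : sfun) x : (a - b) x = a x - b x. Proof. by []. Qed.
Lemma sfunM (a b : sfun) x : (a * b) x = a x * b x. Proof. by []. Qed.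
Lemma sfun0 x : (0 : sfun) x = 0. Proof. by []. Qed.
Lemma sfun1 x : OO x -> (1 : sfun) x = 1.
Proof. by move=> Ox; rewrite [LHS]patchT// inE. Qed.

Lemma sfun_sum (I : Type) (r : seq I) (P : pred I) (a : I -> sfun) x :
  (\sum_(i <- r | P i) a i) x = \sum_(i <- r | P i) a i x.
Proof. by elim/big_rec2: _ => //= i y b Pi <-. Qed.

Lemma sfun_prod (I : Type) (r : seq I) (P : pred I) (a : I -> sfun) x : OO x ->
  (\prod_(i <- r | P i) a i) x = \prod_(i <- r | P i) a i x.
Proof.
by move=> Ox; elim/big_rec2: _ => [|i y b Pi <-]; [exact: sfun1|rewrite sfunM].
Qed.

Lemma sfun_sign (b : bool) x : OO x -> ((-1) ^+ b : sfun) x = (-1) ^+ b.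
Proof. by move=> Ox; case: b; rewrite ?expr1 ?expr0 ?sfunN sfun1. Qed.

Lemma sfun_det n (G : 'M[sfun]_n) x : OO x ->
  (\det G) x = \det (map_mx (fun a : sfun => a x) G).
Proof.
move=> Ox; rewrite /determinant sfun_sum; apply: eq_bigr => s _.
rewrite sfunM sfun_sign// sfun_prod//; congr (_ * _).
by apply: eq_bigr => i _; rewrite mxE.
Qed.

Definition sder (v : V) (a : sfun) : sfun := to_sfun (fun x => 'D_v a x).

Lemma sderE v (a : sfun) x : OO x -> sder v a x = 'D_v a x.
Proof. by move=> Ox; rewrite to_sfunE//; apply: smooth_on_derive; exact: sfun_smooth. Qed.

Lemma sfun_differentiable (a : sfun) x : OO x -> differentiable a x.
Proof. by move=> Ox; exact: (smooth_on_differentiable (sfun_smooth a)). Qed.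

Lemma sder_is_zmod_morphism v : zmod_morphism (sder v).
Proof.
move=> a b; apply: sfun_eq => x Ox; rewrite sfunB !sderE//.
by rewrite -deriveB//; apply: diff_derivable; exact: sfun_differentiable.
Qed.
HB.instance Definition _ v := GRing.isZmodMorphism.Build sfun sfun (sder v)
  (sder_is_zmod_morphism v).

Lemma sderM v (a b : sfun) : sder v (a * b) = sder v a * b + a * sder v b.
Proof.
apply: sfun_eq => x Ox; rewrite sfunD !sfunM !sderE//.
rewrite (_ : sfun_val _ = (a : V -> R) * (b : V -> R))//.
by rewrite deriveM; [rewrite addrC mulrC|apply: diff_derivable; exact: sfun_differentiable..].
Qed.

Lemma sderC v w (a : sfun) : sder v (sder w a) = sder w (sder v a).
Proof.
apply: sfun_eq => x Ox; apply: etrans (sderE v (sder w a) Ox) _.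
apply: etrans (esym (sderE w (sder v a) Ox)).
have E u : \near x, sder u a x = 'D_u a x.
  by apply: (near_open_eq (open_domainP O) Ox) => y; exact: sderE.
rewrite (near_eq_derive _ (E w)) (near_eq_derive _ (E v)).
have d u : differentiable (fun y => 'D_u a y) x.
  apply: (near_eq_differentiable (E u)); exact: sfun_differentiable.
by apply: (derive_swap (open_domainP O)) => // y; exact: sfun_differentiable.
Qed.

Definition sconst (c : R) : sfun := to_sfun (fun _ => c).

Lemma sconstE c x : OO x -> sconst c x = c.
Proof. by move=> Ox; rewrite to_sfunE//; exact: smooth_on_cst. Qed.

Lemma sconst_half : (1 + 1) * sconst 2^-1 = 1.
Proof.
apply: sfun_eq => x Ox; rewrite sfunM sfunD sconstE// sfun1//.
by rewrite mulfV// gt_eqF// -[1 + 1]/(2%:R).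
Qed.

Lemma to_sfunV (a : sfun) : (forall x, OO x -> a x != 0) ->
  a * to_sfun (fun x => (a x)^-1) = 1.
Proof.
move=> a0; apply: sfun_eq => x Ox; rewrite sfunM to_sfunE//.
  by rewrite sfun1// mulfV// a0.
exact: smooth_on_comp_real (open_domainP O) a0 (sfun_smooth a) (@smooth_inv R).
Qed.

Lemma to_sfun_eq (F : V -> R) (a : sfun) :
  (forall x, OO x -> F x = a x) -> to_sfun F = a.
Proof.
move=> Fa; apply: sfun_eq => x Ox; rewrite to_sfunE ?Fa//.
apply: (eq_smooth_on (open_domainP O) _ (sfun_smooth a)) => y Oy; exact/esym/Fa.
Qed.
End SmoothRing.

(** * Tensor calculus over a ring with commuting derivations *)

Section TensorCalculus.
Variables (A : comPzRingType) (n : nat).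

Definition derivation (D : A -> A) := forall a b, D (a * b) = D a * b + a * D b.

Lemma derivation1 (D : {additive A -> A}) : derivation D -> D 1 = 0.
Proof.
move=> dD; have := dD 1 1; rewrite !mulr1 mul1r => h.
by apply: (@addrI _ (D 1)); rewrite addr0 -h.
Qed.

Lemma derivation_mx (D : {additive A -> A}) m p q (X : 'M[A]_(m, p)) (Y : 'M[A]_(p, q)) :
  derivation D -> map_mx D (X *m Y) = map_mx D X *m Y + X *m map_mx D Y.
Proof.
move=> dD; apply/matrixP => i j; rewrite !mxE raddf_sum -big_split/=.
by apply: eq_bigr => k _; rewrite !mxE dD.
Qed.

Lemma derivation_mx1 (D : {additive A -> A}) m : derivation D ->
  map_mx D (1%:M : 'M[A]_m) = 0.
Proof.
move=> dD; apply/matrixP => i j; rewrite !mxE; case: (i == j); rewrite ?raddf0//.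
by rewrite mulr1n derivation1.
Qed.

Lemma derivation_inv (D : {additive A -> A}) m (g P : 'M[A]_m) : derivation D ->
  P *m g = 1%:M -> g *m P = 1%:M -> map_mx D P = - (P *m map_mx D g *m P).
Proof.
move=> dD Pg gP; have := derivation_mx P g dD; rewrite Pg derivation_mx1//.
move=> /(congr1 (mulmx^~ P)); rewrite mul0mx mulmxDl -[_ *m g *m P]mulmxA gP mulmx1.
by move=> /esym/eqP; rewrite addr_eq0 => /eqP.
Qed.

Lemma derivation_prod (D : {additive A -> A}) (I : eqType) (r : seq I) (F : I -> A) :
  derivation D -> uniq r ->
  D (\prod_(i <- r) F i) = \sum_(i <- r) \prod_(j <- r) if j == i then D (F j) else F j.
Proof.
move=> dD; elim: r => [|i r IH]; first by rewrite !big_nil derivation1.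
move=> /= /andP[ir ur]; rewrite !big_cons dD IH// eqxx; congr (_ * _ + _).
  by apply: eq_big_seq => j jr; case: eqP => // ji; rewrite -ji jr in ir.
rewrite big_distrr/=; apply: eq_big_seq => j jr; rewrite big_cons.
by case: eqP => // ij; rewrite ij jr in ir.
Qed.

(** Jacobi's formula. The Leibniz rule gives a sum of determinants with one differentiated row;
    expansion along that row meets only cofactors of [g], hence the adjugate. *)
Lemma derivation_det (D : {additive A -> A}) m (g P : 'M[A]_m) : derivation D ->
  P *m g = 1%:M -> D (\det g) = \det g * \tr (P *m map_mx D g).
Proof.
move=> dD Pg.
have -> : D (\det g) = \sum_k \det (\matrix_(i, j) if i == k then D (g i j) else g i j).
  rewrite /determinant raddf_sum/= exchange_big/=; apply: eq_bigr => s _.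
  have Dsign (b : bool) : D ((-1) ^+ b) = 0.
    by case: b; rewrite ?expr1 ?expr0 ?raddfN/= derivation1// oppr0.
  rewrite dD Dsign mul0r add0r derivation_prod ?index_enum_uniq// big_distrr/=.
  by apply: eq_bigr => k _; congr (_ * _); apply: eq_bigr => i _; rewrite mxE.
have -> : \det g * \tr (P *m map_mx D g) = \tr (\adj g *m map_mx D g).
  by rewrite -[\adj g]mulmx1 -(mulmx1C Pg) mulmxA mul_adj_mx mul_scalar_mx -scalemxAl mxtraceZ.
rewrite mxtrace_mulC; apply: eq_bigr => k _.
rewrite (expand_det_row _ k) mxE; apply: eq_bigr => l _.
rewrite !mxE eqxx; congr (_ * _); rewrite /cofactor; congr (_ * \det _).
by apply/matrixP => i j; rewrite !mxE eq_sym (negbTE (neq_lift _ _)).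
Qed.

(* Row conventions: [gam i] has (j, k) entry Gamma^k_ij, so the covariant derivative of a row
   of vector components X is d_i X + X *m gam i. *)
Section Connection.
Variables (d : 'I_n -> {additive A -> A}) (half : A).
Hypothesis dM : forall i, derivation (d i).
Hypothesis dC : forall i j a, d i (d j a) = d j (d i a).
Hypothesis halfE : (1 + 1) * half = 1.

Lemma half_cancel (a b : A) : a + a = b + b -> a = b.
Proof.
move=> ab; have E x : x = half * (x + x).
  by rewrite -[LHS]mul1r -halfE; ring.
by rewrite (E a) ab -E.
Qed.

Lemma half_double (a : A) : half * a + half * a = a.
Proof. by rewrite -{3}[a]mul1r -halfE; ring. Qed.

Definition gam (g P : 'M[A]_n) i : 'M[A]_n := \matrix_(j, k)
  (half * \sum_l P k l * (d i (g j l) + d j (g i l) - d l (g i j))).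

(** The entry (a, b) is the component along the b-th field of [nabla_i, nabla_j] applied to the a-th
    coordinate field. Connection matrices act on rows from the right, whence the order of the two
    products. *)
Definition curv (G : 'I_n -> 'M[A]_n) i j : 'M[A]_n :=
  map_mx (d i) (G j) - map_mx (d j) (G i) + G j *m G i - G i *m G j.

Lemma curvE (G : 'I_n -> 'M[A]_n) i j a b : curv G i j a b =
  d i (G j a b) - d j (G i a b) + \sum_m G j a m * G i m b - \sum_m G i a m * G j m b.
Proof. by rewrite !mxE. Qed.

Definition ric (G : 'I_n -> 'M[A]_n) : 'M[A]_n := \matrix_(i, j) \sum_k curv G k j i k.

Definition hess (G : 'I_n -> 'M[A]_n) (a : A) : 'M[A]_n :=
  \matrix_(i, j) (d i (d j a) - \sum_k G i j k * d k a).

Definition dif (a : A) : 'cV[A]_n := \col_j d j a.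

Definition pairing (P X Y : 'M[A]_n) : A :=
  \sum_i \sum_j \sum_k \sum_l P i k * P j l * X i j * Y k l.

Lemma div_mul (Y : 'I_n -> A) (b : A) :
  \sum_k d k (Y k * b) = (\sum_k d k (Y k)) * b + \sum_k Y k * d k b.
Proof. by rewrite big_distrl -big_split/=; apply: eq_bigr => k _; rewrite dM. Qed.

Lemma derivation_half (D : {additive A -> A}) : derivation D -> D half = 0.
Proof.
move=> dD; apply: half_cancel; rewrite addr0 -raddfD/= -[half + half](_ : 1 = _).
  exact: derivation1.
by rewrite -halfE; ring.
Qed.

Section Metric.
Variables (g P : 'M[A]_n).
Hypothesis gT : g^T = g.
Hypothesis Pg : P *m g = 1%:M.
Let gP : g *m P = 1%:M. Proof. exact: mulmx1C Pg. Qed.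
Local Notation G := (gam g P).

Lemma inv_metric_sym : P^T = P.
Proof.
have := congr1 trmx gP; rewrite trmx_mul gT trmx1 => h.
by rewrite -[LHS]mulmx1 -gP mulmxA h mul1mx.
Qed.

Let gs i j : g i j = g j i. Proof. by rewrite -[in RHS]gT mxE. Qed.

Lemma gam_sym i j k : G i j k = G j i k.
Proof.
rewrite !mxE; congr (_ * _); apply: eq_bigr => l _; congr (_ * _).
by rewrite (gs i j); ring.
Qed.

Lemma gam_lower i j l : (G i *m g) j l = half * (d i (g j l) + d j (g i l) - d l (g i j)).
Proof.
have -> : G i = (\matrix_(j, m) (half * (d i (g j m) + d j (g i m) - d m (g i j)))) *m P.
  apply/matrixP => j' k; rewrite !mxE big_distrr/=; apply: eq_bigr => m _.
  have -> : P k m = P m k by rewrite -[in LHS]inv_metric_sym mxE.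
  by rewrite !mxE; ring.
by rewrite -mulmxA Pg mulmx1 mxE.
Qed.

Lemma gam_compat i : map_mx (d i) g = G i *m g + (G i *m g)^T.
Proof.
apply/matrixP => j l; rewrite [RHS]mxE [(_^T) _ _]mxE !gam_lower mxE.
rewrite (gs l j) (gs i j) (gs i l); apply: half_cancel.
rewrite -[LHS]mul1r -halfE; ring.
Qed.

(** The difference of two torsion-free metric connections, with its index lowered, is symmetric in
    the first two indices and antisymmetric in the last two. Six alternating swaps give E = -E. This
    uniqueness is what later yields the transformation law of the Christoffel symbols. *)
Lemma gam_unique (G' : 'I_n -> 'M[A]_n) : (forall i j k, G' i j k = G' j i k) ->
  (forall i, map_mx (d i) g = G' i *m g + (G' i *m g)^T) -> forall i, G' i = G i.
Proof.
move=> sG' cG' i; pose E i j l := (G' i *m g) j l - (G i *m g) j l.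
have Es i' j l : E i' j l = E j i' l.
  rewrite /E !mxE; congr (_ - _); apply: eq_bigr => k _; congr (_ * _).
    exact: sG'.
  exact: gam_sym.
have Ea i' j l : E i' j l = - E i' l j.
  apply/eqP; rewrite -subr_eq0 opprK /E; apply/eqP.
  have := gam_compat i'; rewrite cG' => /matrixP/(_ j l).
  rewrite [LHS]mxE [RHS]mxE [(_^T) _ _]mxE [(G i' *m g)^T _ _]mxE => h.
  by rewrite addrACA h -opprD subrr.
have E0 i' j l : E i' j l = 0.
  apply: half_cancel; rewrite addr0 {2}Ea.
  suff -> : E i' l j = E i' j l by rewrite subrr.
  by rewrite Es Ea Es Ea Es Ea !opprK.
have h : G' i *m g = G i *m g.
  by apply/matrixP => j l; apply/eqP; rewrite -subr_eq0; apply/eqP; exact: E0.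
by rewrite -[LHS]mulmx1 -gP mulmxA h -mulmxA gP mulmx1.
Qed.

Lemma d_inv_metric i : map_mx (d i) P = - (P *m G i) - (G i)^T *m P.
Proof.
rewrite (derivation_inv (dM i) Pg gP) gam_compat trmx_mul gT mulmxDr mulmxDl.
by rewrite opprD -!mulmxA gP mulmx1 (mulmxA P g) Pg mul1mx.
Qed.

Lemma tr_gam i : \tr (P *m map_mx (d i) g) = \tr (G i) + \tr (G i).
Proof.
rewrite gam_compat mulmxDr mxtraceD mxtrace_mulC -mulmxA gP mulmx1; congr (_ + _).
by rewrite trmx_mul gT mulmxA Pg mul1mx mxtrace_tr.
Qed.

(** The volume density enters only as an invertible square root of the determinant; all its
    derivatives follow from [ww] and [wV]. *)
Variables (w winv : A).
Hypothesis ww : w * w = \det g.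
Hypothesis wV : w * winv = 1.

Lemma derivation_density (D : {additive A -> A}) : derivation D ->
  D w + D w = w * \tr (P *m map_mx D g).
Proof.
move=> dD; have := derivation_det dD Pg; rewrite -ww dD => /(congr1 ( *%R winv)).
have -> : winv * (D w * w + w * D w) = (w * winv) * (D w + D w) by ring.
by rewrite wV mul1r => ->; rewrite !mulrA [winv * _]mulrC wV mul1r.
Qed.

Lemma d_density i : d i w = w * \tr (G i).
Proof.
by apply: half_cancel; rewrite derivation_density// tr_gam mulrDr.
Qed.

Lemma d_dens_inv i :
  map_mx (d i) (w *: P) = w *: (\tr (G i) *: P - P *m G i - (G i)^T *m P).
Proof.
apply/matrixP => j k; have := d_inv_metric i => /matrixP/(_ j k).
rewrite !mxE => h; rewrite dM h d_density; ring.
Qed.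

Lemma tr_gamE i : \tr (G i) = \sum_l G l i l.
Proof. by apply: eq_bigr => l _; rewrite gam_sym. Qed.

(** The classical identity that the k-th derivatives of sqrt(g) g^ki sum to - sqrt(g) g^kl
    Gamma^i_kl: the trace term from the density cancels one of the two terms from the inverse
    metric. *)
Lemma div_dens_inv i : \sum_k d k (w * P k i) = - (w * \sum_k (P *m G k) k i).
Proof.
have -> : \sum_k d k (w * P k i) = \sum_k (map_mx (d k) (w *: P)) k i.
  by apply: eq_bigr => k _; rewrite !mxE.
under eq_bigr do rewrite d_dens_inv.
have -> : \sum_k (w *: (\tr (G k) *: P - P *m G k - (G k)^T *m P)) k i =
  w * (\sum_k \tr (G k) * P k i - \sum_k (P *m G k) k i - \sum_k ((G k)^T *m P) k i).
  rewrite -!sumrB big_distrr/=; apply: eq_bigr => k _.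
  rewrite [LHS]mxE; congr (_ * _); move: (P *m G k) ((G k)^T *m P) => X Y.
  by rewrite !mxE.
have -> : \sum_k ((G k)^T *m P) k i = \sum_k \tr (G k) * P k i.
  under eq_bigr do rewrite mxE; rewrite exchange_big/=; apply: eq_bigr => l _.
  by rewrite tr_gamE big_distrl/=; apply: eq_bigr => k _; rewrite mxE.
by ring.
Qed.

Lemma pairingE (X Y : 'M[A]_n) : pairing P X Y = \tr (X^T *m P *m Y *m P).
Proof.
rewrite /pairing exchange_big/=; apply: eq_bigr => j _.
have -> : (X^T *m P *m Y *m P) j j = \sum_i X i j * (P *m Y *m P) i j.
  by rewrite -!mulmxA mxE; apply: eq_bigr => i _; rewrite mxE.
apply: eq_bigr => i _; rewrite mxE big_distrr exchange_big/=.
rewrite exchange_big/=.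
under [RHS]eq_bigr do rewrite mxE big_distrl big_distrr/=.
rewrite [RHS]exchange_big/=; apply: eq_bigr => k _; apply: eq_bigr => l _.
have -> : P j l = P l j by rewrite -[in LHS]inv_metric_sym mxE.
by ring.
Qed.

Lemma pairing_g (X : 'M[A]_n) : pairing P X g = \tr (P *m X).
Proof.
rewrite pairingE -[_ *m P *m g]mulmxA Pg mulmx1 -[LHS]mxtrace_tr.
by rewrite trmx_mul trmxK inv_metric_sym.
Qed.

Lemma pairing_gE (X : 'M[A]_n) : pairing P X g = \sum_i \sum_j P i j * X i j.
Proof.
rewrite pairing_g exchange_big/=; apply: eq_bigr => i _; rewrite mxE.
apply: eq_bigr => j _; congr (_ * _).
by rewrite -[in LHS]inv_metric_sym mxE.
Qed.

Lemma pairing_dyad_g (a b : A) :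
  pairing P (dif a *m (dif b)^T) g = \sum_k \sum_i P k i * d i a * d k b.
Proof.
rewrite pairing_gE exchange_big/=; apply: eq_bigr => k _; apply: eq_bigr => i _.
rewrite mxE big_ord1 !mxE mulrA; congr (_ * _ * _).
by rewrite -[in LHS]inv_metric_sym mxE.
Qed.

(** The divergence form of the Laplacian: differentiating the coefficients produces, by
    [div_dens_inv], exactly the Christoffel term of the Hessian. *)
Lemma div_grad (a : A) :
  \sum_k d k (\sum_i (w * P k i) * d i a) = w * \tr (P *m hess G a).
Proof.
under eq_bigr do rewrite raddf_sum/=.
rewrite exchange_big/=; under eq_bigr do rewrite div_mul.
rewrite big_split/=; under eq_bigr do rewrite div_dens_inv.
have -> : \tr (P *m hess G a) = \sum_i \sum_k P k i * d k (d i a)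
    - \sum_i (\sum_k (P *m G k) k i) * d i a.
  have -> : \sum_i (\sum_k (P *m G k) k i) * d i a =
      \sum_i \sum_k \sum_l P k l * G k l i * d i a.
    apply: eq_bigr => i _; rewrite big_distrl/=; apply: eq_bigr => k _.
    by rewrite mxE big_distrl.
  rewrite -sumrB.
  have -> : \sum_i (\sum_k P k i * d k (d i a) - \sum_k \sum_l P k l * G k l i * d i a) =
    \sum_k \sum_i P k i * d k (d i a) - \sum_k \sum_l P k l * (\sum_i G k l i * d i a).
    rewrite sumrB; congr (_ - _); first by rewrite exchange_big.
    rewrite exchange_big/=; apply: eq_bigr => k _; rewrite exchange_big/=.
    apply: eq_bigr => l _; rewrite big_distrr/=; apply: eq_bigr => i _; ring.
  rewrite -sumrB; apply: eq_bigr => k _; rewrite mxE -sumrB; apply: eq_bigr => i _.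
  rewrite [hess _ _ _ _]mxE -mulrBr (dC k i); congr (_ * (_ - _)).
  by apply: eq_bigr => l _; rewrite gam_sym.
rewrite mulrBr addrC; congr (_ + _).
  rewrite big_distrr/=; apply: eq_bigr => i _; rewrite big_distrr/=.
  by apply: eq_bigr => k _; rewrite mulrA.
by rewrite big_distrr/= -sumrN; apply: eq_bigr => i _; ring.
Qed.

Lemma div_laplacian (a b : A) :
  \sum_k d k ((\sum_i (w * P k i) * d i a) * b) =
  w * (pairing P (hess G a) g * b + pairing P (dif a *m (dif b)^T) g).
Proof.
rewrite div_mul div_grad pairing_g mulrDr mulrA; congr (_ + _).
rewrite pairing_dyad_g big_distrr/=; apply: eq_bigr => k _.
by rewrite big_distrl big_distrr/=; apply: eq_bigr => i _; rewrite !mulrA.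
Qed.

Lemma density_cancel (a b : A) : w * a = w * b -> a = b.
Proof.
by move=> ab; rewrite -[a]mul1r -[b]mul1r -wV [w * _]mulrC -!mulrA ab.
Qed.

Lemma d_dens_invE i : map_mx (d i) (w *: P) =
  \tr (G i) *: (w *: P) - (w *: P) *m G i - (G i)^T *m (w *: P).
Proof.
by rewrite d_dens_inv !scalerBr !scalerA [w * _]mulrC scalemxAl scalemxAr.
Qed.

Section Variation.
Variable D : {additive A -> A}.
Hypothesis dD : derivation D.
Hypothesis DC : forall i a, D (d i a) = d i (D a).
Local Notation h := (map_mx D g).
Local Notation T := (pairing P h g).
Local Notation Q := (w *: P).
Local Notation C i := (map_mx D (G i)).

Lemma var_density : D w = half * T * w.
Proof.
apply: half_cancel; rewrite derivation_density// pairing_g -[in LHS](half_double (\tr _)); ring.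
Qed.

Lemma var_inv : map_mx D P = - (P *m h *m P).
Proof. exact: (derivation_inv dD Pg gP). Qed.

Lemma var_tr_gam i : D (\tr (G i)) = half * d i T.
Proof.
have E : w * D (\tr (G i)) = w * (half * d i T).
  have := congr1 D (d_density i); rewrite dD DC var_density !dM derivation_half//.
  rewrite mul0r add0r d_density => h1.
  by apply: (@addrI _ (half * T * w * \tr (G i))); rewrite -h1; ring.
exact: density_cancel.
Qed.

Lemma var_dens_inv : map_mx D Q = w *: (half * T *: P - P *m h *m P).
Proof.
have := var_inv => /matrixP E; apply/matrixP => i j; have := E i j.
by rewrite !mxE => e; rewrite dD e var_density; ring.
Qed.

(** The Palatini field sqrt(g) (g^ij dGamma^k_ij - g^kl dGamma^j_jl), where dGamma is the variation
    of the connection. *)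
Definition ricci_flux k : A := \sum_j (Q *m C j) j k - \sum_l (Q *m C l) k l.

(** The variation of the Ricci tensor is a covariant divergence of dGamma. By [d_dens_invE] the
    derivatives of [Q] are expressed by [Q] and the connection, so divergence and variation of
    curvature differ only by terms bilinear in Gamma and dGamma. *)
Lemma palatini : \sum_k d k (ricci_flux k) = w * \tr (P *m map_mx D (ric G)).
Proof.
have -> : w * \tr (P *m map_mx D (ric G)) =
    \sum_j \sum_k (Q *m map_mx D (curv G k j)) j k.
  rewrite big_distrr/=; apply: eq_bigr => j _; rewrite mxE big_distrr/=.
  under eq_bigr do rewrite !mxE raddf_sum !big_distrr/=.
  rewrite exchange_big/=; apply: eq_bigr => k _; rewrite mxE; apply: eq_bigr => i _.
  by rewrite !mxE mulrA.
have -> : \sum_k d k (ricci_flux k) =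
   \sum_j \sum_k (map_mx (d k) (Q *m C j) - map_mx (d j) (Q *m C k)) j k.
  under eq_bigr do rewrite raddfB/= !raddf_sum/=.
  rewrite big_split/= [X in X + _ = _]exchange_big/= -big_split; apply: eq_bigr => j _.
  rewrite -big_split; apply: eq_bigr => k _ /=.
  by move: (Q *m C j) (Q *m C k) => X Y; rewrite !mxE.
have DG k j : map_mx D (map_mx (d k) (G j)) = map_mx (d k) (C j).
  by apply/matrixP => a b; rewrite !mxE DC.
have E j k : (map_mx (d k) (Q *m C j) - map_mx (d j) (Q *m C k)) =
   Q *m map_mx D (curv G k j) +
   ((\tr (G k) *: (Q *m C j) - (Q *m C j) *m G k - (G k)^T *m (Q *m C j))
   - (\tr (G j) *: (Q *m C k) - (Q *m C k) *m G j - (G j)^T *m (Q *m C k))).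
  have -> : map_mx D (curv G k j) = map_mx (d k) (C j) - map_mx (d j) (C k)
      + (C j *m G k + G j *m C k) - (C k *m G j + G k *m C j).
    rewrite /curv map_mxB map_mxD map_mxB !derivation_mx// !DG //.
  rewrite (derivation_mx Q _ (dM k)) (derivation_mx Q _ (dM j)) !d_dens_invE.
  move: (w *: P) (map_mx (d k) (C j)) (map_mx (d j) (C k)) => Q' dkC djC.
  rewrite !opprD !(mulmxBl, mulmxDr, mulmxBr, mulmxN) -!scalemxAl !mulmxA.
  move: (Q' *m dkC) (Q' *m djC) (Q' *m C j *m G k) (Q' *m C k *m G j) => X1 X2 X3 X4.
  move: (Q' *m G k *m C j) (Q' *m G j *m C k) => X5 X6.
  move: ((G k)^T *m Q' *m C j) ((G j)^T *m Q' *m C k) => X7 X8.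
  move: (\tr _) (\tr _) (Q' *m C j) (Q' *m C k) => c1 c2 X9 X10.
  by apply/matrixP => a b; rewrite !mxE; ring.
(* The remaining terms cancel by symmetry of the connection in its lower indices: [F1] and [F2]
   match products with trace terms, [F3] matches the two mixed products with each other. *)
have F1 (X : 'I_n -> 'M[A]_n) :
    \sum_j \sum_k (X j *m G k) j k = \sum_j \sum_k (\tr (G k) *: X j) j k.
  apply: eq_bigr => j _; under eq_bigr do rewrite mxE.
  rewrite exchange_big/=; apply: eq_bigr => l _; rewrite mxE tr_gamE mulrC big_distrr/=.
  by apply: eq_bigr => k _.
have F2 (X : 'I_n -> 'M[A]_n) :
    \sum_j \sum_k ((G j)^T *m X k) j k = \sum_j \sum_k (\tr (G j) *: X k) j k.
  rewrite exchange_big [RHS]exchange_big/=; apply: eq_bigr => k _.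
  under eq_bigr do rewrite mxE.
  rewrite exchange_big/=; apply: eq_bigr => l _; rewrite mxE tr_gamE big_distrl/=.
  by apply: eq_bigr => j _; rewrite mxE.
have F3 (X : 'I_n -> 'M[A]_n) :
    \sum_j \sum_k ((G k)^T *m X j) j k = \sum_j \sum_k (X k *m G j) j k.
  transitivity (\sum_j \sum_k \sum_l G k l j * X j l k).
    by apply: eq_bigr => j _; apply: eq_bigr => k _; rewrite mxE;
       apply: eq_bigr => l _; rewrite mxE.
  transitivity (\sum_j \sum_k \sum_l X k j l * G j l k); last first.
    by apply: eq_bigr => j _; apply: eq_bigr => k _; rewrite mxE.
  under eq_bigr => j _ do (rewrite exchange_big/=).
  rewrite exchange_big/=; apply: eq_bigr => l _; apply: eq_bigr => j _.
  by apply: eq_bigr => k _; rewrite mulrC gam_sym.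
under eq_bigr => j _ do under eq_bigr => k _ do rewrite E.
transitivity (\sum_j \sum_k (Q *m map_mx D (curv G k j)) j k
  + ((\sum_j \sum_k (\tr (G k) *: (Q *m C j)) j k - \sum_j \sum_k ((Q *m C j) *m G k) j k
      - \sum_j \sum_k ((G k)^T *m (Q *m C j)) j k)
    - (\sum_j \sum_k (\tr (G j) *: (Q *m C k)) j k - \sum_j \sum_k ((Q *m C k) *m G j) j k
      - \sum_j \sum_k ((G j)^T *m (Q *m C k)) j k))).
  rewrite -!sumrB -big_split/=; apply: eq_bigr => j _.
  rewrite -!sumrB -big_split/=; apply: eq_bigr => k _.
  move: (Q *m map_mx D (curv G k j)) (Q *m C j *m G k) (Q *m C k *m G j) => X1 X2 X3.
  move: ((G k)^T *m (Q *m C j)) ((G j)^T *m (Q *m C k)) (Q *m C j) (Q *m C k)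
    => X4 X5 X6 X7.
  by rewrite !mxE.
rewrite (F1 (fun j => Q *m C j)) (F2 (fun j => Q *m C j)) (F3 (fun j => Q *m C j)).
by ring.
Qed.

(** No explicit formula for the variation of the connection is needed: applying [D] to
    [div_dens_inv] and to [d_density] gives the two contractions that occur in the flux. *)
Lemma ricci_fluxE k : ricci_flux k =
  - \sum_j d j (D (w * P j k)) - \sum_j (map_mx D Q *m G j) j k
  - half * \sum_i w * P k i * d i T.
Proof.
rewrite /ricci_flux; congr (_ - _).
  transitivity (D (\sum_j (Q *m G j) j k) - \sum_j (map_mx D Q *m G j) j k).
    rewrite raddf_sum -sumrB; apply: eq_bigr => j _.
    have := derivation_mx Q (G j) dD => /matrixP/(_ j k); rewrite [LHS]mxE => ->.
    by move: (map_mx D Q *m G j) (Q *m C j) => X Y; rewrite !mxE; ring.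
  congr (_ - _).
  have -> : \sum_j (Q *m G j) j k = - \sum_j d j (w * P j k).
    rewrite div_dens_inv opprK big_distrr/=; apply: eq_bigr => j _.
    by rewrite -scalemxAl mxE.
  by rewrite raddfN raddf_sum; congr (- _); apply: eq_bigr => j _; rewrite DC.
rewrite big_distrr/=.
transitivity (\sum_i (w * P k i) * D (\tr (G i))); last first.
  by apply: eq_bigr => i _; rewrite var_tr_gam; ring.
under eq_bigr do rewrite mxE; rewrite exchange_big/=; apply: eq_bigr => i _.
rewrite tr_gamE raddf_sum big_distrr/=; apply: eq_bigr => l _.
by rewrite [Q k i]mxE [map_mx _ _ _ _]mxE.
Qed.

Lemma dens_inv_sym k i : D (w * P k i) = D (w * P i k).
Proof. by congr (D (w * _)); rewrite -[in LHS]inv_metric_sym mxE. Qed.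

(** For Y = D(sqrt(g) g^-1), the divergence of Y applied to db equals Y paired with the Hessian, up
    to first-order terms in b. Those terms are the ones that [ricci_fluxE] contributes with the
    opposite sign. *)
Lemma div_var_dens_inv (b : A) :
  \sum_k d k (\sum_i D (w * P k i) * d i b)
  - \sum_k (\sum_j d j (D (w * P j k)) + \sum_j (map_mx D Q *m G j) j k) * d k b =
  \tr (map_mx D Q *m hess G b).
Proof.
under eq_bigr do rewrite raddf_sum/=.
rewrite exchange_big/=; under eq_bigr do rewrite div_mul.
rewrite -sumrB.
transitivity (\sum_i ((\sum_k D (w * P k i) * d k (d i b))
   - (\sum_j (map_mx D Q *m G j) j i) * d i b)).
  by apply: eq_bigr => i _; ring.
rewrite sumrB exchange_big/=.
have -> : \sum_i (\sum_j (map_mx D Q *m G j) j i) * d i b =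
  \sum_i \sum_j D (w * P i j) * \sum_l G j i l * d l b.
  under eq_bigr do rewrite big_distrl/=.
  transitivity (\sum_l \sum_j \sum_i D (w * P j i) * G j i l * d l b).
    apply: eq_bigr => l _; apply: eq_bigr => j _; rewrite mxE big_distrl/=.
    by apply: eq_bigr => i _; rewrite !mxE.
  rewrite exchange_big/= [RHS]exchange_big/=; apply: eq_bigr => j _.
  rewrite exchange_big/=; apply: eq_bigr => i _; rewrite dens_inv_sym big_distrr/=.
  by apply: eq_bigr => l _; rewrite mulrA.
rewrite -sumrB; apply: eq_bigr => k _; rewrite mxE -sumrB; apply: eq_bigr => i _.
by rewrite [hess _ _ _ _]mxE mulrBr (dC k i) !mxE; congr (_ - _); congr (_ * _).
Qed.

(** Because D(sqrt(g) g^-1) = sqrt(g) ((T/2) g^-1 - P h P), the last two terms together are sqrt(g)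
    (T grad b - h(grad b)). Adding them moves all derivatives of [h] onto [b]. *)
Definition variation_flux (b : A) k : A :=
  ricci_flux k * b + \sum_i D (w * P k i) * d i b
  + (\sum_i (w * P k i) * d i b) * (half * T).

Lemma div_variation_flux (b : A) :
  \sum_k d k (variation_flux b k) =
  w * ((D (\tr (P *m ric G)) + pairing P (ric G) h) * b
       - pairing P h (hess G b) + T * pairing P (hess G b) g).
Proof.
have hT : h^T = h.
  by apply/matrixP => i j; rewrite !mxE gs.
transitivity (\sum_k d k (ricci_flux k * b) + \sum_k d k (\sum_i D (w * P k i) * d i b)
   + \sum_k d k ((\sum_i (w * P k i) * d i b) * (half * T))).
  by rewrite -!big_split/=; apply: eq_bigr => k _; rewrite !raddfD.
rewrite !div_mul palatini div_grad.
have := div_var_dens_inv b => /eqP; rewrite subr_eq => /eqP->.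
have -> : \sum_k (\sum_i w * P k i * d i b) * d k (half * T) =
    \sum_k (half * \sum_i w * P k i * d i T) * d k b.
  under eq_bigr do rewrite dM derivation_half// mul0r add0r big_distrl/=.
  rewrite exchange_big/=; apply: eq_bigr => i _; rewrite big_distrr big_distrl/=.
  apply: eq_bigr => k _.
  have -> : P k i = P i k by rewrite -[in LHS]inv_metric_sym mxE.
  by ring.
have -> : \sum_k ricci_flux k * d k b =
   - \sum_k (\sum_j d j (D (w * P j k)) + \sum_j (map_mx D Q *m G j) j k) * d k b
   - \sum_k (half * \sum_i w * P k i * d i T) * d k b.
  by rewrite -!sumrN -big_split/=; apply: eq_bigr => k _; rewrite ricci_fluxE; ring.
have -> : \tr (map_mx D Q *m hess G b) =
    w * (half * T * \tr (P *m hess G b) - \tr (P *m h *m P *m hess G b)).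
  rewrite var_dens_inv -scalemxAl (mxtraceZ w) mulmxBl raddfB/= -(scalemxAl _ P).
  by rewrite (mxtraceZ (half * T)).
have -> : D (\tr (P *m ric G)) = \tr (P *m map_mx D (ric G)) - pairing P (ric G) h.
  have := derivation_mx P (ric G) dD => /(congr1 mxtrace); rewrite mxtraceD => E.
  have -> : D (\tr (P *m ric G)) = \tr (map_mx D (P *m ric G)).
    by rewrite [LHS]raddf_sum; apply: eq_bigr => i _; rewrite [RHS]mxE.
  rewrite E var_inv mulNmx raddfN/= addrC; congr (_ - _).
  rewrite pairingE -[RHS]mxtrace_tr !trmx_mul trmxK hT inv_metric_sym.
  by rewrite -!mulmxA.
have -> : pairing P h (hess G b) = \tr (P *m h *m P *m hess G b).
  by rewrite pairingE hT mxtrace_mulC !mulmxA.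
rewrite (pairing_g (hess G b)).
have -> : T * \tr (P *m hess G b) = (half * T + half * T) * \tr (P *m hess G b).
  by rewrite half_double.
by ring.
Qed.
End Variation.

Section Bochner.
Variable X : 'rV[A]_n.
Definition cov_der : 'M[A]_n := \matrix_i (map_mx (d i) X + X *m G i).
Local Notation S := cov_der.
Local Notation V k := ((X *m S) 0 k - \tr S * X 0 k).

(** The left side is the covariant divergence of nabla_X X - (div X) X for an arbitrary vector
    field, so this is the Bochner formula before any gradient is inserted. Second derivatives of [X]
    cancel because derivations commute, and commuting covariant derivatives leaves the Ricci
    term. *)
Lemma bochner_div :
  \sum_k (d k (V k) + \tr (G k) * V k) =
  \tr (S *m S) - \tr S * \tr S + (X *m ric G *m X^T) 0 0.
Proof.
have SE i k : S i k = d i (X 0 k) + \sum_l X 0 l * G i l k by rewrite !mxE.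
have trS : \tr S = \sum_k d k (X 0 k) + \sum_l X 0 l * \tr (G l).
  rewrite -[\tr S]/(\sum_k S k k); under eq_bigr do rewrite SE.
  rewrite big_split/=; congr (_ + _); rewrite exchange_big/=; apply: eq_bigr => l _.
  by rewrite tr_gamE big_distrr.
pose sum3 (F : 'I_n -> 'I_n -> 'I_n -> A) := \sum_k \sum_i \sum_l F k i l.
have sum3D F F' : sum3 (fun k i l => F k i l + F' k i l) = sum3 F + sum3 F'.
  rewrite -big_split/=; apply: eq_bigr => k _; rewrite -big_split/=.
  by apply: eq_bigr => i _; rewrite -big_split.
(* [E1] expands the derivatives of the field and isolates [SS]; [E2] replaces [SS] by the trace of
   [S] squared; [E3] is the divergence correction by the traces of the connection, and [E4] the
   Ricci term, in the same monomials. *)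
pose SS := \sum_k \sum_i d k (X 0 i) * S i k.
have E1 : \sum_k d k (V k) = SS
    + sum3 (fun k i l => X 0 i * d k (X 0 l) * G i l k)
    + sum3 (fun k i l => X 0 i * X 0 l * d k (G i l k))
    - sum3 (fun k i l => X 0 i * d i (X 0 l) * G k l k)
    - sum3 (fun k i l => X 0 i * X 0 l * d i (G k l k))
    - \tr S * \sum_k d k (X 0 k).
  have F1 : \sum_k \sum_i X 0 i * d k (S i k) = \sum_k \sum_i X 0 i * d k (d i (X 0 k))
      + sum3 (fun k i l => X 0 i * d k (X 0 l) * G i l k)
      + sum3 (fun k i l => X 0 i * X 0 l * d k (G i l k)).
    rewrite -addrA -sum3D -big_split/=; apply: eq_bigr => k _.
    rewrite -big_split/=; apply: eq_bigr => i _.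
    rewrite SE raddfD raddf_sum mulrDr/= big_distrr/=; congr (_ + _).
    by apply: eq_bigr => l _; rewrite dM; ring.
  have F2 : \sum_k \sum_i X 0 i * d i (S k k) = \sum_k \sum_i X 0 i * d k (d i (X 0 k))
      + sum3 (fun k i l => X 0 i * d i (X 0 l) * G k l k)
      + sum3 (fun k i l => X 0 i * X 0 l * d i (G k l k)).
    rewrite -addrA -sum3D -big_split/=; apply: eq_bigr => k _.
    rewrite -big_split/=; apply: eq_bigr => i _.
    rewrite SE raddfD raddf_sum mulrDr/= big_distrr/= dC; congr (_ + _).
    by apply: eq_bigr => l _; rewrite dM; ring.
  transitivity (SS + \sum_k \sum_i X 0 i * d k (S i k)
      - \sum_k \sum_i X 0 i * d i (S k k) - \tr S * \sum_k d k (X 0 k)).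
    have -> : \sum_k \sum_i X 0 i * d i (S k k) = \sum_k d k (\tr S) * X 0 k.
      rewrite exchange_big/=; apply: eq_bigr => i _; rewrite raddf_sum big_distrl/=.
      by apply: eq_bigr => k _; rewrite mulrC.
    rewrite big_distrr/= -!sumrN -!big_split/=; apply: eq_bigr => k _.
    rewrite raddfB/= dM.
    have -> : d k ((X *m S) 0 k) = \sum_i d k (X 0 i) * S i k + \sum_i X 0 i * d k (S i k).
      by rewrite mxE raddf_sum -big_split/=; apply: eq_bigr => i _; rewrite dM.
    by ring.
  by rewrite F1 F2; ring.
have E2 : SS = \tr (S *m S) - sum3 (fun k i l => X 0 i * d k (X 0 l) * G i l k)
    - \sum_k \sum_i \sum_l X 0 i * X 0 l * \sum_m G k i m * G m l k.
  have -> : \tr (S *m S) = \sum_k \sum_i S k i * S i k.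
    by apply: eq_bigr => k _; rewrite mxE.
  have -> : sum3 (fun k i l => X 0 i * d k (X 0 l) * G i l k) =
      \sum_k \sum_i (\sum_l X 0 l * G k l i) * d i (X 0 k).
    transitivity (\sum_k \sum_i \sum_l X 0 l * G k l i * d i (X 0 k)); last first.
      by apply: eq_bigr => k _; apply: eq_bigr => i _; rewrite big_distrl.
    rewrite /sum3 [RHS]exchange_big/=; apply: eq_bigr => k _.
    rewrite exchange_big/=; apply: eq_bigr => i _; apply: eq_bigr => l _.
    by rewrite gam_sym; ring.
  have -> : \sum_k \sum_i \sum_l X 0 i * X 0 l * \sum_m G k i m * G m l k =
      \sum_k \sum_i (\sum_l X 0 l * G k l i) * (\sum_l X 0 l * G i l k).
    apply: eq_bigr => k _.
    transitivity (\sum_m \sum_i \sum_l (X 0 i * G k i m) * (X 0 l * G m l k)).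
      rewrite [RHS]exchange_big/=; apply: eq_bigr => i _.
      rewrite [RHS]exchange_big/=; apply: eq_bigr => l _; rewrite big_distrr/=.
      by apply: eq_bigr => m _; ring.
    by apply: eq_bigr => m _; rewrite big_distrl/=; apply: eq_bigr => i _; rewrite big_distrr.
  rewrite -!sumrB; apply: eq_bigr => k _; rewrite -!sumrB; apply: eq_bigr => i _.
  have dX j m : d j (X 0 m) = S j m - \sum_l X 0 l * G j l m by rewrite SE addrK.
  by rewrite !dX; ring.
have E3 : \sum_k \tr (G k) * V k =
    sum3 (fun k i l => X 0 i * d i (X 0 l) * G k l k)
    + \sum_k \sum_i \sum_l X 0 i * X 0 l * (G i l k * \tr (G k))
    - \tr S * \sum_l X 0 l * \tr (G l).
  have -> : sum3 (fun k i l => X 0 i * d i (X 0 l) * G k l k) =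
      \sum_k \sum_i \tr (G k) * (X 0 i * d i (X 0 k)).
    transitivity (\sum_l \sum_i \sum_k X 0 i * d i (X 0 l) * G k l k).
      rewrite /sum3 exchange_big [RHS]exchange_big/=; apply: eq_bigr => i _.
      exact: exchange_big.
    apply: eq_bigr => l _; apply: eq_bigr => i _; rewrite -big_distrr [RHS]mulrC/=; congr (_ * _).
    by rewrite tr_gamE.
  rewrite big_distrr/= -big_split/= -sumrB; apply: eq_bigr => k _.
  rewrite -big_split/= mulrBr mxE big_distrr/=; congr (_ - _); last by ring.
  apply: eq_bigr => i _; rewrite SE mulrDr mulrDr; congr (_ + _).
  by rewrite !big_distrr/=; apply: eq_bigr => l _; ring.
have E4 : (X *m ric G *m X^T) 0 0 =
    sum3 (fun k i l => X 0 i * X 0 l * d k (G i l k))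
    - sum3 (fun k i l => X 0 i * X 0 l * d i (G k l k))
    + \sum_k \sum_i \sum_l X 0 i * X 0 l * (G i l k * \tr (G k))
    - \sum_k \sum_i \sum_l X 0 i * X 0 l * \sum_m G k i m * G m l k.
  transitivity (\sum_k \sum_i \sum_l X 0 i * X 0 l * curv G k l i k).
    rewrite mxE; transitivity (\sum_l \sum_i \sum_k X 0 i * X 0 l * curv G k l i k).
      apply: eq_bigr => l _; rewrite !mxE big_distrl/=; apply: eq_bigr => i _.
      by rewrite mxE mulrAC -big_distrr/=; congr (_ * _); ring.
    rewrite exchange_big/= [RHS]exchange_big/=; apply: eq_bigr => i _.
    exact: exchange_big.
  have -> : \sum_k \sum_i \sum_l X 0 i * X 0 l * curv G k l i k =
    sum3 (fun k i l => X 0 i * X 0 l * d k (G i l k))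
    - sum3 (fun k i l => X 0 i * X 0 l * d l (G k i k))
    + \sum_k \sum_i \sum_l X 0 i * X 0 l * (\sum_m G i l m * G k m k)
    - \sum_k \sum_i \sum_l X 0 i * X 0 l * \sum_m G k i m * G m l k.
    rewrite -!sumrN -!big_split/=; apply: eq_bigr => k _.
    rewrite -!sumrN -!big_split/=; apply: eq_bigr => i _.
    rewrite -!sumrN -!big_split/=; apply: eq_bigr => l _.
    have -> : curv G k l i k = d k (G i l k) - d l (G k i k)
        + \sum_m G i l m * G k m k - \sum_m G k i m * G m l k.
      rewrite curvE (gam_sym i l k).
      congr (_ + _ - _); apply: eq_bigr => m _.
        by rewrite (gam_sym i l m).
      by rewrite (gam_sym m l k).
    by ring.
  congr (_ - _ + _ - _).
    by rewrite /sum3; apply: eq_bigr => k _; rewrite exchange_big/=;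
      apply: eq_bigr => i _; apply: eq_bigr => l _; ring.
  transitivity (\sum_i \sum_l \sum_m \sum_k X 0 i * X 0 l * (G i l m * G k m k)).
    rewrite exchange_big/=; apply: eq_bigr => i _; rewrite exchange_big/=.
    apply: eq_bigr => l _; rewrite exchange_big/=; apply: eq_bigr => k _.
    by rewrite big_distrr.
  rewrite [RHS]exchange_big/=; apply: eq_bigr => i _; rewrite [RHS]exchange_big/=.
  apply: eq_bigr => l _; apply: eq_bigr => m _; rewrite tr_gamE -!big_distrr/=.
  by congr (_ * (_ * _)); apply: eq_bigr => k _; rewrite gam_sym.
rewrite big_split/= E1 E2 E3 E4 trS.
by ring.
Qed.
End Bochner.

Lemma hess_sym (a : A) : (hess G a)^T = hess G a.
Proof.
apply/matrixP => i j; rewrite mxE [LHS]mxE [RHS]mxE dC; congr (_ - _).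
by apply: eq_bigr => k _; rewrite gam_sym.
Qed.

Lemma mx11_tr (X : 'M[A]_1) : \tr X = X 0 0.
Proof. by rewrite /mxtrace big_ord1. Qed.

Lemma pairing_dyad (X : 'M[A]_n) (a b : A) :
  pairing P X (dif a *m (dif b)^T) = ((dif a)^T *m P *m X *m P *m dif b) 0 0.
Proof.
rewrite pairingE mxtrace_mulC !mulmxA mxtrace_mulC !mulmxA mx11_tr.
rewrite -mx11_tr -mxtrace_tr mx11_tr.
by rewrite !trmx_mul !trmxK inv_metric_sym !mulmxA.
Qed.

(** The field nabla_X X - (div X) X of [bochner_div] for X = grad a. *)
Definition bochner_flux (a : A) k : A :=
  let X := (dif a)^T *m P in
  (X *m hess G a *m P) 0 k - \tr (hess G a *m P) * X 0 k.

Lemma div_bochner_flux (a b : A) :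
  \sum_k d k (w * bochner_flux a k * b) =
  w * ((pairing P (hess G a) (hess G a) - pairing P (hess G a) g * pairing P (hess G a) g
        + pairing P (ric G) (dif a *m (dif a)^T)) * b
       + pairing P (hess G a) (dif a *m (dif b)^T)
       - pairing P (hess G a) g * pairing P (dif a *m (dif b)^T) g).
Proof.
pose X := (dif a)^T *m P; pose S := hess G a *m P.
(* The covariant derivative commutes with raising an index, since the inverse metric is parallel by
   [d_inv_metric]; so that of the gradient is the Hessian with an index raised. *)
have SE : cov_der X = S.
  apply/row_matrixP => i; rewrite rowK row_mul /X derivation_mx// d_inv_metric.
  have -> : row i (hess G a) = map_mx (d i) (dif a)^T - (dif a)^T *m (G i)^T.
    apply/rowP => j; rewrite !mxE; congr (_ - _).
    by apply: eq_bigr => k _; rewrite !mxE mulrC.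
  rewrite mulmxBr mulmxN mulmxBl -!mulmxA -map_trmx.
  move: ((dif a)^T *m (P *m G i)) ((dif a)^T *m ((G i)^T *m P)) => Y Z.
  by apply/matrixP => p q; rewrite !mxE; ring.
rewrite div_mul.
have -> : \sum_k d k (w * bochner_flux a k) =
    w * (\tr (S *m S) - \tr S * \tr S + (X *m ric G *m X^T) 0 0).
  rewrite -SE -bochner_div big_distrr/=; apply: eq_bigr => k _.
  rewrite dM d_density /bochner_flux/= -/X SE -[X *m _ *m P]mulmxA -/S; ring.
have XT : X^T = P *m dif a by rewrite trmx_mul trmxK inv_metric_sym.
rewrite XT pairing_dyad pairing_dyad.
have -> : \sum_k w * bochner_flux a k * d k b =
    w * ((X *m S *m dif b) 0 0 - \tr S * (X *m dif b) 0 0).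
  rewrite mulrBr [(X *m S *m _) _ _]mxE [(X *m dif b) _ _]mxE !big_distrr/= -sumrB.
  apply: eq_bigr => k _; rewrite /bochner_flux -/X -/S -[X *m _ *m P]mulmxA -/S [dif b _ _]mxE.
  by ring.
have -> : pairing P (hess G a) g = \tr S by rewrite pairing_g mxtrace_mulC.
have -> : pairing P (hess G a) (hess G a) = \tr (S *m S).
  by rewrite pairingE hess_sym /S !mulmxA.
have -> : pairing P (dif a *m (dif b)^T) g = (X *m dif b) 0 0.
  rewrite pairing_dyad_g mxE; apply: eq_bigr => k _; rewrite mxE big_distrl/=.
  apply: eq_bigr => i _.
  have -> : P k i = P i k by rewrite -[in LHS]inv_metric_sym mxE.
  by rewrite !mxE; ring.
rewrite /X /S !mulmxA; ring.
Qed.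
End Metric. End Connection. End TensorCalculus.

(** * Change of coordinates *)

Section PairingChange.
Variables (A : comPzRingType) (n : nat).

Lemma pairing_change (J K g g' P P' X X' Y Y' : 'M[A]_n) :
  J *m K = 1%:M -> g'^T = g' -> P *m g = 1%:M -> P' *m g' = 1%:M ->
  g = J *m g' *m J^T -> X = J *m X' *m J^T -> Y = J *m Y' *m J^T ->
  pairing P X Y = pairing P' X' Y'.
Proof.
move=> JK g'T Pg P'g' gE XE YE.
have gT : g^T = g by rewrite gE !trmx_mul trmxK g'T mulmxA.
have KJ := mulmx1C JK.
have JKT : J^T *m K^T = 1%:M by rewrite -trmx_mul KJ trmx1.
have PE : P = K^T *m P' *m K.
  have h : K^T *m P' *m K *m g = 1%:M.
    rewrite gE !mulmxA -[_ *m K *m J]mulmxA KJ mulmx1 -[_ *m P' *m g']mulmxA P'g' mulmx1.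
    by rewrite -trmx_mul JK trmx1.
  by rewrite -[RHS]mulmx1 -(mulmx1C Pg) mulmxA h mul1mx.
rewrite (pairingE gT Pg) (pairingE g'T P'g') PE XE YE !trmx_mul trmxK !mulmxA.
rewrite -[_ *m J^T *m K^T]mulmxA JKT mulmx1 -[_ *m K *m J]mulmxA KJ mulmx1.
rewrite -[_ *m J^T *m K^T]mulmxA JKT mulmx1.
by rewrite mxtrace_mulC !mulmxA KJ mul1mx.
Qed.
End PairingChange.

(** [phi] stands for the pullback of functions from the second chart to the first, [J] for the
    Jacobian of the transition map, [chain] for the chain rule, and [Jsym] for the symmetry of the
    second derivatives of that map. *)
Section CoordinateChange.
Variables (A B : comPzRingType) (n : nat) (phi : {rmorphism B -> A}).
Variables (d : 'I_n -> {additive A -> A}) (half : A).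
Hypothesis dM : forall i, derivation (d i).
Hypothesis dC : forall i j a, d i (d j a) = d j (d i a).
Hypothesis halfE : (1 + 1) * half = 1.
Variables (d' : 'I_n -> {additive B -> B}) (half' : B).
Hypothesis dM' : forall i, derivation (d' i).
Hypothesis halfE' : (1 + 1) * half' = 1.
Variables (J K : 'M[A]_n).
Hypothesis chain : forall i b, d i (phi b) = \sum_a J i a * phi (d' a b).
Hypothesis Jsym : forall i j a, d i (J j a) = d j (J i a).
Hypothesis JK : J *m K = 1%:M.
Variables (g P : 'M[A]_n) (g' P' : 'M[B]_n).
Hypothesis g'T : g'^T = g'.
Hypothesis Pg : P *m g = 1%:M.
Hypothesis Pg' : P' *m g' = 1%:M.
Hypothesis gE : g = J *m map_mx phi g' *m J^T.
Local Notation G := (gam d half g P).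
Local Notation G' := (gam d' half' g' P').

Definition pulled_gam i : 'M[A]_n := \sum_a J i a *: map_mx phi (G' a).
Local Notation AA := pulled_gam.

Lemma chain_mx m p i (X : 'M[B]_(m, p)) :
  map_mx (d i) (map_mx phi X) = \sum_a J i a *: map_mx phi (map_mx (d' a) X).
Proof.
apply/matrixP => k l; rewrite !mxE chain summxE.
by apply: eq_bigr => a _; rewrite !mxE.
Qed.

Let gT : g^T = g.
Proof. by rewrite gE !trmx_mul trmxK map_trmx g'T mulmxA. Qed.

(** The inhomogeneous transformation law. The connection pulled back from the other chart is
    torsion-free by [Jsym] and compatible with [g] by [gE], so it is the Levi-Civita connection by
    [gam_unique]. *)
Lemma gam_change i : G i *m J = map_mx (d i) J + J *m AA i.
Proof.
have KJ := mulmx1C JK.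
pose Gt i := (map_mx (d i) J + J *m AA i) *m K.
have JA j k b : (J *m AA j) k b = \sum_c \sum_a J k c * J j a * phi (G' a c b).
  rewrite mxE; apply: eq_bigr => c _; rewrite summxE big_distrr/=.
  by apply: eq_bigr => a _; rewrite !mxE mulrA.
have GtE : forall i, Gt i = G i.
  apply: (gam_unique halfE gT Pg) => [j k l|j].
    rewrite [LHS]mxE [RHS]mxE; apply: eq_bigr => b _; congr (_ * _).
    rewrite [LHS]mxE [RHS]mxE [map_mx _ _ _ _]mxE [map_mx _ J _ _]mxE Jsym; congr (_ + _).
    rewrite !JA exchange_big/=; apply: eq_bigr => c _; apply: eq_bigr => a _.
    by rewrite (gam_sym _ _ _ g'T); congr (_ * _); rewrite mulrC.
  have h : Gt j *m g = (map_mx (d j) J + J *m AA j) *m map_mx phi g' *m J^T.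
    by rewrite gE /Gt !mulmxA -[_ *m K *m J]mulmxA KJ mulmx1.
  rewrite h [in LHS]gE (derivation_mx _ _ (dM j)) (derivation_mx _ _ (dM j)) chain_mx.
  have -> : \sum_a J j a *: map_mx phi (map_mx (d' a) g') =
      AA j *m map_mx phi g' + (AA j *m map_mx phi g')^T.
    rewrite mulmx_suml linear_sum -big_split/=; apply: eq_bigr => a _.
    rewrite (gam_compat _ halfE' g'T Pg') -scalemxAl linearZ/= -scalerDr; congr (_ *: _).
    by rewrite -map_mxM map_trmx -map_mxD.
  have qT : (map_mx phi g')^T = map_mx phi g' by rewrite map_trmx g'T.
  rewrite -[map_mx (d j) J^T]map_trmx; move: (map_mx phi g') qT => q qT.
  have trD (X Y : 'M[A]_n) : (X + Y)^T = X^T + Y^T by exact: linearD.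
  rewrite !(trmx_mul, trD, trmxK, qT) !(mulmxDl, mulmxDr) !mulmxA.
  move: ((map_mx (d j) J) *m _ *m _) (J *m _ *m (map_mx (d j) J)^T) => X1 X2.
  move: (J *m AA j *m _ *m _) (J *m q *m (AA j)^T *m _) => X3 X4.
  by apply/matrixP => a b; rewrite !mxE; ring.
by rewrite -GtE /Gt -mulmxA KJ mulmx1.
Qed.

Definition pulled_curv i j : 'M[A]_n :=
  \sum_a \sum_b (J i a * J j b) *: map_mx phi (curv d' G' a b).

(** A gauge transformation: the inhomogeneous terms of [gam_change] drop out since the second
    derivatives of [J] commute and, by [Jsym], so do the derivatives of the coefficients in
    [pulled_gam]. *)
Lemma curv_change i j : curv d G i j *m J = J *m pulled_curv i j.
Proof.
have pullE : pulled_curv i j = map_mx (d i) (AA j) - map_mx (d j) (AA i)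
    + AA j *m AA i - AA i *m AA j.
  have dAA k l : map_mx (d k) (AA l) = \sum_a d k (J l a) *: map_mx phi (G' a)
      + \sum_a \sum_b (J k a * J l b) *: map_mx phi (map_mx (d' a) (G' b)).
    rewrite exchange_big/= -big_split/= raddf_sum/=; apply: eq_bigr => b _.
    have -> : map_mx (d k) (J l b *: map_mx phi (G' b)) =
        d k (J l b) *: map_mx phi (G' b) + J l b *: map_mx (d k) (map_mx phi (G' b)).
      by apply/matrixP => p q; rewrite !mxE dM.
    rewrite chain_mx scaler_sumr; congr (_ + _); apply: eq_bigr => a _.
    by rewrite scalerA mulrC.
  have AAM k l : AA k *m AA l =
      \sum_a \sum_b (J k a * J l b) *: map_mx phi (G' a *m G' b).
    rewrite mulmx_suml; apply: eq_bigr => a _; rewrite mulmx_sumr; apply: eq_bigr => b _.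
    by rewrite -scalemxAl -scalemxAr scalerA map_mxM.
  rewrite !dAA !AAM.
  have -> : \sum_a d i (J j a) *: map_mx phi (G' a) = \sum_a d j (J i a) *: map_mx phi (G' a).
    by apply: eq_bigr => a _; rewrite Jsym.
  rewrite opprD addrACA subrr add0r.
  rewrite [X in _ - X + _]exchange_big [X in _ + X - _]exchange_big/=.
  rewrite -!sumrN -!big_split/=; apply: eq_bigr => a _; rewrite -!sumrN -!big_split/=.
  apply: eq_bigr => b _; rewrite [J j b * _]mulrC -!scalerN -!scalerDr; congr (_ *: _).
  by rewrite /curv map_mxB map_mxD map_mxB.
have GJ k : G k *m J = map_mx (d k) J + J *m AA k by exact: gam_change.
have dGJ k l : map_mx (d k) (G l) *m J = map_mx (d k) (map_mx (d l) J)
    + map_mx (d k) J *m AA l + J *m map_mx (d k) (AA l) - G l *m map_mx (d k) J.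
  have := congr1 (map_mx (d k)) (GJ l); rewrite (derivation_mx _ _ (dM k)) map_mxD.
  rewrite (derivation_mx _ _ (dM k)) addrA => <-; by rewrite addrK.
have dJ k : map_mx (d k) J = G k *m J - J *m AA k by rewrite GJ addrK.
have ddJ : map_mx (d i) (map_mx (d j) J) = map_mx (d j) (map_mx (d i) J).
  by apply/matrixP => a b; rewrite !mxE dC.
rewrite /curv !(mulmxBl, mulmxDl) !dGJ ddJ -!mulmxA !GJ.
rewrite pullE !(mulmxBr, mulmxDr) !dJ !(mulmxBr, mulmxDr, mulmxBl) !mulmxA.
move: (map_mx (d j) (map_mx (d i) J)) (J *m map_mx (d i) (AA j)) => X1 X2.
move: (J *m map_mx (d j) (AA i)) (J *m AA i *m AA j) (J *m AA j *m AA i) => X3 X4 X5.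
move: (G i *m J *m AA j) (G j *m J *m AA i) (G j *m G i *m J) (G i *m G j *m J).
move=> X6 X7 X8 X9; apply/matrixP => a b; rewrite !mxE; ring.
Qed.

(** In the trace the factor [K] of the upper index meets a factor [J] of a lower one; only the two
    [J] factors of the free indices survive. *)
Lemma ric_change : ric d G = J *m map_mx phi (ric d' G') *m J^T.
Proof.
have KJ := mulmx1C JK.
have E k j : curv d G k j = J *m pulled_curv k j *m K.
  by rewrite -curv_change -mulmxA JK mulmx1.
apply/matrixP => i j; rewrite mxE; under eq_bigr do rewrite E.
transitivity (\sum_a \sum_b \sum_e J i e * phi (curv d' G' a b e a) * J j b).
  transitivity (\sum_a \sum_b J j b * \sum_k J k a *
      (J *m map_mx phi (curv d' G' a b) *m K) i k).
    have F k : (J *m pulled_curv k j *m K) i k =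
        \sum_a \sum_b J j b * (J k a * (J *m map_mx phi (curv d' G' a b) *m K) i k).
      rewrite /pulled_curv mulmx_sumr mulmx_suml summxE; apply: eq_bigr => a _.
      rewrite mulmx_sumr mulmx_suml summxE; apply: eq_bigr => b _.
      by rewrite -scalemxAr -scalemxAl mxE; ring.
    under eq_bigr do rewrite F.
    rewrite exchange_big/=; apply: eq_bigr => a _; rewrite exchange_big/=.
    by apply: eq_bigr => b _; rewrite big_distrr.
  apply: eq_bigr => a _; apply: eq_bigr => b _.
  have -> : \sum_k J k a * (J *m map_mx phi (curv d' G' a b) *m K) i k =
      (J *m map_mx phi (curv d' G' a b) *m K *m J) i a.
    by rewrite mxE; apply: eq_bigr => k _; rewrite mulrC.
  rewrite -mulmxA KJ mulmx1 mxE big_distrr/=; apply: eq_bigr => e _.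
  by rewrite [map_mx _ _ _ _]mxE mulrC.
rewrite [RHS]mxE exchange_big/=; apply: eq_bigr => b _.
rewrite [X in _ = X * _]mxE big_distrl/= exchange_big/=; apply: eq_bigr => e _.
rewrite [X in _ = _ * X * _]mxE [ric _ _ _ _]mxE rmorph_sum [J^T _ _]mxE.
by rewrite big_distrr big_distrl.
Qed.

Lemma dif_change b : dif d (phi b) = J *m map_mx phi (dif d' b).
Proof.
apply/matrixP => i j; rewrite !mxE chain; apply: eq_bigr => a _.
by rewrite !mxE.
Qed.

(** The Hessian is read as the covariant derivative of the differential. Differentiating [J] in
    [J *m dif] produces a term that the inhomogeneous part of [gam_change] cancels. *)
Lemma hess_change b : hess d G (phi b) = J *m map_mx phi (hess d' G' b) *m J^T.
Proof.
have H i : col i (hess d G (phi b))^T = map_mx (d i) (dif d (phi b)) - G i *m dif d (phi b).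
  apply/matrixP => j k; rewrite !mxE; congr (_ - _).
  by apply: eq_bigr => l _; rewrite !mxE.
have H' a : col a (hess d' G' b)^T = map_mx (d' a) (dif d' b) - G' a *m dif d' b.
  apply/matrixP => j k; rewrite !mxE; congr (_ - _).
  by apply: eq_bigr => l _; rewrite !mxE.
apply: trmx_inj; apply/matrixP => j i.
have -> : (hess d G (phi b))^T j i = (col i (hess d G (phi b))^T) j 0 by rewrite [RHS]mxE.
rewrite H dif_change (derivation_mx _ _ (dM i)) mulmxA gam_change mulmxDl opprD.
rewrite addrACA subrr add0r chain_mx -mulmxA -mulmxBr.
have -> : \sum_a J i a *: map_mx phi (map_mx (d' a) (dif d' b)) - AA i *m map_mx phi (dif d' b)
   = \sum_a J i a *: map_mx phi (col a (hess d' G' b)^T).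
  rewrite mulmx_suml -sumrB; apply: eq_bigr => a _.
  by rewrite -scalemxAl -scalerBr H' map_mxB map_mxM.
have -> : \sum_a J i a *: map_mx phi (col a (hess d' G' b)^T) =
    col i ((map_mx phi (hess d' G' b))^T *m J^T).
  apply/matrixP => k l; rewrite summxE [RHS]mxE [RHS]mxE; apply: eq_bigr => a _.
  by move: (hess d' G' b) => Y; rewrite !mxE mulrC.
by rewrite !trmx_mul trmxK !mxE; apply: eq_bigr => k _; rewrite [in LHS]mxE.
Qed.

End CoordinateChange.

(** * Iterated Lebesgue integrals *)

Section CompactlySupportedLine.
Variable R : realType.
Local Notation leb := (@lebesgue_measure R).
Implicit Types (f : R -> R) (r : R).

Definition supported_line r f := continuous f /\ forall t, r < `|t| -> f t = 0.

Lemma supported_lineE r f : supported_line r f -> f = f \_ `[- r, r].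
Proof.
move=> [_ f0]; apply/funext => t; rewrite patchE; case: ifPn => //.
rewrite notin_setE/= in_itv/= -ler_norml => /negP; rewrite -ltNge; exact: f0.
Qed.

Lemma supported_line_integrable_itv r f : supported_line r f ->
  leb.-integrable `[- r, r] (EFin \o f).
Proof.
move=> [cf _]; apply: continuous_compact_integrable; first exact: segment_compact.
exact: continuous_subspaceT.
Qed.

Lemma continuous_segment_integrable a b f : continuous f ->
  leb.-integrable [set: R] (EFin \o (f \_ `[a, b])).
Proof.
move=> cf; have : leb.-integrable `[a, b] (EFin \o f).
  by apply: continuous_compact_integrable; [exact: segment_compact|exact: continuous_subspaceT].
move/(integrable_mkcond _ _).1 => /(_ (measurable_itv _)).
by rewrite restrict_EFin.
Qed.

Lemma supported_line_integrable r f : supported_line r f ->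
  leb.-integrable [set: R] (EFin \o f).
Proof.
by move=> sf; rewrite (supported_lineE sf); apply: continuous_segment_integrable; case: sf.
Qed.

Lemma supported_line_itv r f : supported_line r f ->
  \int[leb]_t f t = \int[leb]_(t in `[- r, r]) f t.
Proof. by move=> sf; rewrite [RHS]Rintegral_mkcond -(supported_lineE sf). Qed.

Lemma supported_line_bound r f (B : R) : 0 <= r -> supported_line r f ->
  (forall t, `|f t| <= B) -> `|\int[leb]_t f t| <= 2 * r * B.
Proof.
move=> r0 sf fB; rewrite (supported_line_itv sf).
have mI : measurable `[- r, r] by exact: measurable_itv.
have iI := supported_line_integrable_itv sf.
apply: le_trans; first by apply: le_normr_Rintegral => //; exact: measurable_itv.
apply: (@le_trans _ _ (\int[leb]_(t in `[- r, r]) B)).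
  apply: le_Rintegral => //; first by apply/integrable_norm.
  apply: (@continuous_compact_integrable _ (fun=> B)); first exact: segment_compact.
  by apply: continuous_subspaceT => x; exact: cvg_cst.
rewrite Rintegral_cst//= lebesgue_measure_itv/= lte_fin.
case: ifPn => [_|]; first by rewrite -EFinB/= opprK mulrC; lra.
rewrite -leNgt => h; rewrite mulr0 mulr_ge0// ?mulr_ge0//.
exact: le_trans (normr_ge0 _) (fB 0).
Qed.

Lemma supported_line_gt0 r f a : supported_line r f -> (forall t, 0 <= f t) ->
  0 < f a -> 0 < \int[leb]_t f t.
Proof.
move=> sf f0 fa.
have [cf _] := sf.
have fa2 : 0 < f a / 2 by rewrite divr_gt0.
have [d d0 dP] : exists2 d, 0 < d & forall t, `|t - a| < d -> f a / 2 <= f t.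
  have /cvgrPdist_lt/(_ _ fa2)/nbhs_normP[d /= d0 dP] := cf a.
  exists d => // t td; have := dP t; rewrite /= distrC => /(_ td).
  by rewrite ltr_norml => /andP[_]; lra.
pose I := `[a - d / 2, a + d / 2]%classic.
have mI : measurable I by exact: measurable_itv.
apply: (@lt_le_trans _ _ (\int[leb]_(t in I) (f a / 2))).
  rewrite Rintegral_cst//= lebesgue_measure_itv/= lte_fin.
  have -> : a - d / 2 < a + d / 2 by lra.
  by rewrite -EFinB/= mulr_gt0//; lra.
apply: (@le_trans _ _ (\int[leb]_(t in I) f t)).
  apply: le_Rintegral => //.
  - apply: (@continuous_compact_integrable _ (fun=> f a / 2)); first exact: segment_compact.
    by apply: continuous_subspaceT => x; exact: cvg_cst.
  - apply: continuous_compact_integrable; first exact: segment_compact.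
    exact: continuous_subspaceT.
  - by move=> t; rewrite /I/= in_itv/= => /andP[h1 h2]; apply: dP; rewrite ltr_norml; lra.
rewrite [leLHS]Rintegral_mkcond; apply: le_Rintegral => //.
- exact: continuous_segment_integrable.
- exact: supported_line_integrable sf.
- by move=> t _; rewrite patchE; case: ifP.
Qed.

Lemma supported_line_derive r f (f' : R -> R) : 0 < r -> supported_line r f ->
  (forall t : R, is_derive t 1 f (f' t)) -> continuous f' -> \int[leb]_t f' t = 0.
Proof.
move=> r0 [cf f0] df cf'.
have df' t : derive1 f t = f' t by rewrite derive1E; case: (df t).
(* Beyond r + 1 the function vanishes on a whole neighbourhood, so its derivative vanishes too, and
   the endpoints of the enlarged interval satisfy the strict inequality in the support condition. *)
have r10 : 0 < r + 1 by lra.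
have sf' : supported_line (r + 1) f'.
  split=> // t rt; rewrite -df' derive1E (near_eq_derive (g := fun=> 0)) ?derive_cst//.
  near=> s; apply: f0.
  have : `|t - s| < 1 by near: s; apply: (@cvgr_dist_lt _ _ _ (nbhs t) _ id t) => //; exact: cvg_id.
  by have := ler_normD (t - s) s; rewrite subrK; lra.
rewrite (supported_line_itv sf') /Rintegral.
rewrite (@continuous_FTC2 _ f' f (- (r + 1)) (r + 1))/=.
- by rewrite !f0 ?subr0 ?normrN ?ger0_norm//; lra.
- lra.
- exact: continuous_subspaceT.
- split.
  + by move=> t _; case: (df t).
  + by apply: cvg_at_right_filter; exact: cf.
  + by apply: cvg_at_left_filter; exact: cf.
- by move=> t _; exact: df'.
Unshelve. all: by end_near. Qed.
End CompactlySupportedLine.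

Section RealContinuity.
Variables (R : realType) (T : topologicalType).
Implicit Types F G : T -> R.

Lemma continuous_cst_fun (c : R) : continuous (fun _ : T => c).
Proof. by move=> x; exact: cvg_cst. Qed.

Lemma continuous_add F G : continuous F -> continuous G -> continuous (fun x => F x + G x).
Proof. by move=> cF cG x; exact: (continuousD (cF x) (cG x)). Qed.

Lemma continuous_mul F G : continuous F -> continuous G -> continuous (fun x => F x * G x).
Proof. by move=> cF cG x; exact: (continuousM (cF x) (cG x)). Qed.

End RealContinuity.

Section RowCoordinates.
Variable R : realType.

Definition rV_coord n (a : 'I_n) (x : 'rV[R]_n) : R := x 0 a.

Lemma rV_coord_is_linear n (a : 'I_n) : linear (rV_coord a).
Proof. by move=> c x y; rewrite /rV_coord !mxE. Qed.
HB.instance Definition _ n (a : 'I_n) :=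
  GRing.isLinear.Build R 'rV[R]_n R _ (rV_coord a) (rV_coord_is_linear a).

Lemma rV_coord_continuous n (a : 'I_n) : continuous (rV_coord a).
Proof. exact: coord_continuous. Qed.

Lemma coordinates_rV n :
  coordinates (fun a : 'I_n => delta_mx 0 a : 'rV[R]_n) (fun a => rV_coord a).
Proof.
split=> [a|x]; first exact: rV_coord_continuous.
by rewrite [LHS]row_sum_delta.
Qed.

Definition prepend m (t : R) (y : 'rV[R]_m) : 'rV[R]_m.+1 := row_mx (const_mx t : 'rV_1) y.

Lemma prepend0 m t (y : 'rV[R]_m) : prepend t y 0 0 = t.
Proof.
rewrite /prepend (_ : 0 = lshift m (0 : 'I_1)); last exact/val_inj.
by apply: etrans (row_mxEl _ _ _ _) _; rewrite mxE.
Qed.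

Lemma prependS m t (y : 'rV[R]_m) j : prepend t y 0 (lift 0 j) = y 0 j.
Proof.
rewrite /prepend (_ : lift 0 j = rshift 1 j); last exact/val_inj.
exact: row_mxEr.
Qed.

Lemma prepend_behead m (x : 'rV[R]_m.+1) :
  prepend (x 0 0) (\row_j x 0 (lift 0 j)) = x.
Proof.
apply/rowP => a; have [->|[j ->]] : a = 0 \/ exists j, a = lift 0 j.
  by case: (unliftP 0 a) => [j ->|->]; [right; exists j|left].
by rewrite prepend0.
by rewrite prependS mxE.
Qed.

Lemma differentiable_prepend m (z : R * 'rV[R]_m) :
  differentiable (fun z : R * 'rV[R]_m => prepend z.1 z.2) z.
Proof.
apply: (differentiable_coordinates (coordinates_rV m.+1)) => a.
have [->|[j ->]] : a = 0 \/ exists j, a = lift 0 j.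
  by case: (unliftP 0 a) => [j ->|->]; [right; exists j|left].
- rewrite (_ : (fun _ => _) = fst); last by apply/funext => y; exact: prepend0.
  by apply: linear_differentiable; move=> w; exact: cvg_fst.
- rewrite (_ : (fun _ => _) = rV_coord j \o snd); last by apply/funext => y; exact: prependS.
  apply: differentiable_comp; apply: linear_differentiable.
    move=> w; exact: cvg_snd.
  exact: rV_coord_continuous.
Qed.

Lemma continuous_prepend m (F : 'rV[R]_m.+1 -> R) : continuous F ->
  continuous (fun z : R * 'rV[R]_m => F (prepend z.1 z.2)).
Proof.
move=> cF z; apply: continuous_comp; last exact: cF.
by apply: differentiable_continuous; exact: differentiable_prepend.
Qed.

End RowCoordinates.

Section IntegralRV.
Variable R : realType.
Local Notation leb := (@lebesgue_measure R).

Definition supported (r : R) n (F : 'rV[R]_n -> R) :=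
  continuous F /\ forall (x : 'rV[R]_n) i, r < `|x 0 i| -> F x = 0.

Lemma integral_rVS n (F : 'rV[R]_n.+1 -> R) :
  integral_rV F = \int[leb]_t integral_rV (fun y => F (prepend t y)).
Proof. by []. Qed.

Lemma supported_prepend (r : R) n (F : 'rV[R]_n.+1 -> R) t : supported r F ->
  supported r (fun y => F (prepend t y)).
Proof.
move=> [cF F0]; split=> [y|y j rj]; last by apply: (F0 _ (lift 0 j)); rewrite prependS.
have c2 : {for y, continuous (fun y => (t, y) : R * 'rV[R]_n)}.
  by apply: differentiable_continuous; exact: differentiable_pair.
exact: (continuous_comp c2 (continuous_prepend cF (x := (t, y)))).
Qed.

Lemma supported_line_scale r c (f : R -> R) :
  supported_line r f -> supported_line r (fun t => c * f t).
Proof.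
move=> [cf f0]; split=> [|t rt]; last by rewrite f0// mulr0.
by apply: continuous_mul => //; exact: continuous_cst_fun.
Qed.

Lemma supported_comb (r : R) n (F G : 'rV[R]_n -> R) (c : R) : supported r F -> supported r G ->
  supported r (fun x => c * F x + G x).
Proof.
move=> [cF F0] [cG G0]; split=> [|x i ri]; last by rewrite (F0 _ i)// (G0 _ i)// mulr0 addr0.
by apply: continuous_add => //; apply: continuous_mul => //; exact: continuous_cst_fun.
Qed.

Lemma cube_compact (r : R) n : compact [set x : 'rV[R]_n | forall i, `[- r, r]%classic (x 0 i)].
Proof.
by apply: (@rV_compact R n (fun=> `[- r, r]%classic)) => i; exact: segment_compact.
Qed.

(** The tube lemma: a property that holds locally around each point of a compact cube holds on all
    of it for a common set of parameters. *)
Lemma near_cube (r : R) n (P : R -> 'rV[R]_n -> Prop) (F : set_system R) : Filter F ->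
  (forall y : 'rV[R]_n, \forall y' \near y & t \near F, P t y') ->
  \forall t \near F, forall y : 'rV[R]_n, (forall i, `|y 0 i| <= r) -> P t y.
Proof.
move=> FF yP; have /compact_near_coveringP := @cube_compact r n.
move/(_ R F (fun t y => P t y) FF (fun y _ => yP y)).
by apply: filterS => t tP y yr; apply: tP => i; rewrite /= in_itv/= -ler_norml.
Qed.

Lemma dist_le_half (a b c e : R) : `|a - b| <= e / 2 -> `|a - c| <= e / 2 -> `|b - c| <= e.
Proof. by rewrite !ler_norml; lra. Qed.

(** Bound and linearity are proved together with the continuity of slices, by induction on the
    dimension: continuity of a slice needs both facts one dimension lower, and they in turn need
    integrable slices. *)
Definition integral_rV_spec n := forall r : R, 0 < r ->
  (forall (F : 'rV[R]_n -> R) (B : R), supported r F -> (forall x, `|F x| <= B) ->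
     `|integral_rV F| <= (2 * r) ^+ n * B) /\
  (forall (F G : 'rV[R]_n -> R) (c : R), supported r F -> supported r G ->
     integral_rV (fun x => c * F x + G x) = c * integral_rV F + integral_rV G).

(** By [near_cube] the slices depend on [t] continuously in the uniform norm; linearity and the
    bound turn this into continuity of their integrals. *)
Lemma supported_slice (r : R) n (F : 'rV[R]_n.+1 -> R) : integral_rV_spec n -> 0 < r ->
  supported r F -> supported_line r (fun t => integral_rV (fun y => F (prepend t y))).
Proof.
move=> spec r0 sF; have [bd lin] := spec r r0; split; last first.
  move=> t rt; apply/eqP; rewrite -normr_le0.
  rewrite -[X in _ <= X](mulr0 ((2 * r) ^+ n)); apply: bd.
    exact: supported_prepend.
  by move=> y; rewrite (sF.2 _ 0) ?prepend0// normr0.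
move=> t; apply/cvgrPdist_le => e e0.
pose C := (2 * r) ^+ n + 1.
have C0 : 0 < C by rewrite /C ltr_wpDl// exprn_ge0// mulr_ge0// ltW.
have eC : 0 < e / C by rewrite divr_gt0.
have h : \forall t' \near t, forall y : 'rV[R]_n, (forall i, `|y 0 i| <= r) ->
    `|F (prepend t y) - F (prepend t' y)| <= e / C.
  apply: (@near_cube r n (fun t' y => `|F (prepend t y) - F (prepend t' y)| <= e / C) (nbhs t)) => y.
  have /cvgrPdist_le/(_ _ (divr_gt0 eC (ltr0n _ 2))) := continuous_prepend sF.1 (x := (t, y)).
  move=> [[U V] /= [Ut Vy] UV]; exists (V, U) => //= -[y' t'] /= [Vy' Ut'].
  have h1 := UV (t', y') (conj Ut' Vy').
  have h2 := UV (t, y') (conj (nbhs_singleton Ut) Vy').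
  rewrite distrC; exact: (dist_le_half h1 h2).
near=> t'.
have ht : forall y : 'rV[R]_n, `|F (prepend t y) - F (prepend t' y)| <= e / C.
  move=> y; have [yr|] := pselect (forall i, `|y 0 i| <= r).
    by move: y yr; near: t'.
  move=> /existsNP[i /negP]; rewrite -ltNge => ri.
  by rewrite !(sF.2 _ (lift 0 i)) ?prependS// subrr normr0 ltW.
have := lin _ _ (-1) (supported_prepend t' sF) (supported_prepend t sF).
rewrite mulN1r addrC => <-.
have -> : (fun x => -1 * F (prepend t' x) + F (prepend t x)) =
   (fun x => F (prepend t x) - F (prepend t' x)).
  by apply/funext => x; rewrite mulN1r addrC.
have := bd (fun x => F (prepend t x) - F (prepend t' x)) (e / C).
move=> /(_ _ ht) /le_trans; apply.
  have := supported_comb (-1) (supported_prepend t' sF) (supported_prepend t sF).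
  by congr (supported _ _); apply/funext => x; rewrite mulN1r addrC.
rewrite mulrCA ler_piMr ?(ltW e0)// ler_pdivrMr// mul1r /C; lra.
Unshelve. all: by end_near. Qed.

Lemma integral_rV_specP n : integral_rV_spec n.
Proof.
elim: n => [|n IH] r r0.
  by split=> [F B _ /(_ 0)|//]; rewrite expr0 mul1r.
have [bd lin] := IH r r0; split=> [F B sF FB|F G c sF sG].
  rewrite integral_rVS exprS -mulrA.
  apply: (supported_line_bound (ltW r0) (supported_slice IH r0 sF)) => t.
  by apply: bd => //; exact: supported_prepend.
have sF' := supported_slice IH r0 sF; have sG' := supported_slice IH r0 sG.
rewrite !integral_rVS.
transitivity (\int[leb]_t (c * integral_rV (fun y => F (prepend t y)) +
    integral_rV (fun y => G (prepend t y)))).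
  by congr (fine _); apply: eq_integral => t _; rewrite lin//; exact: supported_prepend.
have iF := supported_line_integrable sF'; have iG := supported_line_integrable sG'.
rewrite RintegralD//; first by rewrite RintegralZl.
exact: (supported_line_integrable (supported_line_scale c sF')).
Qed.

Lemma integral_rV_ge0 n (F : 'rV[R]_n -> R) : (forall x, 0 <= F x) -> 0 <= integral_rV F.
Proof.
elim: n F => [|n IH] F F0; first exact: F0.
by rewrite integral_rVS; apply: Rintegral_ge0 => t _; exact: IH.
Qed.

Lemma integral_rV_gt0 (r : R) n (F : 'rV[R]_n -> R) x : 0 < r -> supported r F ->
  (forall x, 0 <= F x) -> 0 < F x -> 0 < integral_rV F.
Proof.
move=> r0; elim: n F x => [|n IH] F x sF F0 Fx.
  by rewrite /= (_ : 0 = x)//; apply/rowP => -[].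
rewrite integral_rVS.
apply: (supported_line_gt0 (supported_slice (@integral_rV_specP n) r0 sF) _ (a := x 0 0)).
  by move=> t; exact: integral_rV_ge0.
apply: (IH _ (\row_j x 0 (lift 0 j))) => //; first exact: supported_prepend.
by rewrite prepend_behead.
Qed.

Lemma MVT_unordered (f f' : R -> R) (a b : R) : (forall t : R, is_derive t 1 f (f' t)) ->
  exists2 c, `|c - a| <= `|b - a| & f b - f a = f' c * (b - a).
Proof.
move=> df; have cf (u v : R) : {within `[u, v], continuous f}.
  by apply: derivable_within_continuous => t _; case: (df t).
have [ab|/ltW ba] := leP a b.
  have [c] := MVT_segment ab (fun t _ => df t) (cf a b).
  rewrite in_itv/= => /andP[ac cb] ->; exists c => //.
  by rewrite !ger0_norm ?subr_ge0// lerD2r.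
have [c] := MVT_segment ba (fun t _ => df t) (cf b a).
rewrite in_itv/= => /andP[bc ca] fE; exists c.
  by rewrite !ler0_norm ?subr_le0// lerN2 lerD2r.
by rewrite -opprB fE -mulrN opprB.
Qed.

Lemma prepend_line n (t h : R) (y : 'rV[R]_n) :
  prepend (h + t) y = h *: delta_mx 0 0 + prepend t y.
Proof.
apply/rowP => a; case: (unliftP 0 a) => [j ->|->].
  by rewrite [RHS]mxE !prependS !mxE/= mulr0 add0r.
by rewrite [RHS]mxE !prepend0; congr (_ + _); rewrite !mxE/= mulr1.
Qed.

Lemma prepend_lineS n (t h : R) (y : 'rV[R]_n) j :
  prepend t (h *: delta_mx 0 j + y) = h *: delta_mx 0 (lift 0 j) + prepend t y.
Proof.
apply/rowP => a; case: (unliftP 0 a) => [k ->|->].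
  rewrite prependS mxE [RHS]mxE prependS; congr (_ + _).
  by rewrite !mxE (inj_eq lift_inj).
by rewrite [RHS]mxE !prepend0 -[LHS]add0r; congr (_ + _); rewrite !mxE/= mulr0.
Qed.

Lemma derive_prependS n (F : 'rV[R]_n.+1 -> R) t (y : 'rV[R]_n) j :
  'D_(delta_mx 0 j) (fun y => F (prepend t y)) y = 'D_(delta_mx 0 (lift 0 j)) F (prepend t y).
Proof.
rewrite /derive; congr (lim _).
suff -> : (fun h : R => h^-1 *: (F (prepend t (h *: delta_mx 0 j + y)) - F (prepend t y))) =
  (fun h : R => h^-1 *: (F (h *: delta_mx 0 (lift 0 j) + prepend t y) - F (prepend t y))) by [].
by apply/funext => h; rewrite prepend_lineS.
Qed.

Lemma is_derive_prepend n (F : 'rV[R]_n.+1 -> R) (t : R) (y : 'rV[R]_n) :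
  (forall x, differentiable F x) ->
  is_derive t 1 (fun t => F (prepend t y)) ('D_(delta_mx 0 0) F (prepend t y)).
Proof.
move=> dF.
have lineE s : prepend s y = s *: delta_mx 0 0 + prepend 0 y.
  by rewrite -prepend_line addr0.
have -> : (fun t => F (prepend t y)) = (fun t => F (t *: delta_mx 0 0 + prepend 0 y)).
  by apply/funext => s; rewrite -lineE.
by rewrite (lineE t); exact: is_derive_line.
Qed.

Lemma supported_derive (r : R) n (F : 'rV[R]_n -> R) v : supported r F ->
  continuous (fun x => 'D_v F x) -> supported r (fun x => 'D_v F x).
Proof.
move=> [cF F0] cD; split=> // x i rx.
have -> : 'D_v F x = 'D_v (fun _ => 0 : R) x; last exact: derive_cst.
apply: near_eq_derive; have : \forall y \near x, r < `|rV_coord i y|.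
  have c : {for x, continuous (fun y => `|rV_coord i y|)}.
    by apply: continuous_comp; [exact: rV_coord_continuous|exact: norm_continuous].
  by have := c _ (lt_nbhsr rx).
by apply: filterS => y; exact: F0.
Qed.

(** Differentiation under the integral sign. The mean value theorem and [near_cube] give difference
    quotients that converge uniformly on the cube; the integral bound then controls the error. *)
Lemma is_derive_slice (r : R) n (F : 'rV[R]_n.+1 -> R) (t : R) : 0 < r -> supported r F ->
  (forall x, differentiable F x) -> continuous (fun x => 'D_(delta_mx 0 0) F x) ->
  is_derive t 1 (fun t => integral_rV (fun y => F (prepend t y)))
    (integral_rV (fun y => 'D_(delta_mx 0 0) F (prepend t y))).
Proof.
move=> r0 sF dF cD; set D := fun x => 'D_(delta_mx 0 0) F x.
have sD : supported r D by exact: supported_derive.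
have [bd lin] := @integral_rV_specP n r r0.
set f := fun t => integral_rV _; set l := integral_rV _.
suff cv : h^-1 *: (f (h *: 1 + t) - f t) @[h --> 0^'] --> l.
  by apply: DeriveDef; [apply/cvg_ex; exists l|exact/cvg_lim].
apply/cvgrPdist_le => e e0.
pose C := (2 * r) ^+ n + 1.
have C0 : 0 < C by rewrite /C ltr_wpDl// exprn_ge0// mulr_ge0// ltW.
have eC : 0 < e / C by rewrite divr_gt0.
have h : \forall t' \near t, forall y : 'rV[R]_n, (forall i, `|y 0 i| <= r) ->
    `|F (prepend t' y) - F (prepend t y) - (t' - t) * D (prepend t y)| <= e / C * `|t' - t|.
  apply: (@near_cube r n (fun t' y => `|F (prepend t' y) - F (prepend t y) -
    (t' - t) * D (prepend t y)| <= e / C * `|t' - t|) (nbhs t)) => y.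
  have /cvgrPdist_le/(_ _ (divr_gt0 eC (ltr0n _ 2))) := continuous_prepend cD (x := (t, y)).
  move=> [[U V] /= [/nbhs_normP[d /= d0 dU] Vy] UV].
  exists (V, [set t' | `|t - t'| < d]) => /=.
    by split=> //; apply/nbhs_normP; exists d.
  move=> [y' t'] /= [Vy' t'd].
  have Ut : U t by apply: dU; rewrite /= subrr normr0.
  have [c ct cE] := MVT_unordered t t' (fun t => is_derive_prepend t y' dF).
  rewrite cE mulrC -mulrBr normrM mulrC ler_wpM2r//.
  have Uc : U c by apply: dU; rewrite /= distrC (le_lt_trans ct)// distrC.
  have h1 := UV (c, y') (conj Uc Vy'); have h2 := UV (t, y') (conj Ut Vy').
  exact: (dist_le_half h1 h2).
have h' : \forall k \near 0^', forall y : 'rV[R]_n, (forall i, `|y 0 i| <= r) ->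
    `|F (prepend (k + t) y) - F (prepend t y) - k * D (prepend t y)| <= e / C * `|k|.
  have ct : k + t @[k --> (0 : R)^'] --> t.
    rewrite -[X in _ --> X]add0r; apply: cvg_within_filter.
    by apply: cvgD; [exact: cvg_id|exact: cvg_cst].
  near=> k; have : forall y : 'rV[R]_n, (forall i, `|y 0 i| <= r) ->
      `|F (prepend (k + t) y) - F (prepend t y) - (k + t - t) * D (prepend t y)|
        <= e / C * `|k + t - t|.
    near: k; exact: (ct _ h).
  by rewrite addrK.
near=> k.
have k0 : k != 0 by near: k; exact: nbhs_dnbhs_neq.
have hk : forall y : 'rV[R]_n,
    `|F (prepend (k + t) y) - F (prepend t y) - k * D (prepend t y)| <= e / C * `|k|.
  move=> y; have [yr|] := pselect (forall i, `|y 0 i| <= r).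
    by move: y yr; near: k.
  move=> /existsNP[i /negP]; rewrite -ltNge => ri.
  rewrite !(sF.2 _ (lift 0 i)) ?prependS// (sD.2 _ (lift 0 i)) ?prependS//.
  by rewrite mulr0 !subr0 normr0 mulr_ge0// ltW.
have s1 := supported_prepend (k + t) sF; have s2 := supported_prepend t sF.
have s3 := supported_prepend t sD.
have s12 := supported_comb (-1) s2 s1.
have s123 := supported_comb (- k) s3 s12.
have := bd _ (e / C * `|k|) s123.
rewrite (lin _ _ _ s3 s12) (lin _ _ _ s2 s1).
rewrite -/(f (k + t)) -/(f t) -/l => h1.
rewrite [k *: 1]mulr1 -(ler_pM2l (x := `|k|)) ?normr_gt0// -normrM.
rewrite -normrN mulrBr opprB mulrA divff// mul1r.
have -> : f (k + t) - f t - k * l = - k * l + (-1 * f t + f (k + t)) by ring.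
apply: le_trans (h1 _) _.
  move=> y; rewrite (_ : _ + _ = F (prepend (k + t) y) - F (prepend t y) - k * D (prepend t y))//.
  by rewrite /D; ring.
rewrite [leLHS]mulrA mulrC ler_wpM2l// mulrCA ler_piMr ?(ltW e0)// ler_pdivrMr// mul1r /C; lra.
Unshelve. all: by end_near. Qed.

(** For the first coordinate the derivative is moved out of the inner integral and the outer one
    vanishes by the fundamental theorem. For any other coordinate the inner integral vanishes for
    each value of the first, by induction. *)
Lemma integral_rV_derive (r : R) n (F : 'rV[R]_n -> R) i : 0 < r -> supported r F ->
  (forall x, differentiable F x) -> continuous (fun x => 'D_(delta_mx 0 i) F x) ->
  integral_rV (fun x => 'D_(delta_mx 0 i) F x) = 0.
Proof.
move=> r0; elim: n F i => [|n IH] F i sF dF cD; first by case: i cD.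
have sD := supported_derive sF cD.
rewrite integral_rVS; move: sD cD; case: (unliftP 0 i) => [j ->|->] sD cD.
  transitivity (\int[leb]_t (0 : R)); last by rewrite Rintegral_cst ?mul0r.
  congr (fine _); apply: eq_integral => t _; congr (_%:E).
  under [X in integral_rV X]eq_fun do rewrite -derive_prependS.
  apply: IH; first exact: supported_prepend.
    move=> y; have dy : differentiable (fun y => (t, y) : R * 'rV[R]_n) y by exact: differentiable_pair.
    have dp : differentiable (fun y => prepend t y) y.
      exact: (differentiable_comp dy (@differentiable_prepend R n (t, y))).
    exact: (differentiable_comp dp (dF _)).
  have -> : (fun y => 'D_(delta_mx 0 j) (fun y => F (prepend t y)) y) =
      (fun y => 'D_(delta_mx 0 (lift 0 j)) F (prepend t y)).
    by apply/funext => y; rewrite derive_prependS.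
  exact: (supported_prepend t sD).1.
apply: (supported_line_derive r0 (supported_slice (@integral_rV_specP n) r0 sF)).
  by move=> t; exact: (is_derive_slice t r0 sF dF cD).
exact: (supported_slice (@integral_rV_specP n) r0 sD).1.
Qed.
End IntegralRV.

(** * Positive definite matrices *)

Section PositiveDefinite.
Variable R : realType.

Definition posdef n (X : 'M[R]_n) := forall v : 'rV[R]_n, v != 0 -> 0 < (v *m X *m v^T) 0 0.

(** The Cholesky recursion: split off the first row and column and factor the Schur complement. *)
Lemma posdef_factor n (X : 'M[R]_n) : X^T = X -> posdef X -> exists B : 'M[R]_n, X = B^T *m B.
Proof.
elim: n X => [|n IH] X XT Xp; first by exists 0; apply/matrixP => -[].
pose a := X 0 0; pose X' : 'M[R]_(1 + n) := X.
pose b := ursubmx X'; pose C := drsubmx X'.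
have XE : X' = block_mx (a%:M) b b^T C.
  rewrite -[LHS]submxK; congr block_mx.
    by rewrite [ulsubmx _]mx11_scalar !mxE /X' /a; congr (X _ _)%:M; exact: val_inj.
  by apply/matrixP => i j; rewrite !mxE /X' -[in LHS]XT mxE.
have a0 : 0 < a.
  have := Xp (delta_mx 0 0); rewrite -rowE.
  have -> : (delta_mx 0 0 : 'rV[R]_n.+1) != 0.
    by apply/eqP => /matrixP/(_ 0 0); rewrite !mxE/= => /eqP; rewrite oner_eq0.
  move=> /(_ isT); rewrite mxE (bigD1 0)//= !mxE/= mulr1 big1 ?addr0// => j j0.
  by rewrite !mxE (negbTE j0) mulr0.
have sa : Num.sqrt a * Num.sqrt a = a by rewrite -expr2 sqr_sqrtr// ltW.
have sa0 : Num.sqrt a != 0 by rewrite sqrtr_eq0 -ltNge.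
pose C' := C - a^-1 *: (b^T *m b).
have CT : C^T = C.
  by apply/matrixP => i j; rewrite !mxE /X' -[in LHS]XT mxE.
have [|v v0|B' CE] := IH C'.
- by rewrite /C' linearB/= linearZ/= trmx_mul trmxK CT.
- pose s := (v *m b^T) 0 0.
  have sE : v *m b^T = s%:M by exact: mx11_scalar.
  have sE' : b *m v^T = s%:M by rewrite -[LHS]trmxK trmx_mul trmxK sE tr_scalar_mx.
  (* Among the rows with tail [v], this one minimises the quadratic form (completing the square);
     the minimum is the Schur complement evaluated at [v], hence positive. *)
  pose w : 'rV[R]_n.+1 := row_mx (- (s / a))%:M v.
  have w0 : w != 0.
    apply: contra v0 => /eqP w0; apply/eqP/rowP => j.
    by have := congr1 (fun m : 'rV[R]_(1 + n) => m 0 (rshift 1 j)) w0; rewrite row_mxEr !mxE.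
  have : 0 < (row_mx (- (s / a))%:M v *m block_mx a%:M b b^T C
      *m (row_mx (- (s / a))%:M v)^T) 0 0 by rewrite -XE; exact: (Xp w w0).
  rewrite tr_row_mx mul_row_block mul_row_col.
  rewrite tr_scalar_mx sE !mulmxDl mul_scalar_mx scale_scalar_mx.
  rewrite -[(- (s / a))%:M *m b *m v^T]mulmxA sE' -!scalar_mxM.
  have -> : v *m C' *m v^T = v *m C *m v^T - (a^-1 * (s * s))%:M.
    have h : v *m (b^T *m b) *m v^T = (s * s)%:M.
      by rewrite mulmxA sE -mulmxA sE' -scalar_mxM.
    by rewrite /C' mulmxBr mulmxBl -scalemxAr -scalemxAl h scale_scalar_mx.
  move: (v *m C *m v^T) => Y; rewrite !mxE/= !mulr1n; congr (0 < _).
  by field; rewrite gt_eqF.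
pose B : 'M[R]_(1 + n) := block_mx (Num.sqrt a)%:M ((Num.sqrt a)^-1 *: b) 0 B'.
exists (B : 'M[R]_n.+1); apply: (etrans (XE : X = _)).
suff : block_mx a%:M b b^T C = B^T *m B by [].
rewrite /B tr_block_mx mulmx_block !tr_scalar_mx !trmx0 !mul0mx !addr0.
rewrite -scalar_mxM sa mul_scalar_mx scalerA divff// scale1r.
rewrite linearZ/= mul_mx_scalar scalerA divff// scale1r -CE -scalemxAl -scalemxAr scalerA.
by rewrite -invfM sa /C' mulmx0 addr0 addrC subrK.
Qed.

Lemma posdef_unit n (X : 'M[R]_n) : posdef X -> X \in unitmx.
Proof.
move=> Xp; rewrite -row_free_unit -kermx_eq0; apply/eqP/row_matrixP => i; rewrite row0.
apply: contrapT => /eqP k0; have := Xp _ k0.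
have -> : row i (kermx X) *m X = 0 by apply/sub_kermxP; exact: row_sub.
by rewrite mul0mx mxE ltxx.
Qed.

Lemma posdef_det_gt0 n (X : 'M[R]_n) : X^T = X -> posdef X -> 0 < \det X.
Proof.
move=> XT Xp; have := posdef_unit Xp; rewrite unitmxE unitfE.
have [B ->] := posdef_factor XT Xp; rewrite det_mulmx det_tr => d0.
by rewrite lt0r d0 -expr2 sqr_ge0.
Qed.

Lemma sqr_sum_le n (y : 'I_n -> R) : (\sum_i y i) ^+ 2 <= n%:R * \sum_i y i ^+ 2.
Proof.
case: n y => [|n] y; first by rewrite !big_ord0 expr0n/= mul0r.
have nn : 0 < n.+1%:R :> R by rewrite ltr0n.
pose m := (\sum_i y i) / n.+1%:R.
have yE : \sum_i y i = m * n.+1%:R by rewrite /m divfK// gt_eqF.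
have : 0 <= \sum_i (y i - m) ^+ 2 by apply: sumr_ge0 => i _; exact: sqr_ge0.
have -> : \sum_i (y i - m) ^+ 2 = \sum_i y i ^+ 2 - m ^+ 2 * n.+1%:R.
  transitivity (\sum_i (y i ^+ 2 - 2 * m * y i + m ^+ 2)).
    by apply: eq_bigr => i _; ring.
  by rewrite big_split sumrB/= sumr_const card_ord -mulr_sumr yE -mulr_natr; ring.
rewrite yE; move: (\sum_i _) => Q h.
rewrite exprMn [n.+1%:R ^+ 2]expr2 mulrA mulrC ler_pM2l//; lra.
Qed.

(** Writing the metric as [B^T *m B] turns [S] into a symmetric matrix [Y] with the same trace and
    norm in Euclidean space. There the diagonal alone gives the Cauchy-Schwarz bound. *)
Lemma pairing_trace_le n (g S : 'M[R]_n) : g^T = g -> posdef g -> S^T = S ->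
  pairing (invmx g) S g ^+ 2 <= n%:R * pairing (invmx g) S S.
Proof.
move=> gT gp ST; have gU := posdef_unit gp.
have Pg : invmx g *m g = 1%:M by rewrite mulVmx.
have [B gE] := posdef_factor gT gp.
have BU : B \in unitmx by move: gU; rewrite gE unitmx_mul => /andP[].
pose C := (invmx B)^T.
have PE : invmx g = C^T *m C.
  rewrite /C trmxK; have h : invmx B *m (invmx B)^T *m g = 1%:M.
    rewrite gE -mulmxA [(invmx B)^T *m _]mulmxA -trmx_mul mulmxV// trmx1 mul1mx.
    by rewrite mulVmx.
  by rewrite -[RHS]mulmx1 -(mulmxV gU) mulmxA h mul1mx.
pose Y := C *m S *m C^T.
have YT : Y^T = Y by rewrite /Y !trmx_mul trmxK ST mulmxA.
have -> : pairing (invmx g) S g = \sum_i Y i i.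
  by rewrite pairing_g// PE -mulmxA mxtrace_mulC /Y.
have -> : pairing (invmx g) S S = \sum_i \sum_j Y i j ^+ 2.
  rewrite (pairingE gT Pg) ST PE !mulmxA.
  have -> : S *m C^T *m C *m S *m C^T *m C = (S *m C^T) *m (Y *m C) by rewrite /Y !mulmxA.
  rewrite mxtrace_mulC -mulmxA [C *m _]mulmxA -/Y.
  apply: eq_bigr => i _; rewrite mxE; apply: eq_bigr => j _.
  have -> : Y j i = Y i j by rewrite -[in LHS]YT mxE.
  by rewrite expr2.
apply: (@le_trans _ _ (n%:R * \sum_i Y i i ^+ 2)); last first.
  rewrite ler_wpM2l ?ler0n//; apply: ler_sum => i _.
  by rewrite (bigD1 i)//= lerDl sumr_ge0// => j _; exact: sqr_ge0.
exact: sqr_sum_le.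
Qed.
End PositiveDefinite.

(** * Integration on the manifold *)

Lemma smooth_on_local (R : realType) (V W : normedModType R) (A : set V) (F : V -> W) :
  (forall x, A x -> exists2 B : set V, B x & smooth_on B F) -> smooth_on A F.
Proof. by move=> h vs x /h[B Bx sB]; exact: sB. Qed.

Lemma smooth_on_sum (R : realType) (V : normedModType R) (A : set V) (I : Type)
    (r : seq I) (F : I -> V -> R) :
  open A -> (forall i, smooth_on A (F i)) -> smooth_on A (fun x => \sum_(i <- r) F i x).
Proof.
move=> oA sF; elim: r => [|i r IH].
  rewrite (_ : (fun x => _) = fun=> 0); last by apply/funext => x; rewrite big_nil.
  exact: smooth_on_cst.
rewrite (_ : (fun x => _) = fun x => F i x + \sum_(j <- r) F j x).
  exact: smooth_onD.
by apply/funext => x; rewrite big_cons.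
Qed.

Lemma continuous_sum (R : realType) (T : topologicalType) (I : Type)
    (r : seq I) (F : I -> T -> R) :
  (forall i, continuous (F i)) -> continuous (fun x => \sum_(i <- r) F i x).
Proof.
move=> cF; elim: r => [|i r IH].
  rewrite (_ : (fun x => _) = fun=> 0); last by apply/funext => x; rewrite big_nil.
  exact: continuous_cst_fun.
rewrite (_ : (fun x => _) = fun x => F i x + \sum_(j <- r) F j x).
  exact: continuous_add.
by apply/funext => x; rewrite big_cons.
Qed.

Section Charts.
Variables (R : realType) (n : nat) (M : ptopologicalType).
Variable A : smooth_atlas R n M.
Local Notation U c := (chart_map c @` chart_dom c).
Implicit Types (c d : chart A) (p : M) (x : 'rV[R]_n).

Lemma chart_image c p : chart_dom c p -> U c (chart_map c p).
Proof. by move=> dp; exists p. Qed.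

Lemma chart_inv_dom c x : U c x -> chart_dom c (chart_inv c x).
Proof. by case=> p dp <-; rewrite chart_mapK. Qed.

Lemma chart_invK c x : U c x -> chart_map c (chart_inv c x) = x.
Proof. by case=> p dp <-; rewrite chart_mapK. Qed.

Lemma chart_map_continuous_at c p : chart_dom c p -> {for p, continuous (chart_map c)}.
Proof.
move=> dp; have := @chart_map_continuous R n M A c.
by rewrite continuous_open_subspace; [apply; rewrite inE|exact: chart_dom_open].
Qed.

Lemma chart_inv_continuous_at c x : U c x -> {for x, continuous (chart_inv c)}.
Proof.
move=> Ux; have := @chart_inv_continuous R n M A c.
by rewrite continuous_open_subspace; [apply; rewrite inE|exact: chart_image_open].
Qed.

Lemma continuous_from_charts (T : topologicalType) (q : M -> T) :
  (forall c x, U c x -> {for x, continuous (q \o chart_inv c)}) -> continuous q.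
Proof.
move=> cq p; have dp := chart_atP A p; set c := chart_at A p in dp.
have : {for p, continuous ((q \o chart_inv c) \o chart_map c)}.
  apply: continuous_comp; first exact: chart_map_continuous_at.
  by apply: cq; exact: chart_image.
move=> h; have E : q p = ((q \o chart_inv c) \o chart_map c) p by rewrite /= chart_mapK.
rewrite /continuous_at E; apply: cvg_trans h; apply: near_eq_cvg.
have : nbhs p (chart_dom c) by apply: open_nbhs_nbhs; split=> //; exact: chart_dom_open.
by apply: filterS => r dr; rewrite /= chart_mapK.
Qed.

Lemma continuous_in_chart (T : topologicalType) (q : M -> T) c x : continuous q -> U c x ->
  {for x, continuous (q \o chart_inv c)}.
Proof.
move=> cq Ux; apply: continuous_comp; first exact: chart_inv_continuous_at.
exact: cq.
Qed.

Lemma smooth_fun_continuous (u : M -> R) : smooth_fun A u -> continuous u.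
Proof.
move=> su; apply: continuous_from_charts => c x Ux; apply: differentiable_continuous.
exact: (su c [::]).
Qed.

Lemma chart_image_compact c (K : set M) : compact K -> K `<=` chart_dom c ->
  compact (chart_map c @` K).
Proof.
move=> cK Kd; apply: continuous_compact => //.
by apply: continuous_subspaceW (@chart_map_continuous R n M A c).
Qed.

Lemma chart_image_mem c (K : set M) x : K `<=` chart_dom c -> U c x ->
  (chart_map c @` K) x <-> K (chart_inv c x).
Proof.
move=> Kd Ux; split=> [[p Kp <-]|Kx]; first by rewrite chart_mapK//; exact: Kd.
by exists (chart_inv c x) => //; rewrite chart_invK.
Qed.

Definition extend0 c (F : 'rV[R]_n -> R) x : R := if x \in U c then F x else 0.

Lemma extend0_in c F x : U c x -> extend0 c F x = F x.
Proof. by move=> Ux; rewrite /extend0 ifT// inE. Qed.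

Section CompactSupport.
Variables (c : chart A) (K : set M) (F : 'rV[R]_n -> R).
Hypotheses (cK : compact K) (Kd : K `<=` chart_dom c).
Hypothesis F0 : forall x, U c x -> ~ K (chart_inv c x) -> F x = 0.

Let oK : open (~` (chart_map c @` K)).
Proof.
rewrite openC; apply: compact_closed; first exact: norm_hausdorff.
exact: chart_image_compact.
Qed.

Lemma near_extend0_out x : ~ (chart_map c @` K) x -> \near x, extend0 c F x = 0.
Proof.
move=> nKx; have : nbhs x (~` (chart_map c @` K)) by exact: open_nbhs_nbhs.
apply: filterS => y nKy; rewrite /extend0; case: ifPn => //; rewrite inE => Uy.
by apply: F0 => // Ky; apply: nKy; apply/(chart_image_mem Kd Uy).
Qed.

Lemma near_extend0_in x : U c x -> \near x, F x = extend0 c F x.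
Proof.
move=> Ux; apply: (near_open_eq (@chart_image_open R n M A c) Ux) => y Uy.
by rewrite extend0_in.
Qed.

(** The image of the chart and the complement of the compact image of [K] are open and cover the
    space; on the first the extension is [F], on the second it is 0. Local properties are checked on
    each. *)
Lemma extend0_cases x : U c x \/ ~ (chart_map c @` K) x.
Proof.
have [Kx|] := pselect ((chart_map c @` K) x); last by right.
by left; case: Kx => p Kp <-; apply: chart_image; exact: Kd.
Qed.

Lemma extend0_continuous : (forall x, U c x -> {for x, continuous F}) ->
  continuous (extend0 c F).
Proof.
move=> cF x; have [Ux|nKx] := extend0_cases x.
  rewrite /continuous_at extend0_in//; apply: cvg_trans (cF x Ux).
  exact: near_eq_cvg (near_extend0_in Ux).
have h := near_extend0_out nKx.
rewrite /continuous_at (nbhs_singleton h); apply: cvg_near_cst h.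
Qed.

Lemma extend0_supported : (forall x, U c x -> {for x, continuous F}) ->
  exists2 r : R, 0 < r & supported r (extend0 c F).
Proof.
move=> cF; have /compact_bounded[B [_ BP]] := chart_image_compact cK Kd.
pose r := `|B| + 1.
have r0 : 0 < r by rewrite /r ltr_wpDl.
exists r => //; split; first exact: extend0_continuous.
move=> x i rx; apply: contrapT => Fx0.
have Kx : (chart_map c @` K) x.
  by apply: contrapT => nKx; apply: Fx0; exact: (nbhs_singleton (near_extend0_out nKx)).
have Br : B < r by rewrite /r (le_lt_trans (ler_norm B))// ltrDl.
have := BP r Br x Kx; rewrite /= => xr.
have : `|x 0 i| <= `|x|.
  by rewrite /Num.norm/= mx_normrE; apply: (le_trans _ (le_bigmax _ _ (0, i))).
by move/le_trans => /(_ _ xr); rewrite leNgt rx.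
Qed.

Lemma extend0_differentiable x : (forall y, U c y -> differentiable F y) ->
  differentiable (extend0 c F) x.
Proof.
move=> dF; have [Ux|nKx] := extend0_cases x.
  by apply: near_eq_differentiable (dF x Ux); exact: near_extend0_in.
apply: (@near_eq_differentiable _ _ _ (fun=> 0)) => //.
by near do apply/esym; exact: near_extend0_out.
Unshelve. all: by end_near. Qed.

Lemma extend0_derive v : extend0 c (fun x => 'D_v F x) = (fun x => 'D_v (extend0 c F) x).
Proof.
apply/funext => x; rewrite [LHS]/extend0; case: ifPn; rewrite ?inE ?notin_setE => Ux.
  exact: (near_eq_derive _ (near_extend0_in Ux)).
have [//|nKx] := extend0_cases x.
by rewrite (near_eq_derive (g := fun=> 0) _ (near_extend0_out nKx)) derive_cst.
Qed.

Lemma derive_out v x : U c x -> ~ K (chart_inv c x) -> 'D_v F x = 0.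
Proof.
move=> Ux nKx.
have nK : ~ (chart_map c @` K) x by move=> /(chart_image_mem Kd Ux).
have h := near_extend0_out nK.
rewrite (near_eq_derive (g := extend0 c F) _ (near_extend0_in Ux)).
by rewrite (near_eq_derive (g := fun=> 0) _ h) derive_cst.
Qed.

End CompactSupport.

Lemma integral_extend0_derive c (K : set M) (F : 'rV[R]_n -> R) i :
  compact K -> K `<=` chart_dom c ->
  (forall x, U c x -> ~ K (chart_inv c x) -> F x = 0) -> smooth_on (U c) F ->
  integral_rV (extend0 c (fun x => 'D_(delta_mx 0 i) F x)) = 0.
Proof.
move=> cK Kd F0 sF.
have cF x : U c x -> {for x, continuous F}.
  by move=> Ux; apply: differentiable_continuous; exact: (sF [::]).
have [r r0 sr] := extend0_supported cK Kd F0 cF.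
rewrite (extend0_derive cK Kd F0); apply: (integral_rV_derive r0 sr).
  by move=> x; apply: (extend0_differentiable cK Kd F0) => y Uy; exact: (sF [::]).
rewrite -(extend0_derive cK Kd F0); apply: (extend0_continuous cK Kd).
  by move=> x Ux nKx; exact: (derive_out cK Kd F0).
by move=> x Ux; apply: differentiable_continuous; exact: (sF [:: _]).
Qed.

Lemma integral_rV_sum (r : R) (I : Type) (s : seq I) (F : I -> 'rV[R]_n -> R) : 0 < r ->
  (forall i, supported r (F i)) ->
  integral_rV (fun x => \sum_(i <- s) F i x) = \sum_(i <- s) integral_rV (F i).
Proof.
move=> r0 sF; have [bd lin] := @integral_rV_specP R n r r0.
have s0 : supported r (fun _ : 'rV[R]_n => 0 : R).
  by split=> [|//]; exact: continuous_cst_fun.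
have I0 : integral_rV (fun _ : 'rV[R]_n => 0 : R) = 0.
  by have := lin _ _ 1 s0 s0; rewrite !mul1r addr0; lra.
have h : supported r (fun x => \sum_(i <- s) F i x) /\
    integral_rV (fun x => \sum_(i <- s) F i x) = \sum_(i <- s) integral_rV (F i).
  elim: s => [|i s [IHs IHi]].
    by rewrite big_nil; under eq_fun do rewrite big_nil.
  have -> : (fun x => \sum_(j <- i :: s) F j x) = (fun x => 1 * F i x + \sum_(j <- s) F j x).
    by apply/funext => x; rewrite big_cons mul1r.
  by rewrite lin// big_cons mul1r IHi; split=> //; exact: supported_comb.
by case: h.
Qed.

Section Density.
Variables (g : tensor2 A) (mu : {measure set (borel M) -> \bar R}).
Hypotheses (rg : riemannian_metric g) (rmu : riemannian_measure g mu).

Lemma metric_sym c p : chart_dom c p -> (g c p)^T = g c p.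
Proof. by case: rg => -[sg _ _] _; exact: sg. Qed.

Lemma metric_posdef c p : chart_dom c p -> posdef (g c p).
Proof. by case: rg => _ pg dp v v0; exact: pg. Qed.

Lemma metric_det_gt0 c p : chart_dom c p -> 0 < \det (g c p).
Proof. by move=> dp; apply: posdef_det_gt0; [exact: metric_sym|exact: metric_posdef]. Qed.

Definition density c x : R := Num.sqrt (\det (g c (chart_inv c x))).

Definition chart_domain c := OpenDomain (@chart_image_open R n M A c).

Lemma smooth_density c : smooth_on (U c) (density c).
Proof.
(* The determinant is computed in the ring, so its smoothness is part of its type. *)
pose G : 'M[sfun (chart_domain c)]_n := \matrix_(i, j) to_sfun _ (fun x => g c (chart_inv c x) i j).
have GE x : U c x -> (\det G) x = \det (g c (chart_inv c x)).
  move=> Ux; rewrite sfun_det//; congr (\det _); apply/matrixP => i j.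
  by rewrite !mxE to_sfunE//; case: rg => -[_ sg _] _; exact: sg.
apply: (@eq_smooth_on _ _ _ _ (fun x => Num.sqrt ((\det G) x))).
- exact: chart_image_open.
- by move=> x Ux; rewrite GE.
apply: (smooth_on_comp_real (@chart_image_open R n M A c) _ _ (@smooth_sqrt R)).
  by move=> x Ux; rewrite /= GE//; apply: metric_det_gt0; exact: chart_inv_dom.
exact: (sfun_smooth (\det G)).
Qed.

Lemma chart_integral c (K : set M) (u : M -> R) : compact K -> K `<=` chart_dom c ->
  continuous u -> (forall p, ~ K p -> u p = 0) ->
  (\int[mu]_p (u p)%:E)%E =
  (integral_rV (extend0 c (fun x => u (chart_inv c x) * density c x)))%:E.
Proof. exact: rmu. Qed.

Lemma chart_divergence c (K : set M) (u : M -> R) (Z : 'I_n -> 'rV[R]_n -> R) :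
  compact K -> K `<=` chart_dom c -> continuous u -> (forall p, ~ K p -> u p = 0) ->
  (forall k, smooth_on (U c) (Z k)) ->
  (forall k x, U c x -> ~ K (chart_inv c x) -> Z k x = 0) ->
  (forall x, U c x -> u (chart_inv c x) * density c x = \sum_k 'D_(delta_mx 0 k) (Z k) x) ->
  \int[mu]_p u p = 0.
Proof.
move=> cK Kd cu u0 sZ Z0 uZ; rewrite /Rintegral (chart_integral cK Kd cu u0)/=.
have cD k x : U c x -> {for x, continuous (fun y => 'D_(delta_mx 0 k) (Z k) y)}.
  by move=> Ux; apply: differentiable_continuous; exact: (sZ k [:: _]).
have D0 k x : U c x -> ~ K (chart_inv c x) -> 'D_(delta_mx 0 k) (Z k) x = 0.
  by move=> Ux nKx; exact: (derive_out cK Kd (Z0 k)).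
have [r r0 sr] : exists2 r : R, 0 < r &
    forall k, supported r (extend0 c (fun x => 'D_(delta_mx 0 k) (Z k) x)).
  have h k := extend0_supported cK Kd (D0 k) (cD k).
  have /choice[rr rrP] : forall k, exists r, 0 < r /\
      supported r (extend0 c (fun x => 'D_(delta_mx 0 k) (Z k) x)).
    by move=> k; have [r r0 sr] := h k; exists r.
  (* A common radius for all components: the sum dominates each summand, and 1 makes it positive
     also when there are none. *)
  exists (1 + \sum_k rr k).
    by rewrite ltr_wpDr// sumr_ge0// => k _; case: (rrP k) => /ltW.
  move=> k; have [_ [cc s0]] := rrP k; split=> // x i rx; apply: (s0 x i).
  apply: le_lt_trans rx; rewrite (bigD1 k)//= addrCA lerDl addr_ge0//.
  by rewrite sumr_ge0// => j _; case: (rrP j) => /ltW.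
have -> : extend0 c (fun x => u (chart_inv c x) * density c x) =
    (fun x => \sum_k extend0 c (fun y => 'D_(delta_mx 0 k) (Z k) y) x).
  apply/funext => x; rewrite /extend0; case: ifPn; rewrite ?inE => Ux; first exact: uZ.
  by rewrite big1.
rewrite (integral_rV_sum _ r0 sr) big1// => k _.
exact: (integral_extend0_derive _ cK Kd (Z0 k) (sZ k)).
Qed.
End Density.
End Charts.

(** * Bump functions and partitions of unity *)

Section SmoothFunctions.
Variables (R : realType) (n : nat) (M : ptopologicalType).
Variable A : smooth_atlas R n M.
Local Notation U c := (chart_map c @` chart_dom c).
Implicit Types (c d : chart A) (p : M) (x : 'rV[R]_n) (u v : M -> R).

Lemma smooth_fun_cst (a : R) : smooth_fun A (fun=> a).
Proof. by move=> c; exact: smooth_on_cst. Qed.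

Lemma smooth_funD u v : smooth_fun A u -> smooth_fun A v -> smooth_fun A (fun p => u p + v p).
Proof. by move=> su sv c; apply: smooth_onD (su c) (sv c); exact: chart_image_open. Qed.

Lemma smooth_funM u v : smooth_fun A u -> smooth_fun A v -> smooth_fun A (fun p => u p * v p).
Proof. by move=> su sv c; apply: smooth_onM (su c) (sv c); exact: chart_image_open. Qed.

Lemma smooth_fun_comp (B : set R) (F : R -> R) u : smooth_fun A u -> smooth_on B F ->
  (forall p, B (u p)) -> smooth_fun A (fun p => F (u p)).
Proof.
move=> su sF uB c; apply: (smooth_on_comp_real (@chart_image_open _ _ _ A c) _ (su c) sF).
by move=> x _; exact: uB.
Qed.

Lemma chart_overlap_open c d : open (chart_map c @` (chart_dom c `&` chart_dom d)).
Proof.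
rewrite openE => x [p [cp dp] <-]; rewrite /interior/=.
have Ux := chart_image cp.
have h1 : nbhs (chart_map c p) (U c).
  by apply: open_nbhs_nbhs; split=> //; exact: chart_image_open.
have h2 : \forall y \near chart_map c p, chart_dom d (chart_inv c y).
  apply: (chart_inv_continuous_at Ux); rewrite chart_mapK//.
  by apply: open_nbhs_nbhs; split=> //; exact: chart_dom_open.
apply: filterS2 h1 h2 => y Uy dy; exists (chart_inv c y); last exact: chart_invK.
by split=> //; exact: chart_inv_dom.
Qed.

Lemma transition_coord_smooth c d (j : 'I_n) :
  smooth_on (chart_map c @` (chart_dom c `&` chart_dom d))
    (fun x => chart_map d (chart_inv c x) 0 j).
Proof.
apply/smooth_onP => k; apply: (smooth_upto_linl (L := @rV_coord R n j)).
- exact: chart_overlap_open.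
- exact: rV_coord_continuous.
- by have /smooth_onP := @transition_smooth _ _ _ A c d.
Qed.

Hypothesis hM : hausdorff_space M.

(** A flat function of the squared coordinate distance is extended by zero. The Hausdorff property
    makes [K] closed, so that every point outside the chart has a neighbourhood on which the
    extension vanishes. *)
Lemma bump_exists p : exists (chi : M -> R) (K : set M),
  [/\ smooth_fun A chi, compact K, K `<=` chart_dom (chart_at A p),
      forall q, ~ K q -> chi q = 0 & (forall q, 0 <= chi q) /\ 0 < chi p].
Proof.
set c := chart_at A p; have dp : chart_dom c p := chart_atP A p.
set x0 := chart_map c p.
have /nbhs_normP[e /= e0 eU] : nbhs x0 (U c).
  by apply: open_nbhs_nbhs; split; [exact: chart_image_open|exact: chart_image].
pose dl := e / 2; have dl0 : 0 < dl by rewrite divr_gt0.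
pose cube := [set y : 'rV[R]_n | forall j, `[x0 0 j - dl, x0 0 j + dl]%classic (y 0 j)].
have cubeU : cube `<=` U c.
  move=> y yc; apply: eU => /=; apply: (@le_lt_trans _ _ dl); last by rewrite /dl; lra.
  rewrite /Num.norm/= mx_normrE; apply: bigmax_le; first exact: ltW.
  move=> [i j] _ /=; rewrite ord1 !mxE; have := yc j.
  by rewrite /= in_itv/= ler_norml => /andP[h1 h2]; lra.
have ccube : compact cube.
  by apply: (@rV_compact R n (fun j => `[x0 0 j - dl, x0 0 j + dl]%classic)) => j; exact: segment_compact.
pose K := chart_inv c @` cube.
have Kd : K `<=` chart_dom c by move=> _ [y yc <-]; apply: chart_inv_dom; exact: cubeU.
have cK : compact K.
  apply: continuous_compact => //.
  by apply: continuous_subspaceW (@chart_inv_continuous R n M A c).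
have clK : closed K by exact: compact_closed.
pose Q (y : 'rV[R]_n) := \sum_j (y 0 j - x0 0 j) ^+ 2.
(* Within the chart this is positive exactly on the Euclidean ball of radius [dl], which lies in the
   compact cube with the same half-width. *)
pose chi q := if q \in chart_dom c then flat_exp 0 (dl ^+ 2 - Q (chart_map c q)) else 0.
have chi0 q : ~ K q -> chi q = 0.
  move=> nKq; rewrite /chi; case: ifPn => //; rewrite inE => dq.
  rewrite /flat_exp; case: ifPn => // h; exfalso; apply: nKq.
  exists (chart_map c q); last exact: chart_mapK.
  move=> j; rewrite /= in_itv/=.
  have : (chart_map c q 0 j - x0 0 j) ^+ 2 <= dl ^+ 2.
    apply: le_trans (_ : Q (chart_map c q) <= _); last by rewrite -subr_ge0 ltW.
    by rewrite /Q (bigD1 j)//= lerDl sumr_ge0// => i _; exact: sqr_ge0.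
  rewrite -ler_sqrt ?sqr_ge0// !sqrtr_sqr (gtr0_norm dl0) ler_norml.
  by move=> /andP[h1 h2]; apply/andP; split; lra.
exists chi, K; split=> //; last first.
  split=> [q|]; first by rewrite /chi; case: ifP => // _; exact: flat_exp_ge0.
  rewrite /chi ifT ?inE// /Q -/x0 big1 ?subr0; last by move=> j _; rewrite subrr expr0n.
  rewrite /flat_exp exprn_gt0// mulr_gt0 ?expR_gt0// invr_gt0 exprn_gt0//.
  by rewrite exprn_gt0.
move=> d; apply: smooth_on_local => x Ux.
have [dx|ndx] := pselect (chart_dom c (chart_inv d x)).
  exists (chart_map d @` (chart_dom d `&` chart_dom c)).
    exists (chart_inv d x); last exact: chart_invK.
    by split=> //; exact: chart_inv_dom.
  have oB := @chart_overlap_open d c.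
  apply: (@eq_smooth_on _ _ _ _ (fun y => flat_exp 0 (dl ^+ 2 + (-1) *
      \sum_j (chart_map c (chart_inv d y) 0 j + - x0 0 j) *
             (chart_map c (chart_inv d y) 0 j + - x0 0 j)))) => //.
    move=> y [r [dr cr] <-]; rewrite /= /chi chart_mapK// ifT ?inE//.
    by rewrite mulN1r.
  apply: (smooth_on_comp_real oB (B := setT)) => //; last exact: smooth_flat_exp.
  apply: smooth_onD => //; first exact: smooth_on_cst.
  apply: smooth_onM => //; first exact: smooth_on_cst.
  apply: smooth_on_sum => // j.
  have s1 : smooth_on (chart_map d @` (chart_dom d `&` chart_dom c))
      (fun y => chart_map c (chart_inv d y) 0 j + - x0 0 j).
    apply: smooth_onD => //; [exact: transition_coord_smooth|exact: smooth_on_cst].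
  exact: smooth_onM.
have nKx : ~ K (chart_inv d x) by move=> /Kd.
have h : \forall y \near x, ~ K (chart_inv d y).
  apply: (chart_inv_continuous_at Ux (t := ~` K)); apply: open_nbhs_nbhs; split=> //.
  by rewrite openC.
exists ([set y | ~ K (chart_inv d y)]^°); first exact: h.
apply: (@eq_smooth_on _ _ _ _ (fun=> 0)); first exact: open_interior.
  by move=> y /interior_subset nKy; rewrite /= chi0.
exact: smooth_on_cst.
Qed.

Hypothesis cM : compact [set: M].

(** The index is a point so that the chart carrying [rho p] is [chart_at A p]. Compactness gives
    finitely many bumps whose sum is positive everywhere, and each is divided by that sum. *)
Lemma partition_of_unity : exists (s : seq M) (rho : M -> M -> R) (K : M -> set M),
  [/\ forall p, smooth_fun A (rho p), forall p, compact (K p),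
      forall p, K p `<=` chart_dom (chart_at A p),
      forall p q, ~ K p q -> rho p q = 0 &
      (forall p q, 0 <= rho p q) /\ forall q, \sum_(p <- s) rho p q = 1].
Proof.
have /choice[chi /choice[K chiP]] := bump_exists.
have schi p : smooth_fun A (chi p) by case: (chiP p).
have chi_ge0 p q : 0 <= chi p q by case: (chiP p) => _ _ _ _ [].
have cM' : cover_compact [set: M] by rewrite -compact_cover.
have [|q _|s _ sP] := cM' M setT (fun p => [set q | 0 < chi p q]).
- move=> p _; have /continuousP/(_ _ (@open_gt R 0)) := smooth_fun_continuous (schi p).
  by rewrite /preimage.
- by exists q => //=; case: (chiP q) => _ _ _ _ [].
have S0 q : 0 < \sum_(p <- finmap.enum_fset s) chi p q.
  have [p ps chip] := sP q I.
  rewrite (big_rem p)//= ltr_pwDl// sumr_ge0//.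
exists (finmap.enum_fset s), (fun p q => chi p q * (\sum_(r <- finmap.enum_fset s) chi r q)^-1), K.
split=> [p|p|p|p q nK|]; try by case: (chiP p).
- apply: smooth_funM => //.
  apply: (smooth_fun_comp (u := fun q => \sum_(r <- finmap.enum_fset s) chi r q) _ (@smooth_inv R)).
    by move=> c; apply: smooth_on_sum => [|r]; [exact: chart_image_open|exact: schi].
  by move=> q; rewrite /= gt_eqF.
- by have [_ _ _ h _] := chiP p; rewrite h ?mul0r.
- split=> [p q|q]; first by rewrite mulr_ge0// invr_ge0 ltW.
  by rewrite -mulr_suml mulfV// gt_eqF.
Qed.

End SmoothFunctions.

(** * Integrals of continuous functions over the manifold *)

Section Integration.
Variables (R : realType) (n : nat) (M : ptopologicalType).
Variable A : smooth_atlas R n M.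
Hypotheses (hM : hausdorff_space M) (cM : compact [set: M]).
Local Notation U c := (chart_map c @` chart_dom c).

Lemma continuous_measurable (u : M -> R) : continuous u ->
  measurable_fun [set: borel M] (u : borel M -> R).
Proof.
move=> /continuousP cu; apply: (measurability _ (measurable_realfun.RGenOpens.measurableE R)).
move=> _ [_ [a [b ->] <-]]; rewrite setTI; apply: sub_sigma_algebra.
by apply: cu; exact: interval_open.
Qed.

Lemma continuous_bounded (u : M -> R) : continuous u ->
  [bounded u x | x in [set: M]].
Proof.
move=> cu; have : compact (u @` [set: M]).
  by apply: continuous_compact => //; apply: continuous_subspaceT.
move/compact_bounded => -[B [Br BP]]; exists B; split=> // B' BB' x _.
by apply: (BP _ BB'); exists x.
Qed.

Variables (g : tensor2 A) (mu : {measure set (borel M) -> \bar R}).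
Hypotheses (rg : riemannian_metric g) (rmu : riemannian_measure g mu).
Implicit Types u v psi : M -> R.

(** The defining property of the measure only speaks of functions supported in a chart. Writing 1 as
    the sum of the partition functions, whose integrals are real numbers by that property, bounds
    the total mass; nonnegativity allows the exchange before integrability is known. *)
Lemma measure_finite : (mu [set: M] < +oo)%E.
Proof.
have [s [rho [K [srho cK Kd rhoK [rho0 rho1]]]]] := partition_of_unity A hM cM.
have cr p : continuous (rho p) := smooth_fun_continuous (srho p).
have <- : (\int[mu]_(x in [set: borel M]) 1%:E)%E = mu [set: M].
  by rewrite integral_cst// mul1e.
have -> : (\int[mu]_(x in [set: borel M]) 1%:E)%E =
    (\int[mu]_(x in [set: borel M]) \sum_(p <- s) (rho p x)%:E)%E.
  by apply: eq_integral => x _; rewrite sumEFin rho1.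
rewrite ge0_integral_sum//.
- rewrite (eq_bigr (fun p => (integral_rV (extend0 (chart_at A p) (fun x =>
    rho p (chart_inv (chart_at A p) x) * density g (chart_at A p) x)))%:E)).
    by rewrite sumEFin ltry.
  move=> p _; apply: (chart_integral rmu (cK p)) => //; exact: rhoK.
- by move=> p; apply/measurable_realfun.measurable_EFinP; exact: continuous_measurable.
- by move=> p x _; rewrite lee_fin.
Qed.

Lemma continuous_integrable u : continuous u ->
  mu.-integrable [set: borel M] (EFin \o (u : borel M -> R)).
Proof.
move=> cu; apply: measurable_bounded_integrable => //.
- exact: measure_finite.
- exact: continuous_measurable.
- exact: continuous_bounded.
Qed.

Lemma integralD_cont u v : continuous u -> continuous v ->
  \int[mu]_p (u p + v p) = \int[mu]_p u p + \int[mu]_p v p.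
Proof. by move=> cu cv; apply: RintegralD => //; exact: continuous_integrable. Qed.

Lemma integralZ_cont (a : R) u : continuous u ->
  \int[mu]_p (a * u p) = a * \int[mu]_p u p.
Proof. by move=> cu; apply: RintegralZl => //; exact: continuous_integrable. Qed.

Lemma eq_integral_fun u v : (forall p, u p = v p) -> \int[mu]_p u p = \int[mu]_p v p.
Proof. by move=> uv; congr (fine _); apply: eq_integral => p _; rewrite uv. Qed.

Lemma integral0_fun u : (forall p, u p = 0) -> \int[mu]_p u p = 0.
Proof.
move=> u0; rewrite (eq_integral_fun (v := fun p => 0 * u p)); last by move=> p; rewrite u0 mulr0.
rewrite integralZ_cont ?mul0r// (_ : u = fun=> 0); first exact: continuous_cst_fun.
exact/funext.
Qed.

Lemma integral_sum_cont (I : Type) (s : seq I) (u : I -> M -> R) :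
  (forall i, continuous (u i)) ->
  \int[mu]_p (\sum_(i <- s) u i p) = \sum_(i <- s) \int[mu]_p u i p.
Proof.
move=> cu; elim: s => [|i s IH].
  by rewrite big_nil integral0_fun// => p; rewrite big_nil.
rewrite big_cons -IH -integralD_cont//; last by apply: continuous_sum.
by apply: eq_integral_fun => p; rewrite big_cons.
Qed.

Lemma le_integral_cont u v : continuous u -> continuous v -> (forall p, u p <= v p) ->
  \int[mu]_p u p <= \int[mu]_p v p.
Proof.
by move=> cu cv uv; apply: le_Rintegral => //; exact: continuous_integrable.
Qed.

(* An integral identity that is local and additive in psi may be checked in one chart. *)
Lemma integral_localize (Phi : (M -> R) -> M -> R) :
  (forall psi, smooth_fun A psi -> continuous (Phi psi)) ->
  (forall psi chi, smooth_fun A psi -> smooth_fun A chi ->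
    forall p, Phi (fun q => psi q + chi q) p = Phi psi p + Phi chi p) ->
  (forall p, Phi (fun=> 0) p = 0) ->
  (forall (c : chart A) (K : set M) psi, compact K -> K `<=` chart_dom c ->
    smooth_fun A psi -> (forall p, ~ K p -> psi p = 0) -> \int[mu]_p Phi psi p = 0) ->
  forall psi, smooth_fun A psi -> \int[mu]_p Phi psi p = 0.
Proof.
move=> cP PD P0 Ploc psi spsi.
have [s [rho [K [srho cK Kd rhoK [rho0 rho1]]]]] := partition_of_unity A hM cM.
have sp p : smooth_fun A (fun q => rho p q * psi q) by exact: smooth_funM.
have E (r : seq M) q : Phi (fun x => \sum_(p <- r) rho p x * psi x) q =
    \sum_(p <- r) Phi (fun x => rho p x * psi x) q.
  elim: r => [|p r IH].
    by rewrite big_nil -(P0 q); congr (Phi _ q); apply/funext => x; rewrite big_nil.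
  rewrite big_cons -IH -PD//; last first.
    by move=> c; apply: smooth_on_sum => [|p']; [exact: chart_image_open|exact: sp].
  by congr (Phi _ q); apply/funext => x; rewrite big_cons.
rewrite (eq_integral_fun (v := fun q => \sum_(p <- s) Phi (fun x => rho p x * psi x) q)).
  rewrite integral_sum_cont ?big1// => [p _|p]; last exact: cP.
  apply: (Ploc (chart_at A p) (K p)) => // q nK.
  by rewrite rhoK// mul0r.
move=> q; rewrite -E; congr (Phi _ q); apply/funext => x.
by rewrite -mulr_suml rho1 mul1r.
Qed.

(** At a point where [u] is positive some partition function is positive too, and their product has
    positive integral in a chart, yet is dominated by [u]. *)
Lemma integral_eq0_ge0 u : continuous u -> (forall p, 0 <= u p) -> \int[mu]_p u p = 0 ->
  forall p, u p = 0.
Proof.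
move=> cu u0 Iu x; apply/eqP; rewrite eq_le u0 andbT leNgt; apply/negP => ux.
have [s [rho [K [srho cK Kd rhoK [rho0 rho1]]]]] := partition_of_unity A hM cM.
have cr p : continuous (rho p) := smooth_fun_continuous (srho p).
have rle p q : p \in s -> rho p q <= 1.
  move=> ps; rewrite -(rho1 q) (big_rem p)//= lerDl sumr_ge0//.
have [p ps rx] : exists2 p, p \in s & 0 < rho p x.
  apply: contrapT => h; suff: (1 : R) = 0 by move/eqP; rewrite oner_eq0.
  rewrite -(rho1 x) big1_seq// => p /andP[_ ps]; apply/eqP; rewrite eq_le rho0 andbT leNgt.
  by apply/negP => rx; apply: h; exists p.
set c := chart_at A p; have dx : chart_dom c x by apply: contrapT => nx; move: rx; rewrite rhoK ?ltxx// => /Kd.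
have cv : continuous (fun q => rho p q * u q) by exact: continuous_mul.
have v0 q : ~ K p q -> rho p q * u q = 0 by move=> nK; rewrite rhoK// mul0r.
have : \int[mu]_q (rho p q * u q) <= 0.
  by rewrite -Iu; apply: le_integral_cont => // q; rewrite ler_piMl// rle.
rewrite /Rintegral (chart_integral rmu (cK p) (Kd p) cv v0)/= -/c leNgt => /negP; apply.
pose F y := rho p (chart_inv c y) * u (chart_inv c y) * density g c y.
have cF y : U c y -> {for y, continuous F}.
  move=> Uy; apply: (continuousM (continuous_in_chart cv Uy)).
  by apply: differentiable_continuous; have sd := @smooth_density R n M A g rg c; exact: (sd [::]).
have F0 y : U c y -> ~ K p (chart_inv c y) -> F y = 0 by move=> _ nK; rewrite /F v0// mul0r.
have [r r0 sr] := extend0_supported (cK p) (Kd p) F0 cF.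
apply: (integral_rV_gt0 (x := chart_map c x) r0 sr) => [y|].
  rewrite /extend0; case: ifP => // _; rewrite /F mulr_ge0 ?sqrtr_ge0// mulr_ge0//.
rewrite extend0_in; last exact: chart_image.
rewrite /F chart_mapK// mulr_gt0 ?mulr_gt0// /density chart_mapK// sqrtr_gt0.
exact: (metric_det_gt0 rg).
Qed.
End Integration.

(** * Curvature in coordinates and chart independence *)

Section Evaluation.
Variables (R : realType) (V : normedModType R) (O : open_domain V).
Local Notation OO := (open_domain_set O).

Definition evmx (x : V) p q (X : 'M[sfun O]_(p, q)) : 'M[R]_(p, q) :=
  \matrix_(i, j) X i j x.

Lemma evmxM x p q r (X : 'M[sfun O]_(p, q)) (Y : 'M[sfun O]_(q, r)) :
  evmx x (X *m Y) = evmx x X *m evmx x Y.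
Proof.
apply/matrixP => i j; rewrite !mxE sfun_sum; apply: eq_bigr => k _.
by rewrite sfunM !mxE.
Qed.

Lemma evmx_tr x p q (X : 'M[sfun O]_(p, q)) : evmx x X^T = (evmx x X)^T.
Proof. by apply/matrixP => i j; rewrite !mxE. Qed.

Lemma evmx1 x p : OO x -> evmx x (1%:M : 'M[sfun O]_p) = 1%:M.
Proof.
move=> Ox; apply/matrixP => i j; rewrite !mxE; case: (i == j) => //.
exact: sfun1.
Qed.

Lemma ev_pairing x p (P X Y : 'M[sfun O]_p) :
  pairing P X Y x = pairing (evmx x P) (evmx x X) (evmx x Y).
Proof.
rewrite /pairing; do 4 (rewrite sfun_sum; apply: eq_bigr => ? _).
by rewrite !sfunM !mxE.
Qed.

Lemma evmx_inv x p (g P : 'M[sfun O]_p) : P *m g = 1%:M -> OO x ->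
  evmx x P = invmx (evmx x g).
Proof.
move=> Pg Ox; have h : evmx x P *m evmx x g = 1%:M by rewrite -evmxM Pg evmx1.
have u : evmx x g \in unitmx by have /mulmx1_unit[] := h.
by rewrite -[LHS]mulmx1 -(mulmxV u) mulmxA h mul1mx.
Qed.

Definition sfun_invmx p (g : 'M[sfun O]_p) : 'M[sfun O]_p :=
  to_sfun O (fun x => ((\det g : sfun O) x)^-1) *: \adj g.

Lemma sfun_mulVmx p (g : 'M[sfun O]_p) :
  (forall x, OO x -> (\det g : sfun O) x != 0) -> sfun_invmx g *m g = 1%:M.
Proof.
move=> g0; rewrite /sfun_invmx -scalemxAl mul_adj_mx.
apply/matrixP => i j; rewrite !mxE.
by case: (i == j); rewrite ?mulr0// mulrC to_sfunV.
Qed.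

End Evaluation.

Section Partials.
Variables (R : realType) (V : normedModType R) (O : open_domain V) (I : Type) (e : I -> V).

Definition partials i : {additive sfun O -> sfun O} := sder (e i).

Lemma partialsE i (a : sfun O) x : open_domain_set O x -> partials i a x = 'D_(e i) a x.
Proof. exact: sderE. Qed.

Lemma partials_derivation i : derivation (partials i).
Proof. exact: sderM. Qed.

Lemma partialsC i j a : partials i (partials j a) = partials j (partials i a).
Proof. exact: sderC. Qed.
End Partials.

(* A slice [iota] of a domain of [V] in affine position: the coordinate derivatives of
   [F \o iota] are the derivatives of [F] along the vectors [e i]. *)
Section CoordinateLink.
Variables (R : realType) (n : nat) (V : normedModType R).
Variables (iota : 'rV[R]_n -> V) (e : 'I_n -> V) (O : open_domain V).
Local Notation OO := (open_domain_set O).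
Hypothesis iotaE : forall (x : 'rV[R]_n) i (t : R),
  iota (t *: delta_mx 0 i + x) = t *: e i + iota x.
Hypothesis iota_cont : continuous iota.
Implicit Types (x : 'rV[R]_n) (i j k l : 'I_n).
Local Notation S := (sfun O).
Local Notation d := (partials O e).
Local Notation half := (sconst O 2^-1).

Lemma pderiv_slice (F : V -> R) i x : pderiv i (F \o iota) x = 'D_(e i) F (iota x).
Proof.
rewrite /pderiv /derive; congr (lim _).
by rewrite (_ : (fun h : R => _) = (fun h : R => h^-1 *: ((F \o shift (iota x)) (h *: e i) - F (iota x)))) //;
   apply/funext => t /=; rewrite iotaE.
Qed.

Lemma near_slice x : OO (iota x) -> \forall y \near x, OO (iota y).
Proof.
move=> Ox; have := iota_cont (x := x) (t := OO); apply; apply: open_nbhs_nbhs; split=> //.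
exact: open_domainP.
Qed.

Lemma pderiv_sfun (u : 'rV[R]_n -> R) (a : S) i x :
  (forall y, OO (iota y) -> u y = a (iota y)) -> OO (iota x) ->
  pderiv i u x = d i a (iota x).
Proof.
move=> ua Ox; rewrite partialsE// -pderiv_slice; apply: near_eq_derive.
by apply: filterS (near_slice Ox) => y Oy; rewrite ua.
Qed.

Variables (gm : 'rV[R]_n -> 'M[R]_n) (g P : 'M[S]_n).
Hypothesis gT : g^T = g.
Hypothesis Pg : P *m g = 1%:M.
Hypothesis gmE : forall x, OO (iota x) -> gm x = evmx (iota x) g.
Local Notation G := (gam d half g P).

Lemma ginv_sfun i j x : OO (iota x) -> ginv gm i j x = P i j (iota x).
Proof. by move=> Ox; rewrite /ginv gmE// -(evmx_inv Pg)// mxE. Qed.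

Lemma christoffel_sfun k i j x : OO (iota x) -> christoffel gm k i j x = G i j k (iota x).
Proof.
move=> Ox; rewrite mxE sfunM sconstE// sfun_sum; congr (_ * _).
apply: eq_bigr => l _; rewrite sfunM sfunB sfunD ginv_sfun//; congr (_ * _).
have E a b y : OO (iota y) -> gm y a b = g a b (iota y) by move=> Oy; rewrite gmE// mxE.
by rewrite !(pderiv_sfun _ (E _ _)).
Qed.

Let ev_curv (a b c f : S) y : (a - b + c - f) y = a y - b y + (c y - f y).
Proof. by rewrite addrA. Qed.

Lemma christoffel_sfunC k i j x : OO (iota x) -> christoffel gm k i j x = G j i k (iota x).
Proof.
move=> Ox; apply: etrans (christoffel_sfun k i j Ox) _.
have E : G i j k = G j i k by exact: gam_sym.
exact: (congr1 (fun a : S => a (iota x)) E).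
Qed.

Lemma ricci_sfun i j x : OO (iota x) -> ricci gm i j x = ric d G i j (iota x).
Proof.
move=> Ox; rewrite mxE sfun_sum; apply: eq_bigr => k _.
rewrite curvE (ev_curv _ _ _ _ (iota x)); congr (_ + _).
  rewrite (pderiv_sfun _ (christoffel_sfunC k i j) Ox).
  by rewrite (pderiv_sfun _ (christoffel_sfunC k i k) Ox).
rewrite sumrB; congr (_ - _); rewrite sfun_sum; apply: eq_bigr => l _.
  rewrite (christoffel_sfun k k l Ox) (christoffel_sfunC l i j Ox); exact: mulrC.
rewrite (christoffel_sfun k j l Ox) (christoffel_sfunC l i k Ox); exact: mulrC.
Qed.

Lemma hessian_sfun (u : 'rV[R]_n -> R) (a : S) i j x :
  (forall y, OO (iota y) -> u y = a (iota y)) -> OO (iota x) ->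
  hessian gm u i j x = hess d G a i j (iota x).
Proof.
move=> ua Ox; rewrite mxE sfunB sfun_sum; congr (_ - _).
  by apply: pderiv_sfun => // y Oy; apply: pderiv_sfun.
apply: eq_bigr => k _; rewrite sfunM (christoffel_sfun _ _ _ Ox); congr (_ * _).
exact: pderiv_sfun.
Qed.

End CoordinateLink.

Section Pullback.
Variables (R : realType) (V W : normedModType R) (O : open_domain V) (Q : open_domain W).
Local Notation OO := (open_domain_set O).
Local Notation QQ := (open_domain_set Q).

Record smooth_map := SmoothMap {
  smooth_map_fun :> V -> W;
  smooth_map_dom : forall x, OO x -> QQ (smooth_map_fun x);
  smooth_map_comp : forall F : W -> R, smooth_on QQ F -> smooth_on OO (F \o smooth_map_fun) }.

Variable T : smooth_map.
Definition pullback (a : sfun Q) : sfun O := to_sfun O (a \o T).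

Lemma pullbackE a x : OO x -> pullback a x = a (T x).
Proof. by move=> Ox; rewrite to_sfunE//; apply: smooth_map_comp; exact: sfun_smooth. Qed.

Lemma pullback_is_zmod_morphism : zmod_morphism pullback.
Proof. by move=> a b; apply: sfun_eq => x Ox; rewrite sfunB !pullbackE. Qed.

Lemma pullback_is_monoid_morphism : monoid_morphism pullback.
Proof.
split=> [|a b]; apply: sfun_eq => x Ox.
  by rewrite pullbackE// !sfun1//; exact: smooth_map_dom.
by rewrite sfunM !pullbackE.
Qed.

HB.instance Definition _ :=
  GRing.isZmodMorphism.Build (sfun Q) (sfun O) pullback pullback_is_zmod_morphism.
HB.instance Definition _ :=
  GRing.isMonoidMorphism.Build (sfun Q) (sfun O) pullback pullback_is_monoid_morphism.

Lemma evmx_pullback x p q (X : 'M[sfun Q]_(p, q)) : OO x ->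
  evmx x (map_mx pullback X) = evmx (T x) X.
Proof. by move=> Ox; apply/matrixP => i j; rewrite !mxE pullbackE. Qed.

End Pullback.

Section Tensors.
Variables (R : realType) (n : nat) (M : ptopologicalType).
Variable A : smooth_atlas R n M.
Local Notation U c := (chart_map c @` chart_dom c).
Local Notation ev i := (delta_mx 0 i : 'rV[R]_n).
Implicit Types (c d : chart A) (p : M) (x : 'rV[R]_n) (X Y : tensor2 A) (u v : M -> R).

Definition overlap c d : open_domain 'rV[R]_n :=
  OpenDomain (@chart_overlap_open R n M A c d).
Local Notation UU c d := (open_domain_set (overlap c d)).

Lemma overlap_transition c d x : UU c d x -> UU d c (chart_map d (chart_inv c x)).
Proof. by case=> p [cp dp] <-; rewrite chart_mapK//; exists p. Qed.

Lemma transition_comp c d (F : 'rV[R]_n -> R) : smooth_on (UU d c) F ->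
  smooth_on (UU c d) (F \o (chart_map d \o chart_inv c)).
Proof.
move=> sF; apply: (smooth_on_comp (T := chart_map d \o chart_inv c) (@coordinates_rV R n) _ _ _ sF).
- exact: chart_overlap_open.
- exact: overlap_transition.
- by move=> a; exact: transition_coord_smooth.
Qed.

Definition transition c d : smooth_map (overlap c d) (overlap d c) :=
  SmoothMap (@overlap_transition c d) (@transition_comp c d).
Local Notation phi c d := (pullback (transition c d)).
Local Notation dd c d := (partials (overlap c d) (fun i : 'I_n => ev i)).

Definition transition_coord c d a : sfun (overlap c d) :=
  to_sfun (overlap c d) (fun x => chart_map d (chart_inv c x) 0 a).

Lemma transition_coordE c d a x : UU c d x ->
  transition_coord c d a x = chart_map d (chart_inv c x) 0 a.
Proof. by move=> Ox; rewrite to_sfunE//; exact: transition_coord_smooth. Qed.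

Definition transition_jac c d : 'M[sfun (overlap c d)]_n :=
  \matrix_(i, a) dd c d i (transition_coord c d a).
Local Notation J := transition_jac.

Lemma partials_transition_coord c d i a x : UU c d x ->
  dd c d i (transition_coord c d a) x =
  'D_(ev i) (fun y => chart_map d (chart_inv c y) 0 a) x.
Proof.
move=> Ox; rewrite partialsE//; apply: near_eq_derive.
apply: (near_open_eq (@chart_overlap_open R n M A c d) Ox) => y Oy.
exact: transition_coordE.
Qed.

Lemma transition_chain c d i (b : sfun (overlap d c)) :
  dd c d i (phi c d b) = \sum_a J c d i a * phi c d (dd d c a b).
Proof.
apply: sfun_eq => x Ox; rewrite sfun_sum partialsE//.
have oO := @chart_overlap_open R n M A c d.
rewrite (near_eq_derive (g := fun y => b (chart_map d (chart_inv c y)))); last first.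
  by apply: (near_open_eq oO Ox) => y Oy; rewrite pullbackE.
rewrite (@derive_comp_coordinates R _ _ _ (fun a : 'I_n => delta_mx 0 a)
  (fun a => @rV_coord R n a) (fun y => chart_map d (chart_inv c y)) b x (ev i) (@coordinates_rV R n)).
- apply: eq_bigr => a _; rewrite sfunM mxE partials_transition_coord//; congr (_ * _).
  by rewrite pullbackE// partialsE//; exact: overlap_transition.
- by move=> a; apply: (@transition_coord_smooth R n M A c d a [::]).
- by apply: sfun_differentiable; exact: overlap_transition.
Qed.

Lemma transition_jac_sym c d i j a : dd c d i (J c d j a) = dd c d j (J c d i a).
Proof. by rewrite !mxE partialsC. Qed.

(** The chain rule applied to a coordinate of the reverse transition, whose pullback is a coordinate
    function of the first chart. *)
Lemma transition_jacV c d : J c d *m map_mx (phi c d) (J d c) = 1%:M.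
Proof.
apply/matrixP => i j; rewrite !mxE.
have E : phi c d (transition_coord d c j) = to_sfun (overlap c d) (fun x => x 0 j).
  apply: esym; apply: to_sfun_eq => x Ox; rewrite pullbackE// transition_coordE//=; last exact: overlap_transition.
  by case: Ox => p [cp dp] <-; rewrite !chart_mapK.
have := transition_chain i (transition_coord d c j).
rewrite E => E2.
have -> : \sum_k J c d i k * map_mx (phi c d) (J d c) k j =
   dd c d i (to_sfun (overlap c d) (fun x => x 0 j)).
  by rewrite E2; apply: eq_bigr => k _; rewrite [map_mx _ _ _ _]mxE [J d c k j]mxE.
have sj : smooth_on (UU c d) (fun x : 'rV[R]_n => x 0 j).
  apply/smooth_onP => k.
  have h := @smooth_upto_lin R k _ _ (UU c d) (@rV_coord R n j) (@rV_coord_continuous R n j).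
  exact: h.
apply: sfun_eq => x Ox; rewrite partialsE//.
rewrite (near_eq_derive (g := @rV_coord R n j)); last first.
  by apply: (near_open_eq (@chart_overlap_open R n M A c d) Ox) => y Oy; rewrite to_sfunE.
rewrite deriveE; last by apply: linear_differentiable; exact: rV_coord_continuous.
rewrite diff_lin; last exact: rV_coord_continuous.
rewrite /= /rV_coord mxE eqxx/=.
by case: (i =P j) => [->|/eqP ij]; rewrite ?eqxx ?sfun1// eq_sym (negPf ij) sfun0.
Qed.

Lemma transition_jacobian c d x : UU c d x ->
  jacobian (chart_map d \o chart_inv c) x = evmx x (J c d).
Proof.
move=> Ox; have dT : differentiable (chart_map d \o chart_inv c) x.
  by apply: (@transition_smooth R n M A c d [::]).
apply/matrixP => i a; rewrite [RHS]mxE [J c d i a]mxE partials_transition_coord//.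
have <- : (ev i *m jacobian (chart_map d \o chart_inv c) x) 0 a = jacobian (chart_map d \o chart_inv c) x i a.
  by rewrite -rowE mxE.
rewrite -(deriveEjacobian _ dT).
have da : differentiable (@rV_coord R n a) (chart_map d (chart_inv c x)).
  by apply: linear_differentiable; exact: rV_coord_continuous.
rewrite (deriveE (f := fun y => rV_coord a (chart_map d (chart_inv c y)))); last exact: differentiable_comp.
rewrite (diff_comp (f := chart_map d \o chart_inv c) (g := @rV_coord R n a) dT da) /=.
by rewrite diff_lin; [rewrite deriveE|exact: rV_coord_continuous].
Qed.

(** Only the transformation rule is retained from [smooth_sym_tensor], because the dyad of two
    different functions is not symmetric. *)
Definition tensor_law X := forall c d p, chart_dom c p -> chart_dom d p ->
  let K := jacobian (chart_map d \o chart_inv c) (chart_map c p) in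
  X c p = K *m X d p *m K^T.

Lemma tensor_lawE X c d p : tensor_law X -> chart_dom c p -> chart_dom d p ->
  X c p = evmx (chart_map c p) (J c d) *m X d p *m (evmx (chart_map c p) (J c d))^T.
Proof. by move=> lX cp dp; rewrite -transition_jacobian; [exact: lX|exists p]. Qed.

Lemma transition_jac_unit c d x : UU c d x -> exists K, evmx x (J c d) *m K = 1%:M.
Proof.
move=> Ox; exists (evmx x (map_mx (phi c d) (J d c))).
by rewrite -evmxM transition_jacV evmx1.
Qed.
End Tensors.

Lemma evmxE (R : realType) (V : normedModType R) (O : open_domain V) (x : V) p q
    (X : 'M[sfun O]_(p, q)) i j : evmx x X i j = X i j x.
Proof. by rewrite [LHS]mxE. Qed.

Section TensorLaws.
Variables (R : realType) (n : nat) (M : ptopologicalType).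
Variable A : smooth_atlas R n M.
Local Notation U c := (chart_map c @` chart_dom c).
Local Notation ev i := (delta_mx 0 i : 'rV[R]_n).
Implicit Types (c d : chart A) (p : M) (x : 'rV[R]_n) (X Y : tensor2 A) (u v : M -> R).
Local Notation UU c d := (open_domain_set (overlap c d)).
Local Notation phi c d := (pullback (transition c d)).
Local Notation dd c d := (partials (overlap c d) (fun i : 'I_n => ev i)).
Local Notation J := transition_jac.

Lemma overlap_sub c d : UU c d `<=` U c.
Proof. by move=> _ [p [cp dp] <-]; exact: chart_image. Qed.

Lemma overlap_in c d p : chart_dom c p -> chart_dom d p -> UU c d (chart_map c p).
Proof. by move=> cp dp; exists p. Qed.

Definition chart_sfun u c d : sfun (overlap c d) := to_sfun (overlap c d) (u \o chart_inv c).

Lemma chart_sfunE u c d x : smooth_fun A u -> UU c d x -> chart_sfun u c d x = u (chart_inv c x).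
Proof. by move=> su Ox; rewrite to_sfunE//; apply: smooth_on_sub (su c); exact: overlap_sub. Qed.

Lemma pullback_chart_sfun u c d : smooth_fun A u -> phi c d (chart_sfun u d c) = chart_sfun u c d.
Proof.
move=> su; apply: sfun_eq => x Ox; rewrite pullbackE// !chart_sfunE//.
  by case: Ox => p [cp dp] <-; rewrite /= !chart_mapK.
exact: overlap_transition.
Qed.

Definition gradient_dyad u v : tensor2 A := fun c p => \matrix_(i, j)
  (pderiv i (u \o chart_inv c) (chart_map c p) * pderiv j (v \o chart_inv c) (chart_map c p)).

(** On an overlap the slice is the identity map, so the comparison of coordinate formulas with ring
    formulas is shared with the space-time charts used for families. *)
Let idE (x : 'rV[R]_n) (i : 'I_n) (t : R) : id (t *: ev i + x) = t *: ev i + id x.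
Proof. by []. Qed.

Let id_cont : continuous (@id 'rV[R]_n).
Proof. by move=> x. Qed.

Lemma pderiv_overlap u c d i x : smooth_fun A u -> UU c d x ->
  pderiv i (u \o chart_inv c) x = dd c d i (chart_sfun u c d) x.
Proof.
move=> su Ox; apply: (@pderiv_sfun R n _ id (fun i => ev i) _ idE id_cont _ _ i x) => //.
by move=> y Oy; rewrite chart_sfunE.
Qed.

Lemma gradient_dyad_overlap u v c d p : smooth_fun A u -> smooth_fun A v ->
  chart_dom c p -> chart_dom d p -> gradient_dyad u v c p =
  evmx (chart_map c p) (dif (dd c d) (chart_sfun u c d) *m (dif (dd c d) (chart_sfun v c d))^T).
Proof.
move=> su sv cp dp; apply/matrixP => i j; rewrite !mxE big_ord_recl big_ord0 addr0 !mxE sfunM.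
by rewrite !(pderiv_overlap (d := d))//; exact: overlap_in.
Qed.

Lemma dif_chart_sfun u c d : smooth_fun A u ->
  dif (dd c d) (chart_sfun u c d) = J c d *m map_mx (phi c d) (dif (dd d c) (chart_sfun u d c)).
Proof.
move=> su; rewrite -(dif_change (@transition_chain R n M A c d)).
by congr (dif _ _); rewrite -(pullback_chart_sfun c d su).
Qed.

Lemma gradient_dyad_law u v : smooth_fun A u -> smooth_fun A v -> tensor_law (gradient_dyad u v).
Proof.
move=> su sv c d p cp dp /=; have Ox := overlap_in cp dp.
rewrite (gradient_dyad_overlap su sv cp dp) (gradient_dyad_overlap su sv dp cp).
rewrite (transition_jacobian Ox) (dif_chart_sfun c d su) (dif_chart_sfun c d sv).
have TE : transition c d (chart_map c p) = chart_map d p by rewrite /= chart_mapK.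
move: (dif _ (chart_sfun u d c)) (dif _ (chart_sfun v d c)) => X Y.
rewrite (evmxM _ (J c d *m map_mx _ X)) (evmxM _ (J c d)) evmx_tr (evmxM _ (J c d) (map_mx _ Y)).
rewrite (evmx_pullback _ X Ox) (evmx_pullback _ Y Ox) TE (evmxM _ X) evmx_tr.
by rewrite trmx_mul !mulmxA.
Qed.

Section Metric.
Variable g : tensor2 A.
Hypothesis rg : riemannian_metric g.

Definition chart_metric c d : 'M[sfun (overlap c d)]_n :=
  \matrix_(i, j) to_sfun (overlap c d) (fun x => g c (chart_inv c x) i j).

Lemma evmx_chart_metric c d x : UU c d x -> evmx x (chart_metric c d) = g c (chart_inv c x).
Proof.
move=> Ox; apply/matrixP => i j; rewrite !mxE to_sfunE//.
by case: rg => -[_ sg _] _; apply: smooth_on_sub (sg c i j); exact: overlap_sub.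
Qed.

Lemma chart_metric_sym c d : (chart_metric c d)^T = chart_metric c d.
Proof.
apply/matrixP => i j; rewrite mxE; apply: sfun_eq => x Ox.
have /matrixP E := evmx_chart_metric Ox.
have /matrixP S := metric_sym rg (chart_inv_dom (overlap_sub Ox)).
by have := E i j; have := E j i; rewrite ![evmx _ _ _ _]mxE => -> ->; rewrite -S mxE.
Qed.

Lemma chart_metric_det c d x : UU c d x -> (\det (chart_metric c d) : sfun (overlap c d)) x != 0.
Proof.
move=> Ox; rewrite sfun_det//.
rewrite (_ : map_mx _ _ = evmx x (chart_metric c d)); last by apply/matrixP => i j; rewrite !mxE.
by rewrite evmx_chart_metric// gt_eqF// (metric_det_gt0 rg)//; exact: chart_inv_dom (overlap_sub Ox).
Qed.

Let P c d := sfun_invmx (chart_metric c d).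
Let PV c d : P c d *m chart_metric c d = 1%:M.
Proof. by apply: sfun_mulVmx => x Ox; exact: chart_metric_det. Qed.

Let gE c d : tensor_law g -> chart_metric c d =
  J c d *m map_mx (phi c d) (chart_metric d c) *m (J c d)^T.
Proof.
move=> lg; apply/matrixP => i j; apply: sfun_eq => x Ox.
rewrite -evmxE -(evmxE _ (J c d *m _ *m _)) evmx_chart_metric//.
have dx : chart_dom c (chart_inv c x) by exact: chart_inv_dom (overlap_sub Ox).
have ex : chart_dom d (chart_inv c x) by case: Ox => q [cq dq] <-; rewrite chart_mapK.
rewrite (tensor_lawE lg dx ex) chart_invK; last exact: overlap_sub Ox.
rewrite (evmxM _ (J c d *m _)) (evmxM _ (J c d)) evmx_tr (evmx_pullback _ _ Ox) evmx_chart_metric; last exact: overlap_transition.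
by rewrite /= chart_mapK.
Qed.

Lemma metric_law : tensor_law g.
Proof. by case: rg => -[_ _ lg] _ c d p cp dp; exact: lg. Qed.

Definition ricci_tensor : tensor2 A :=
  fun c p => \matrix_(i, j) ricci (local_metric g c) i j (chart_map c p).
Definition hessian_tensor u : tensor2 A :=
  fun c p => \matrix_(i, j) hessian (local_metric g c) (u \o chart_inv c) i j (chart_map c p).

Let gmE c d x : UU c d (id x) -> local_metric g c x = evmx (id x) (chart_metric c d).
Proof. by move=> Ox; rewrite evmx_chart_metric. Qed.

Lemma ricci_tensor_law : tensor_law ricci_tensor.
Proof.
move=> c d p cp dp /=; have Ox := overlap_in cp dp; have Oy := overlap_in dp cp.
have E a b : UU a b (chart_map a p) -> ricci_tensor a p = evmx (chart_map a p)
    (ric (dd a b) (gam (dd a b) (sconst (overlap a b) 2^-1) (chart_metric a b) (P a b))).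
  move=> Oa; apply/matrixP => i j; rewrite !mxE.
  by rewrite (ricci_sfun idE id_cont (chart_metric_sym a b) (PV a b) (@gmE a b) i j Oa) mxE.
rewrite (E _ _ Ox) (E _ _ Oy) (transition_jacobian Ox).
rewrite (ric_change (@partials_derivation _ _ _ _ _) (@partialsC _ _ _ _ _)
  (sconst_half _) (sconst_half _) (@transition_chain R n M A c d) (@transition_jac_sym R n M A c d)
  (transition_jacV c d) (chart_metric_sym d c) (PV c d) (PV d c) (gE c d metric_law)).
move: (ric _ _) => X; have TE : transition c d (chart_map c p) = chart_map d p by rewrite /= chart_mapK.
by rewrite (evmxM _ (J c d *m _)) (evmxM _ (J c d)) evmx_tr (evmx_pullback _ X Ox) TE.
Qed.

Lemma hessian_tensor_law u : smooth_fun A u -> tensor_law (hessian_tensor u).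
Proof.
move=> su c d p cp dp /=; have Ox := overlap_in cp dp; have Oy := overlap_in dp cp.
have E a b : UU a b (chart_map a p) -> hessian_tensor u a p = evmx (chart_map a p)
    (hess (dd a b) (gam (dd a b) (sconst (overlap a b) 2^-1) (chart_metric a b) (P a b))
      (chart_sfun u a b)).
  move=> Oa; apply/matrixP => i j; rewrite !mxE.
  rewrite (hessian_sfun idE id_cont (PV a b) (@gmE a b) i j (a := chart_sfun u a b) _ Oa) ?mxE//.
  by move=> y Oy'; rewrite chart_sfunE.
rewrite (E _ _ Ox) (E _ _ Oy) (transition_jacobian Ox) -(pullback_chart_sfun c d su).
rewrite (hess_change (@partials_derivation _ _ _ _ _)
  (sconst_half _) (sconst_half _) (@transition_chain R n M A c d) (@transition_jac_sym R n M A c d)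
  (transition_jacV c d) (chart_metric_sym d c) (PV c d) (PV d c) (gE c d metric_law)).
move: (hess _ _ _) => X; have TE : transition c d (chart_map c p) = chart_map d p by rewrite /= chart_mapK.
by rewrite (evmxM _ (J c d *m _)) (evmxM _ (J c d)) evmx_tr (evmx_pullback _ X Ox) TE.
Qed.

Definition contraction X Y p : R :=
  let c := chart_at A p in pairing (invmx (g c p)) (X c p) (Y c p).

Lemma metric_mulVmx c p : chart_dom c p -> invmx (g c p) *m g c p = 1%:M.
Proof.
by move=> cp; apply: mulVmx; apply: posdef_unit; exact: (metric_posdef rg).
Qed.

(** The chart in [contraction] depends on the point in an uncontrolled way. Evaluating in one fixed
    chart near a point is what makes scalar invariants smooth and lets ring identities be applied to
    them. *)
Lemma contractionE X Y c p : tensor_law X -> tensor_law Y -> chart_dom c p ->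
  contraction X Y p = pairing (invmx (g c p)) (X c p) (Y c p).
Proof.
move=> lX lY cp; have dp := chart_atP A p; rewrite /contraction /=.
have Ox := overlap_in dp cp; have [K JK] := transition_jac_unit Ox.
apply: (pairing_change JK (metric_sym rg cp) (metric_mulVmx dp) (metric_mulVmx cp)).
- exact: tensor_lawE metric_law dp cp.
- exact: tensor_lawE lX dp cp.
- exact: tensor_lawE lY dp cp.
Qed.
End Metric.
End TensorLaws.

(** * One-parameter families of metrics *)

Section SpaceTime.
Variables (R : realType) (n : nat).
Local Notation ST := (R * 'rV[R]_n)%type.
Local Notation ev i := (delta_mx 0 i : 'rV[R]_n).

Definition st_coord (o : option 'I_n) : {linear ST -> R} :=
  if o is Some a then (@rV_coord R n a \o snd : {linear ST -> R}) else (fst : {linear ST -> R}).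
Definition st_basis (o : option 'I_n) : ST :=
  if o is Some a then (0, ev a) else (1, 0).

Lemma snd_continuous : continuous (snd : ST -> 'rV[R]_n).
Proof. by move=> z; exact: cvg_snd. Qed.

Lemma fst_continuous : continuous (fst : ST -> R).
Proof. by move=> z; exact: cvg_fst. Qed.

Lemma coordinates_st : coordinates st_basis (fun o => st_coord o).
Proof.
split=> [[a|] z|[s x]].
- apply: (@continuous_comp _ _ _ snd (@rV_coord R n a)); first exact: snd_continuous.
  exact: rV_coord_continuous.
- exact: fst_continuous.
have E (I : finType) (F : I -> ST) : \sum_i F i = (\sum_i (F i).1, \sum_i (F i).2).
  have h : (\sum_i F i).1 = \sum_i (F i).1 /\ (\sum_i F i).2 = \sum_i (F i).2.
    by split; apply: (big_morph _ (id1 := 0)).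
  by case: (\sum_i F i) h => a b /= [-> ->].
have bo (V : zmodType) (F : option 'I_n -> V) : \sum_o F o = F None + \sum_a F (Some a).
  rewrite (bigD1 None)//=; congr (_ + _).
  rewrite (reindex_omap Some id)/=; last by case.
  by apply: eq_bigl => a; rewrite /= eqxx.
rewrite E !bo/=; congr (_, _).
  by rewrite big1 ?addr0 ?[RHS]mulr1// => a _; rewrite /= scaler0.
rewrite scaler0 add0r; exact: ((@coordinates_rV R n).2 x).
Qed.

Lemma smooth_slice (O : set ST) (F : ST -> R) (s : R) (B : set 'rV[R]_n) :
  open B -> (forall x, B x -> O (s, x)) -> smooth_on O F -> smooth_on B (fun x => F (s, x)).
Proof.
move=> oB BO sF; apply: (smooth_on_comp (T := fun x => (s, x)) coordinates_st oB BO _ sF).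
case=> [a|] /=; last exact: smooth_on_cst.
apply/smooth_onP => k.
exact: (@smooth_upto_lin R k _ _ B (@rV_coord R n a) (@rV_coord_continuous R n a)).
Qed.

Lemma smooth_snd (O : set ST) (B : set 'rV[R]_n) (F : 'rV[R]_n -> R) :
  open O -> (forall z, O z -> B z.2) -> smooth_on B F -> smooth_on O (fun z => F z.2).
Proof.
move=> oO OB /smooth_onP sF; apply/smooth_onP => k.
exact: (@smooth_upto_linr R k _ _ _ O B F snd oO snd_continuous OB (sF k)).
Qed.

Lemma smooth_fst (O : set ST) : smooth_on O (fun z : ST => z.1).
Proof.
apply/smooth_onP => k.
exact: (@smooth_upto_lin R k _ _ O (fst : {linear ST -> R}) fst_continuous).
Qed.

Lemma slice_st (s : R) (x : 'rV[R]_n) (i : 'I_n) (t : R) :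
  (s, t *: ev i + x) = t *: ((0, ev i) : ST) + (s, x).
Proof. by congr pair; rewrite /= scaler0 add0r. Qed.

Lemma slice_st_continuous (s : R) : continuous (fun x : 'rV[R]_n => (s, x)).
Proof. by move=> x; exact: (cvg_pair (F := nbhs x) (cvg_cst s) cvg_id). Qed.

Lemma is_derive_time (F : ST -> R) (s : R) (x : 'rV[R]_n) : differentiable F (s, x) ->
  is_derive s 1 (fun t => F (t, x)) ('D_((1, 0) : ST) F (s, x)).
Proof.
have E t : (t, x) = t *: ((1, 0) : ST) + (0, x).
  by congr pair; rewrite /= ?scaler0 ?add0r// addr0 [RHS]mulr1.
rewrite E => /is_derive_line.
by rewrite (_ : (fun t => F (t, x)) = (fun t => F (t *: ((1, 0) : ST) + (0, x))))//; apply/funext => t; rewrite E.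
Qed.
End SpaceTime.

Section Families.
Variables (R : realType) (n : nat) (M : ptopologicalType).
Variable A : smooth_atlas R n M.
Local Notation U c := (chart_map c @` chart_dom c).
Local Notation ST := (R * 'rV[R]_n)%type.
Local Notation ev i := (delta_mx 0 i : 'rV[R]_n).
Variables (g h : tensor2 A) (eps : R).
Hypothesis eps0 : 0 < eps.
Hypothesis rgs : forall s : R, `|s| < eps -> riemannian_metric (perturb g h s).
Hypothesis sh : smooth_sym_tensor h.
Local Notation gs := (perturb g h).
Implicit Types (c d : chart A) (p : M) (x : 'rV[R]_n) (z : ST) (u v : M -> R)
  (F : R -> M -> R).

Definition st_set c : set ST := [set z | `|z.1| < eps /\ (U c) z.2].

Lemma st_set_open c : open (st_set c).
Proof.
apply: openI.
  have := @fst_continuous R n; move/continuousP => /(_ (ball (0 : R) eps)).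
  rewrite (_ : _ @^-1` _ = [set z : ST | `|z.1| < eps]).
    by apply; exact: ball_open.
  by apply/seteqP; split=> z; rewrite /ball/= sub0r normrN.
have := @snd_continuous R n; move/continuousP => /(_ (U c)); apply.
exact: chart_image_open.
Qed.

Definition st_domain c := OpenDomain (@st_set_open c).
Local Notation Om c := (open_domain_set (st_domain c)).
Local Notation S c := (sfun (st_domain c)).

Definition dx c : 'I_n -> {additive S c -> S c} :=
  partials (st_domain c) (fun i => ((0, ev i) : ST)).
Definition dt c : {additive S c -> S c} := sder ((1, 0) : ST).

Lemma dxE c i (a : S c) z : Om c z -> dx c i a z = 'D_((0, ev i) : ST) a z.
Proof. exact: partialsE. Qed.
Lemma dtE c (a : S c) z : Om c z -> dt c a z = 'D_((1, 0) : ST) a z.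
Proof. exact: sderE. Qed.
Lemma dx_derivation c i : derivation (dx c i). Proof. exact: partials_derivation. Qed.
Lemma dt_derivation c : derivation (dt c). Proof. exact: sderM. Qed.
Lemma dxC c i j a : dx c i (dx c j a) = dx c j (dx c i a). Proof. exact: partialsC. Qed.
Lemma dtC c i a : dt c (dx c i a) = dx c i (dt c a). Proof. exact: sderC. Qed.

(** Families of functions are handled through representing ring elements: sums, products and
    contractions of families become ring operations, and [dt] computes their derivative in s. *)
Definition repr c F (a : S c) := forall z, Om c z -> F z.1 (chart_inv c z.2) = a z.
Definition smooth_ffam F := forall c, exists a : S c, repr F a.
Definition repr_tensor c (X : R -> tensor2 A) (Xc : 'M[S c]_n) :=
  forall z, Om c z -> X z.1 c (chart_inv c z.2) = evmx z Xc.

Lemma st_dom c z : Om c z -> chart_dom c (chart_inv c z.2).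
Proof. by case=> _; exact: chart_inv_dom. Qed.

Lemma smooth_ffamP F :
  (forall c, smooth_on (Om c) (fun z => F z.1 (chart_inv c z.2))) -> smooth_ffam F.
Proof.
move=> sF c; exists (to_sfun (st_domain c) (fun z => F z.1 (chart_inv c z.2))) => z Oz.
by rewrite to_sfunE//; exact: sF.
Qed.

Lemma smooth_ffam_static u : smooth_fun A u -> smooth_ffam (fun=> u).
Proof.
move=> su; apply: smooth_ffamP => c.
apply: (@smooth_snd R n (st_set c) (U c) (fun x => u (chart_inv c x))); [exact: st_set_open|by move=> z []|exact: su].
Qed.

Lemma smooth_ffam_fun F s : smooth_ffam F -> `|s| < eps -> smooth_fun A (F s).
Proof.
move=> sF se c; have [a ra] := sF c.
apply: (@eq_smooth_on R _ _ _ (fun x => a (s, x))); first exact: chart_image_open.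
  by move=> x Ux; rewrite /= -(ra (s, x)).
apply: (@smooth_slice R n (st_set c)); first exact: chart_image_open.
  by move=> x Ux; split.
exact: (sfun_smooth a).
Qed.

Definition Gc c : 'M[S c]_n :=
  \matrix_(i, j) to_sfun (st_domain c) (fun z => gs z.1 c (chart_inv c z.2) i j).
Definition Hc c : 'M[S c]_n :=
  \matrix_(i, j) to_sfun (st_domain c) (fun z => h c (chart_inv c z.2) i j).

Lemma norm0_lt : `|0 : R| < eps. Proof. by rewrite normr0. Qed.

Lemma perturb0 : gs 0 = g.
Proof. by apply/funext => c; apply/funext => p; rewrite /perturb scale0r addr0. Qed.

Lemma Hc_repr c : repr_tensor (fun=> h) (Hc c).
Proof.
move=> z Oz; apply/matrixP => i j; rewrite !mxE to_sfunE//.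
case: sh => _ s _.
apply: (@smooth_snd R n (st_set c) (U c) (fun x => h c (chart_inv c x) i j)); [exact: st_set_open|by move=> y []|exact: s].
Qed.

Lemma Gc_repr c : repr_tensor gs (Gc c).
Proof.
move=> z Oz; apply/matrixP => i j; rewrite evmxE [Gc c i j]mxE to_sfunE//.
have sg : smooth_on (st_set c) (fun z => g c (chart_inv c z.2) i j).
  have := rgs norm0_lt; rewrite perturb0 => -[[_ s _] _].
  apply: (@smooth_snd R n (st_set c) (U c) (fun x => g c (chart_inv c x) i j)); [exact: st_set_open|by move=> y []|exact: s].
apply: (@eq_smooth_on R _ _ _ (fun z => g c (chart_inv c z.2) i j + z.1 * h c (chart_inv c z.2) i j)).
- exact: st_set_open.
- by move=> y _; rewrite /perturb !mxE.
apply: smooth_onD => //; first exact: st_set_open.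
apply: smooth_onM; [exact: st_set_open|exact: smooth_fst|].
case: sh => _ s _.
apply: (@smooth_snd R n (st_set c) (U c) (fun x => h c (chart_inv c x) i j)); [exact: st_set_open|by move=> y []|exact: s].
Qed.

Lemma Gc_sym c : (Gc c)^T = Gc c.
Proof.
apply/matrixP => i j; rewrite [LHS]mxE; apply: sfun_eq => z Oz.
rewrite -!evmxE -(Gc_repr Oz).
have /matrixP E := metric_sym (rgs Oz.1) (st_dom Oz).
by have := E i j; rewrite [_^T i j]mxE.
Qed.

Lemma Gc_det c z : Om c z -> 0 < (\det (Gc c) : S c) z.
Proof.
move=> Oz; rewrite sfun_det// (_ : map_mx _ _ = evmx z (Gc c)); last by apply/matrixP => i j; rewrite !mxE.
by rewrite -(Gc_repr Oz); exact: (metric_det_gt0 (rgs Oz.1) (st_dom Oz)).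
Qed.

Definition Pc c := sfun_invmx (Gc c).
Lemma PcV c : Pc c *m Gc c = 1%:M.
Proof. by apply: sfun_mulVmx => z Oz; rewrite gt_eqF// Gc_det. Qed.

Lemma Pc_inv c z : Om c z -> evmx z (Pc c) = invmx (gs z.1 c (chart_inv c z.2)).
Proof. by move=> Oz; rewrite (evmx_inv (PcV c) Oz) -(Gc_repr Oz). Qed.

Definition wc c : S c := to_sfun (st_domain c) (fun z => Num.sqrt ((\det (Gc c) : S c) z)).

Lemma wcE c z : Om c z -> wc c z = density (gs z.1) c z.2.
Proof.
move=> Oz; rewrite to_sfunE//; last first.
  apply: (smooth_on_comp_real (@st_set_open c) _ (sfun_smooth (\det (Gc c))) (@smooth_sqrt R)).
  by move=> y Oy; exact: Gc_det.
rewrite sfun_det// (_ : map_mx _ _ = evmx z (Gc c)); last by apply/matrixP => i j; rewrite !mxE.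
by rewrite -(Gc_repr Oz).
Qed.

Lemma wc_gt0 c z : Om c z -> 0 < wc c z.
Proof.
move=> Oz; rewrite wcE// /density sqrtr_gt0.
exact: (metric_det_gt0 (rgs Oz.1) (st_dom Oz)).
Qed.

Lemma wcM c : wc c * wc c = \det (Gc c).
Proof.
apply: sfun_eq => z Oz; rewrite sfunM to_sfunE//.
  by rewrite -expr2 sqr_sqrtr// ltW// Gc_det.
apply: (smooth_on_comp_real (@st_set_open c) _ (sfun_smooth (\det (Gc c))) (@smooth_sqrt R)).
by move=> y Oy; exact: Gc_det.
Qed.

Definition wic c : S c := to_sfun (st_domain c) (fun z => (wc c z)^-1).
Lemma wcV c : wc c * wic c = 1.
Proof. by apply: to_sfunV => z Oz; rewrite gt_eqF// wc_gt0. Qed.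

Local Notation half c := (sconst (st_domain c) 2^-1).
Local Notation Gam c := (gam (dx c) (half c) (Gc c) (Pc c)).

Definition at_time (s : R) : 'rV[R]_n -> ST := fun x => (s, x).

Let gmE c (s : R) x : Om c (at_time s x) -> local_metric (gs s) c x = evmx (at_time s x) (Gc c).
Proof. by move=> Oz; rewrite -(Gc_repr Oz). Qed.

Lemma ricci_repr c : repr_tensor (fun s => ricci_tensor (gs s)) (ric (dx c) (Gam c)).
Proof.
case=> s x Oz; have Oz' : Om c (at_time s x) by [].
apply/matrixP => i j; rewrite evmxE mxE chart_invK; last by case: Oz.
exact: (ricci_sfun (slice_st s) (@slice_st_continuous R n s) (Gc_sym c) (PcV c) (@gmE c s) i j Oz').
Qed.

Lemma hessian_repr c F (a : S c) : repr F a ->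
  repr_tensor (fun s => hessian_tensor (gs s) (F s)) (hess (dx c) (Gam c) a).
Proof.
move=> ra [s x] Oz; have Oz' : Om c (at_time s x) by [].
apply/matrixP => i j; rewrite evmxE mxE chart_invK; last by case: Oz.
apply: (hessian_sfun (slice_st s) (@slice_st_continuous R n s) (PcV c) (@gmE c s) i j _ Oz').
by move=> y Oy; rewrite /= -(ra (s, y)).
Qed.

Lemma pderiv_repr c F (a : S c) i z : repr F a -> Om c z ->
  pderiv i (F z.1 \o chart_inv c) z.2 = dx c i a z.
Proof.
case: z => s x ra Oz.
apply: (pderiv_sfun (slice_st s) (@slice_st_continuous R n s) i _ Oz).
by move=> y Oy; rewrite /= -(ra (s, y)).
Qed.

Lemma dyad_repr c F1 F2 (a b : S c) : repr F1 a -> repr F2 b ->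
  repr_tensor (fun s => (gradient_dyad (F1 s) (F2 s) : tensor2 A)) (dif (dx c) a *m (dif (dx c) b)^T).
Proof.
move=> ra rb z Oz; apply/matrixP => i j; rewrite evmxE !mxE big_ord_recl big_ord0 addr0 !mxE sfunM.
by rewrite chart_invK ?(pderiv_repr _ ra Oz) ?(pderiv_repr _ rb Oz)//; case: Oz.
Qed.

Definition law_fam (X : R -> tensor2 A) := forall s, `|s| < eps -> tensor_law (X s).

Lemma contraction_repr c (X Y : R -> tensor2 A) (Xc Yc : 'M[S c]_n) :
  law_fam X -> law_fam Y -> repr_tensor X Xc -> repr_tensor Y Yc ->
  repr (fun s => contraction (gs s) (X s) (Y s)) (pairing (Pc c) Xc Yc).
Proof.
move=> lX lY rX rY z Oz; have [se _] := Oz.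
rewrite (contractionE (rgs se) (lX _ se) (lY _ se) (st_dom Oz)).
by rewrite ev_pairing Pc_inv// -rX// -rY.
Qed.

Definition dot F p : R := 'D_1 (fun s => F s p) 0.

Lemma near_time c x : (U c) x -> \forall s \near (0 : R), Om c (s, x).
Proof.
move=> Ux; have : nbhs (0 : R) (ball (0 : R) eps) by exact: nbhsx_ballx.
by apply: filterS => s; rewrite /ball/= sub0r normrN => hs; split.
Qed.

Lemma dot_repr c F (a : S c) x : repr F a -> (U c) x ->
  dot F (chart_inv c x) = dt c a (0, x).
Proof.
move=> ra Ux; have Oz : Om c (0, x) by split; [exact: norm0_lt|].
rewrite dtE// /dot (near_eq_derive (g := fun s => a (s, x))).
  by have [_ ->] := is_derive_time (sfun_differentiable a Oz).
by apply: filterS (near_time Ux) => s Os; rewrite -(ra (s, x)).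
Qed.
End Families.

(** * Differentiating integrals along the family *)

Section QuadraticRemainder.
Variable R : realType.
Implicit Types (u f : R -> R) (s t r B : R).

Lemma lipschitz_at0 u u' r B : (forall t, `|t| <= r -> is_derive t 1 u (u' t)) ->
  (forall t, `|t| <= r -> `|u' t| <= B) ->
  forall s, `|s| <= r -> `|u s - u 0| <= B * `|s|.
Proof.
move=> du Bu.
have key a b : a <= b -> `|a| <= r -> `|b| <= r -> `|u b - u a| <= B * `|b - a|.
  move=> ab ar br.
  have ir t : a <= t -> t <= b -> `|t| <= r.
    move=> at_ tb; move: ar br; rewrite !ler_norml => /andP[a1 _] /andP[_ b2].
    by rewrite (le_trans a1 at_) (le_trans tb b2).
  have dab t : t \in `]a, b[ -> is_derive t 1 u (u' t).
    by rewrite in_itv/= => /andP[at_ tb]; apply: du; apply: ir; exact: ltW.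
  have cab : {within `[a, b], continuous u}.
    apply: derivable_within_continuous => t; rewrite in_itv/= => /andP[at_ tb].
    by have [] := du t (ir t at_ tb).
  have [z] := MVT_segment ab dab cab; rewrite in_itv/= => /andP[az zb] ->.
  by rewrite normrM ler_wpM2r// Bu// ir.
move=> s sr; have r0 : `|0 : R| <= r by rewrite normr0 (le_trans _ sr).
have [s0|/ltW s0] := leP 0 s; first by have := key _ _ s0 r0 sr; rewrite subr0.
by have := key _ _ s0 sr r0; rewrite sub0r normrN distrC.
Qed.

Lemma taylor_at0 f f1 f2 r B : (forall t, `|t| <= r -> is_derive t 1 f (f1 t)) ->
  (forall t, `|t| <= r -> is_derive t 1 f1 (f2 t)) ->
  (forall t, `|t| <= r -> `|f2 t| <= B) ->
  forall s, `|s| <= r -> `|f s - f 0 - s * f1 0| <= B * s ^+ 2.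
Proof.
move=> d1 d2 B2 s sr.
have B0 : 0 <= B by apply: le_trans (B2 s sr).
have h1 := lipschitz_at0 d2 B2.
pose u t := f t - t * f1 0.
have du t : `|t| <= `|s| -> is_derive t 1 u (f1 t - f1 0).
  move=> ts; have df := d1 t (le_trans ts sr).
  have dl : is_derive t 1 (fun t => t * f1 0) (f1 0).
    have -> : (fun t => t * f1 0) = (f1 0) *: (id : R -> R).
      by apply/funext => y; rewrite /= mulrC.
    by apply: is_derive_eq; rewrite [LHS]mulr1.
  exact: is_deriveB.
have Bu t : `|t| <= `|s| -> `|f1 t - f1 0| <= B * `|s|.
  move=> ts; apply: le_trans (h1 t (le_trans ts sr)) _.
  by rewrite ler_wpM2l.
have := lipschitz_at0 du Bu (lexx `|s|); rewrite /u mul0r subr0.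
rewrite -mulrA -expr2 real_normK ?num_real//.
by have -> : f s - s * f1 0 - f 0 = f s - f 0 - s * f1 0 by ring.
Qed.

(** A quadratic remainder that is uniform on a compact support survives integration, which gives
    differentiation under the integral sign without a convergence theorem. *)
Lemma is_derive_quadratic (I : R -> R) (D C r : R) : 0 < r ->
  (forall s, `|s| <= r -> `|I s - I 0 - s * D| <= C * s ^+ 2) -> is_derive (0 : R) 1 I D.
Proof.
move=> r0 h.
have cv : (fun t : R => t^-1 *: (I (t *: 1 + 0) - I 0)) @ 0^' --> D.
  apply/cvgrPdist_le => e e0; pose dl := Num.min r (e / (`|C| + 1)).
  have dl0 : 0 < dl by rewrite lt_min r0 divr_gt0// ltr_wpDl.
  exists dl => //= t; rewrite /ball/= sub0r normrN => tdl t0.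
  move: tdl; rewrite lt_min => /andP[tr te].
  rewrite addr0 [t *: 1]mulr1 [_ *: _]/( _ * _).
  have -> : D - t^-1 * (I t - I 0) = - (t^-1 * (I t - I 0 - t * D)) by field.
  rewrite normrN normrM normfV ler_pdivrMl ?normr_gt0//.
  apply: le_trans (h t (ltW tr)) _; apply: (@le_trans _ _ (`|C| * t ^+ 2)).
    by rewrite ler_wpM2r ?sqr_ge0// ler_norm.
  rewrite -(ger0_norm (sqr_ge0 t)) normrX expr2 mulrCA ler_wpM2l//.
  move: te; rewrite ltr_pdivlMr ?ltr_wpDl// => te.
  apply: le_trans (ltW te); rewrite mulrC ler_wpM2l//; lra.
apply: DeriveDef; first by apply/cvg_ex; exists D.
exact: cvg_lim.
Qed.
End QuadraticRemainder.

Lemma is_derive_affine (R : realType) (a b s : R) : is_derive s 1 (fun t => a + t * b) b.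
Proof.
have dl : is_derive s 1 (b *: (id : R -> R)) b by apply: is_derive_eq; rewrite [LHS]mulr1.
have dc : is_derive s 1 (cst a : R -> R) 0 by exact: is_derive_cst.
have -> : (fun t => a + t * b) = cst a + b *: (id : R -> R).
  by apply/funext => t; rewrite fctE/= mulrC.
have := is_deriveD dc dl.
by have -> : (0 : R) + b = b by rewrite add0r.
Qed.

Section TimeDerivative.
Variables (R : realType) (n : nat) (M : ptopologicalType).
Variable A : smooth_atlas R n M.
Local Notation U c := (chart_map c @` chart_dom c).
Local Notation ST := (R * 'rV[R]_n)%type.
Variables (g h : tensor2 A) (eps : R).
Hypothesis eps0 : 0 < eps.
Hypothesis rgs : forall s : R, `|s| < eps -> riemannian_metric (perturb g h s).
Hypothesis sh : smooth_sym_tensor h.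
Local Notation gs := (perturb g h).
Local Notation Om c := (open_domain_set (st_domain eps c)).
Local Notation S c := (sfun (st_domain eps c)).
Local Notation half c := (sconst (st_domain eps c) 2^-1).
Local Notation G c := (Gc g h eps c).
Local Notation P c := (Pc g h eps c).
Local Notation w c := (wc g h eps c).
Implicit Types (c d : chart A) (p q : M) (x : 'rV[R]_n) (z : ST) (u v : M -> R)
  (F : R -> M -> R).

Lemma dt_metric c : map_mx (dt eps c) (G c) = Hc h eps c.
Proof.
apply/matrixP => i j; apply: sfun_eq => -[s x] Oz.
have -> : map_mx (dt eps c) (G c) i j = dt eps c (G c i j) by rewrite mxE.
rewrite dtE//; have [_ <-] := is_derive_time (sfun_differentiable (G c i j) Oz).
have Ux : U c x by case: Oz.
rewrite -evmxE -(Hc_repr sh Oz)/=.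
have GE t : `|t| < eps -> G c i j (t, x) = g c (chart_inv c x) i j + t * h c (chart_inv c x) i j.
  move=> te; have Ot : Om c (t, x) by [].
  by rewrite -evmxE -(Gc_repr eps0 rgs sh Ot) /perturb !mxE.
have ns : \forall t \near s, `|t| < eps.
  have [se _] := Oz.
  have : nbhs (s : R) (ball (0 : R) eps).
    by apply: open_nbhs_nbhs; split; [exact: ball_open|rewrite /ball/= sub0r normrN].
  by apply: filterS => t; rewrite /ball/= sub0r normrN.
rewrite (near_eq_derive (g := fun t : R => g c (chart_inv c x) i j + t * h c (chart_inv c x) i j)); last first.
  by apply: filterS ns => t /GE.
by have [_ ->] := is_derive_affine (g c (chart_inv c x) i j) (h c (chart_inv c x) i j) s.
Qed.

Lemma contraction_h_repr c X (Xc : 'M[S c]_n) : law_fam eps X -> repr_tensor X Xc ->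
  repr (fun s => contraction (gs s) h (X s)) (pairing (P c) (Hc h eps c) Xc).
Proof.
move=> lX rX; apply: (contraction_repr eps0 rgs sh (X := fun=> h)) => //.
  by move=> s se; case: sh => _ _ lh ? ? ? ? ?; exact: lh.
exact: Hc_repr.
Qed.

Lemma law_metric : law_fam eps gs.
Proof. by move=> s se; exact: metric_law (rgs se). Qed.

(** Half the trace of [h]: the logarithmic derivative at s = 0 of the volume density of g + s h. *)
Definition volume_rate p := 2^-1 * contraction (gs 0) h (gs 0) p.

Lemma dt_density c x : U c x ->
  dt eps c (w c) (0, x) = volume_rate (chart_inv c x) * w c (0, x).
Proof.
move=> Ux; have Oz : Om c (0, x) by split=> //=; exact: norm0_lt.
rewrite (var_density (sconst_half _) (Gc_sym eps0 rgs sh c) (PcV eps0 rgs sh c)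
  (wcM eps0 rgs sh c) (wcV eps0 rgs sh c) (@dt_derivation R n M A eps c)) dt_metric.
rewrite !sfunM sconstE// /volume_rate.
by rewrite (contraction_h_repr law_metric (@Gc_repr _ _ _ _ _ _ _ eps0 rgs sh c) Oz).
Qed.

Lemma dot_out F K : closed K -> (forall s p, ~ K p -> F s p = 0) ->
  forall p, ~ K p -> dot F p = 0.
Proof.
move=> cK F0 p nK; rewrite /dot (_ : (fun s => F s p) = cst 0) ?derive_cst//.
by apply/funext => s; rewrite F0.
Qed.

Variable mus : R -> {measure set (borel M) -> \bar R}.
Hypothesis rmus : forall s, `|s| < eps -> riemannian_measure (gs s) (mus s).
Hypotheses (hM : hausdorff_space M) (cM : compact [set: M]).

Lemma dot_smooth F : smooth_ffam A eps F -> smooth_fun A (dot F).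
Proof.
move=> sF c; have [a ra] := sF c.
apply: (@eq_smooth_on R _ _ _ (fun x => dt eps c a (0, x))); first exact: chart_image_open.
  by move=> x Ux; rewrite /= (dot_repr eps0 ra).
apply: (@smooth_slice R n (Om c)); first exact: chart_image_open.
  by move=> x Ux; split=> //=; exact: norm0_lt.
exact: (sfun_smooth (dt eps c a)).
Qed.

(** In the chart the integrand is the ring element a w, and Taylor's formula in s applies at each
    point, with second derivative bounded on a compact set. The support [K] does not move with s, so
    the remainder can be integrated. *)
Lemma local_integral_derive c (K : set M) F : compact K -> K `<=` chart_dom c ->
  smooth_ffam A eps F -> (forall s p, ~ K p -> F s p = 0) ->
  is_derive (0 : R) 1 (fun s => \int[mus s]_p F s p)
    (\int[mus 0]_p (dot F p + F 0 p * volume_rate p)).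
Proof.
move=> cK Kd sF F0; have [a ra] := sF c.
pose b : S c := a * w c.
have n0 := norm0_lt eps0.
have oU := @chart_image_open R n M A c.
have clK : closed K by exact: compact_closed.
have cF s : `|s| < eps -> continuous (F s).
  by move=> se; apply: smooth_fun_continuous (smooth_ffam_fun sF se).
have bE s x : `|s| < eps -> U c x -> b (s, x) = F s (chart_inv c x) * density (gs s) c x.
  move=> se Ux; have Oz : Om c (s, x) by [].
  by rewrite sfunM -(ra _ Oz) (wcE eps0 rgs sh Oz).
have b0 s x : `|s| < eps -> U c x -> ~ K (chart_inv c x) -> b (s, x) = 0.
  by move=> se Ux nK; rewrite bE// F0// mul0r.
have IE s : `|s| < eps -> \int[mus s]_p F s p = integral_rV (extend0 c (fun x => b (s, x))).
  move=> se; rewrite /Rintegral (chart_integral (rmus se) cK Kd (cF s se))/=; last by move=> p nK; rewrite F0.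
  congr integral_rV; apply/funext => x; rewrite /extend0; case: ifPn => //; rewrite inE => Ux.
  exact/esym/bE.
pose b1 := dt eps c b; pose b2 := dt eps c b1.
have b1E x : U c x -> b1 (0, x) =
    (dot F (chart_inv c x) + F 0 (chart_inv c x) * volume_rate (chart_inv c x)) * density (gs 0) c x.
  move=> Ux; have Oz : Om c (0, x) by [].
  rewrite /b1 (@dt_derivation R n M A eps c) sfunD !sfunM (dt_density Ux) -(dot_repr eps0 ra Ux).
  by rewrite -(ra _ Oz) -(wcE eps0 rgs sh Oz)/=; ring.
have dF0 p : ~ K p -> dot F p + F 0 p * volume_rate p = 0.
  by move=> nK; rewrite (dot_out clK F0 nK) F0// mul0r addr0.
have b10 x : U c x -> ~ K (chart_inv c x) -> b1 (0, x) = 0.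
  by move=> Ux nK; rewrite b1E// dF0// mul0r.
have sT : smooth_fun A volume_rate.
  have sff : smooth_ffam A eps (fun s => contraction (gs s) h (gs s)).
    by move=> d; exists (pairing (P d) (Hc h eps d) (G d)); apply: contraction_h_repr law_metric _; exact: Gc_repr.
  by apply: smooth_funM; [exact: smooth_fun_cst|exact: (smooth_ffam_fun sff n0)].
have scI : continuous (fun p => dot F p + F 0 p * volume_rate p).
  apply: smooth_fun_continuous; apply: smooth_funD; first exact: dot_smooth.
  by apply: smooth_funM sT; exact: smooth_ffam_fun sF n0.
have DE : \int[mus 0]_p (dot F p + F 0 p * volume_rate p) = integral_rV (extend0 c (fun x => b1 (0, x))).
  rewrite /Rintegral (chart_integral (rmus n0) cK Kd scI dF0)/=.
  congr integral_rV; apply/funext => x; rewrite /extend0; case: ifPn => //; rewrite inE => Ux.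
  exact/esym/b1E.
rewrite DE.
(* A closed time interval inside the open one, so that its product with the image of [K] is a
   compact part of the space-time domain. *)
pose r := eps / 2.
have r0 : 0 < r by rewrite divr_gt0.
have re (s : R) : `|s| <= r -> `|s| < eps by move=> h1; apply: le_lt_trans h1 _; rewrite /r ltr_pdivrMr// ltr_pMr// ltr1n.
have cK' := chart_image_compact cK Kd.
have KU x : (chart_map c @` K) x -> U c x by case=> p Kp <-; exact: chart_image (Kd _ Kp).
have [B Bb] : exists B, forall s x, `|s| <= r -> (chart_map c @` K) x -> `|b2 (s, x)| <= B.
  have cSK : compact (`[- r, r]%classic `*` (chart_map c @` K)).
    by apply: compact_setX => //; exact: segment_compact.
  have : compact (b2 @` (`[- r, r]%classic `*` (chart_map c @` K))).
    apply: continuous_compact => //; apply: (@continuous_subspaceW _ _ _ (Om c)).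
      move=> [s x] [/= sr xK]; split; last exact: KU.
      by apply: re; rewrite ler_norml; move: sr; rewrite in_itv.
    rewrite continuous_open_subspace; last exact: st_set_open.
    move=> z; rewrite inE => Oz; apply: differentiable_continuous.
    exact: sfun_differentiable.
  move/compact_bounded => -[B [_ BP]]; exists (B + 1) => s x sr xK.
  have B1 : B < B + 1 by rewrite ltrDl.
  apply: (BP _ B1); exists (s, x) => //; split=> //=.
  by rewrite in_itv/= -ler_norml.
have cslice (a' : S c) s : `|s| < eps -> forall x, U c x -> {for x, continuous (fun x => a' (s, x))}.
  move=> se x Ux; apply: differentiable_continuous.
  have := @smooth_slice R n (Om c) a' s (U c) oU _ (sfun_smooth a'); move/(_ _ [::] x); apply => //.
(* One radius for all times, as required by the linearity of the iterated integral; it exists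
   because all supports lie in the image of the same [K]. *)
have [rr rr0 srr] : exists2 rr : R, 0 < rr & (forall s, `|s| < eps ->
   supported rr (extend0 c (fun x => b (s, x)))) /\ supported rr (extend0 c (fun x => b1 (0, x))).
  have [r1 r10 [_ s1]] := extend0_supported cK Kd b10 (cslice b1 0 n0).
  have /compact_bounded[B1 [_ BP]] := cK'.
  pose rr := `|B1| + 1.
  have rr0 : 0 < rr by rewrite /rr ltr_wpDl.
  have out x i : rr < `|x 0 i| -> ~ (chart_map c @` K) x.
    move=> rx Kx; have B1r : B1 < rr by rewrite /rr (le_lt_trans (ler_norm B1))// ltrDl.
    have := BP rr B1r x Kx; rewrite /= => xr.
    have : `|x 0 i| <= `|x|.
      by rewrite [in leRHS]/Num.norm/= mx_normrE; apply: (le_trans _ (le_bigmax _ _ (0, i))).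
    by move/le_trans => /(_ _ xr); rewrite leNgt rx.
  exists rr => //; split.
    move=> s se; split; first exact: (extend0_continuous cK Kd (fun x => b0 s x se) (cslice b s se)).
    move=> x i /out nK; exact: nbhs_singleton (near_extend0_out cK Kd (fun x => b0 s x se) nK).
  split; first exact: (extend0_continuous cK Kd b10 (cslice b1 0 n0)).
  move=> x i /out nK; exact: nbhs_singleton (near_extend0_out cK Kd b10 nK).
have [sb sb1] := srr.
have [bd lin] := @integral_rV_specP R n rr rr0.
apply: (is_derive_quadratic (C := (2 * rr) ^+ n * `|B|) r0) => s sr.
have se := re s sr.
rewrite (IE s se) (IE 0 n0).
set F1 := extend0 c (fun x => b (s, x)); set F2 := extend0 c (fun x => b (0, x)).
set F3 := extend0 c (fun x => b1 (0, x)).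
have s1 : supported rr F1 by exact: sb (re _ sr).
have s2 : supported rr F2 by exact: sb n0.
have s23 := supported_comb s sb1 s2.
have s123 := supported_comb (-1) s23 s1.
have -> : integral_rV F1 - integral_rV F2 - s * integral_rV F3 =
    integral_rV (fun x => -1 * (s * F3 x + F2 x) + F1 x).
  by rewrite (lin _ _ _ s23 s1) (lin _ _ _ sb1 s2); ring.
rewrite -mulrA; apply: bd => // x.
have B0 : 0 <= `|B| * s ^+ 2 by rewrite mulr_ge0// sqr_ge0.
have [Kx|nKx] := pselect ((chart_map c @` K) x); last first.
  have e1 := nbhs_singleton (near_extend0_out cK Kd (fun x => b0 s x (re _ sr)) nKx).
  have e2 := nbhs_singleton (near_extend0_out cK Kd (fun x => b0 0 x n0) nKx).
  have e3 := nbhs_singleton (near_extend0_out cK Kd b10 nKx).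
  by rewrite /F1 /F2 /F3 e1 e2 e3 !(mulr0, addr0) normr0.
have Ux := KU _ Kx; rewrite /F1 /F2 /F3 !extend0_in//.
have dd (a' : S c) (t : R) : `|t| <= r -> is_derive t 1 (fun t => a' (t, x)) (dt eps c a' (t, x)).
  move=> tr; have Ot : Om c (t, x) by split=> //=; exact: re.
  by rewrite dtE//; apply: is_derive_time; exact: sfun_differentiable.
have := taylor_at0 (dd b) (dd b1) (B := `|B|) _ sr.
have -> : -1 * (s * b1 (0, x) + b (0, x)) + b (s, x) = b (s, x) - b (0, x) - s * b1 (0, x) by ring.
apply=> t tr; apply: le_trans (Bb t x tr Kx) _; exact: ler_norm.
Qed.
End TimeDerivative.

(** * Integral identities *)

Section RingIdentities.
Variables (A : comPzRingType) (n : nat) (d : 'I_n -> {additive A -> A}).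
Hypothesis dM : forall i, derivation (d i).
Variables (G : 'I_n -> 'M[A]_n) (P : 'M[A]_n).
Implicit Types (X Y Z : 'M[A]_n) (a b c : A).

Lemma pairingDl X Y Z : pairing P (X + Y) Z = pairing P X Z + pairing P Y Z.
Proof.
rewrite /pairing; do 4 (rewrite -big_split/=; apply: eq_bigr => ? _).
by rewrite !mxE; ring.
Qed.

Lemma pairingDr X Y Z : pairing P X (Y + Z) = pairing P X Y + pairing P X Z.
Proof.
rewrite /pairing; do 4 (rewrite -big_split/=; apply: eq_bigr => ? _).
by rewrite !mxE; ring.
Qed.

Lemma pairingZl c X Y : pairing P (c *: X) Y = c * pairing P X Y.
Proof.
rewrite /pairing; do 4 (rewrite big_distrr/=; apply: eq_bigr => ? _).
by rewrite !mxE; ring.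
Qed.

Lemma pairingZr c X Y : pairing P X (c *: Y) = c * pairing P X Y.
Proof.
rewrite /pairing; do 4 (rewrite big_distrr/=; apply: eq_bigr => ? _).
by rewrite !mxE; ring.
Qed.

Lemma pairingNl X Y : pairing P (- X) Y = - pairing P X Y.
Proof. by rewrite -scaleN1r pairingZl mulN1r. Qed.

Lemma pairingNr X Y : pairing P X (- Y) = - pairing P X Y.
Proof. by rewrite -scaleN1r pairingZr mulN1r. Qed.

Definition pairing_lin := (pairingDl, pairingDr, pairingZl, pairingZr, pairingNl, pairingNr).

Lemma difD a b : dif d (a + b) = dif d a + dif d b.
Proof. by apply/matrixP => i j; rewrite !mxE raddfD. Qed.

Lemma hessD a b : hess d G (a + b) = hess d G a + hess d G b.
Proof.
apply/matrixP => i j; rewrite !mxE !raddfD/= addrACA -opprD; congr (_ - _).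
by rewrite -big_split/=; apply: eq_bigr => k _; rewrite raddfD mulrDr.
Qed.

Lemma hessM a b : hess d G (a * b) = b *: hess d G a + a *: hess d G b
  + dif d a *m (dif d b)^T + dif d b *m (dif d a)^T.
Proof.
apply/matrixP => i j; rewrite !mxE !big_ord_recl !big_ord0 !mxE !addr0 !dM raddfD/= !dM.
rewrite !mulrBr !big_distrr/=.
under eq_bigr do rewrite dM.
have -> : \sum_k G i j k * (d k a * b + a * d k b) =
   \sum_k b * (G i j k * d k a) + \sum_k a * (G i j k * d k b).
  by rewrite -big_split/=; apply: eq_bigr => k _; ring.
move: (\sum_k b * _) (\sum_k a * _) => s1 s2; ring.
Qed.

(** The weight e^-f enters the ring only through its differential equation [du]. *)
Variables (u f : A).
Hypothesis du : forall i, d i u = - (u * d i f).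

Lemma dif_weight : dif d u = - (u *: dif d f).
Proof. by apply/matrixP => i j; rewrite !mxE du. Qed.

Lemma hess_weight : hess d G u = u *: (dif d f *m (dif d f)^T - hess d G f).
Proof.
apply/matrixP => i j; rewrite !mxE big_ord_recl big_ord0 !mxE addr0 du raddfN dM du.
under eq_bigr do rewrite du.
have -> : \sum_k G i j k * - (u * d k f) = - (u * \sum_k G i j k * d k f).
  by rewrite big_distrr/= -sumrN; apply: eq_bigr => k _; ring.
move: (\sum_k _) => s1; ring.
Qed.

Lemma hess_weighted b : hess d G (b * u) =
  u *: (hess d G b - (dif d f *m (dif d b)^T + dif d b *m (dif d f)^T)
        + b *: (dif d f *m (dif d f)^T - hess d G f)).
Proof.
rewrite hessM hess_weight dif_weight; apply/matrixP => i j.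
by rewrite !mxE !big_ord_recl !big_ord0 !mxE; ring.
Qed.

End RingIdentities.

Section DivergenceTheorem.
Variables (R : realType) (n : nat) (M : ptopologicalType).
Variable A : smooth_atlas R n M.
Local Notation U c := (chart_map c @` chart_dom c).
Variables (g h : tensor2 A) (eps : R).
Hypothesis eps0 : 0 < eps.
Hypothesis rgs : forall s : R, `|s| < eps -> riemannian_metric (perturb g h s).
Hypothesis sh : smooth_sym_tensor h.
Hypotheses (hM : hausdorff_space M) (cM : compact [set: M]).
Local Notation gs := (perturb g h).
Local Notation Om c := (open_domain_set (st_domain eps c)).
Local Notation S c := (sfun (st_domain eps c)).
Local Notation w c := (wc g h eps c).
Variable mu : {measure set (borel M) -> \bar R}.
Hypothesis rmu : riemannian_measure g mu.
Implicit Types (c : chart A) (p q : M) (x : 'rV[R]_n) (z : R * 'rV[R]_n) (psi : M -> R).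

Lemma metric0 : riemannian_metric g.
Proof. by rewrite -(perturb0 g h); apply: rgs; exact: norm0_lt. Qed.

Lemma st0 c x : U c x -> Om c (0, x).
Proof. by move=> Ux; split=> //=; exact: norm0_lt. Qed.

Lemma slice0_smooth c (a : S c) : smooth_on (U c) (fun x => a (0, x)).
Proof.
apply: (@smooth_slice R n (Om c)); first exact: chart_image_open.
  by move=> x Ux; exact: st0.
exact: (sfun_smooth a).
Qed.

(** [e] is the ring expression of the integrand and [Z] the flux whose divergence it is, up to the
    density. Additivity of [e] allows localisation to a test function supported in one chart, where
    [chart_divergence] applies. *)
Lemma divergence_theorem (Phi : (M -> R) -> M -> R)
    (e : forall c : chart A, S c -> S c) (Z : forall c : chart A, S c -> 'I_n -> S c) :
  (forall c psi (b : S c), smooth_fun A psi -> repr (fun=> psi) b -> forall x, U c x ->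
    Phi psi (chart_inv c x) = e c b (0, x)) ->
  (forall c (a b : S c), e c (a + b) = e c a + e c b) ->
  (forall c (b : S c), w c * e c b = \sum_k dx eps c k (Z c b k)) ->
  (forall c (b : S c) z k, b z = 0 -> (forall i, dx eps c i b z = 0) -> Z c b k z = 0) ->
  forall psi, smooth_fun A psi -> \int[mu]_p Phi psi p = 0.
Proof.
move=> Phie eD eZ Z0.
have e0 c : e c 0 = 0.
  by apply: (addrI (e c 0)); rewrite -eD !addr0.
have rp psi c : smooth_fun A psi -> exists b : S c, repr (fun=> psi) b.
  by move=> sp; exact: (smooth_ffam_static eps sp c).
have pE p : p = chart_inv (chart_at A p) (chart_map (chart_at A p) p).
  by rewrite chart_mapK//; exact: chart_atP.
have sPhi psi : smooth_fun A psi -> smooth_fun A (Phi psi).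
  move=> sp c; have [b rb] := rp psi c sp.
  apply: (@eq_smooth_on R _ _ _ (fun x => e c b (0, x))); first exact: chart_image_open.
    by move=> x Ux; rewrite /= (Phie c psi b).
  exact: slice0_smooth.
apply: (integral_localize hM cM rmu).
- by move=> psi sp; apply: smooth_fun_continuous; exact: sPhi.
- move=> psi chi sp sc p; set c := chart_at A p.
  have Ux : U c (chart_map c p) by apply: chart_image; exact: chart_atP.
  have [a ra] := rp psi c sp; have [b rb] := rp chi c sc.
  rewrite [in LHS](pE p) -/c (Phie c _ (a + b))//.
  - by rewrite eD sfunD -(Phie c psi)// -(Phie c chi)// /c -pE.
  - exact: smooth_funD.
  - by move=> z Oz; rewrite sfunD -ra// -rb.
- move=> p; set c := chart_at A p.
  have Ux : U c (chart_map c p) by apply: chart_image; exact: chart_atP.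
  rewrite (pE p) -/c (Phie c _ 0)//; first by rewrite e0.
  exact: smooth_fun_cst.
move=> c K psi cK Kd sp psi0; have [b rb] := rp psi c sp.
have clK : closed K by exact: compact_closed.
have dead c' (b' : S c') z : repr (fun=> psi) b' -> Om c' z -> ~ K (chart_inv c' z.2) ->
    b' z = 0 /\ forall i, dx eps c' i b' z = 0.
  move=> rb' Oz nK; split; first by rewrite -(rb' z Oz) psi0.
  move=> i; rewrite -(pderiv_repr i rb' Oz) /pderiv.
  rewrite (near_eq_derive (g := fun=> 0)) ?derive_cst//.
  have : \forall y \near z.2, ~ K (chart_inv c' y).
    apply: (chart_inv_continuous_at Oz.2 (t := ~` K)); apply: open_nbhs_nbhs; split=> //.
    by rewrite openC.
  by apply: filterS => y nKy; rewrite /= psi0.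
(* [e] may involve second derivatives of the test function, about which [Z0] says nothing. Off [K]
   it vanishes because the density times it is the divergence of a field that vanishes near the
   point. *)
have PhiK p : ~ K p -> Phi psi p = 0.
  move=> nK; pose c' := chart_at A p; pose x := chart_map c' p.
  have Ux : U c' x by apply: chart_image; exact: chart_atP.
  have [b' rb'] := rp psi c' sp.
  have Ei : chart_inv c' x = p by rewrite /c' /x -pE.
  rewrite -Ei (Phie c' psi b' sp rb' x Ux).
  have : (w c' * e c' b') (0, x) = 0.
    rewrite eZ sfun_sum big1// => k _; rewrite dxE; last exact: st0.
    rewrite -(pderiv_slice (iota := fun y => (0, y)) (e := fun i => (0, delta_mx 0 i)) (@slice_st R n 0)).
    rewrite /pderiv (near_eq_derive (g := fun=> 0)) ?derive_cst//.
    have n1 : \forall y \near x, U c' y by apply: open_nbhs_nbhs; split=> //; exact: chart_image_open.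
    have n2 : \forall y \near x, ~ K (chart_inv c' y).
      apply: (chart_inv_continuous_at Ux (t := ~` K)); apply: open_nbhs_nbhs; split; first by rewrite openC.
      by rewrite /setC/= Ei.
    apply: filterS2 n1 n2 => y Uy nKy /=.
    by have [b0 db0] := dead c' b' (0, y) rb' (st0 Uy) nKy; exact: Z0.
  rewrite sfunM => /eqP; rewrite mulf_eq0 gt_eqF ?(wc_gt0 eps0 rgs sh (st0 Ux))//= => /eqP //.
apply: (chart_divergence rmu cK Kd (smooth_fun_continuous (sPhi psi sp)) PhiK
  (Z := fun k x => Z c b k (0, x))).
- by move=> k; exact: slice0_smooth.
- move=> k x Ux nK; have [b0 db0] := dead c b (0, x) rb (st0 Ux) nK; exact: Z0.
- move=> x Ux; rewrite (Phie c psi b sp rb x Ux).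
  have := wcE eps0 rgs sh (st0 Ux); rewrite perturb0/= => <-.
  rewrite mulrC -sfunM eZ sfun_sum; apply: eq_bigr => k _; rewrite dxE; last exact: st0.
  rewrite -(pderiv_slice (iota := fun y => (0, y)) (e := fun i => (0, delta_mx 0 i)) (@slice_st R n 0)).
  by [].
Qed.
End DivergenceTheorem.

Section MoreRingIdentities.
Variables (A : comPzRingType) (n : nat) (d : 'I_n -> {additive A -> A}) (half : A).
Hypothesis dM : forall i, derivation (d i).
Hypothesis dC : forall i j a, d i (d j a) = d j (d i a).
Hypothesis halfE : (1 + 1) * half = 1.
Variables (g P : 'M[A]_n).
Hypothesis gT : g^T = g.
Hypothesis Pg : P *m g = 1%:M.
Local Notation G := (gam d half g P).

Lemma pairing_gg : pairing P g g = n%:R.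
Proof. by rewrite (pairing_g gT Pg) Pg mxtrace1. Qed.

Lemma inner_dif a b :
  pairing P (dif d a *m (dif d b)^T) g = ((dif d a)^T *m P *m dif d b) 0 0.
Proof.
rewrite (pairing_g gT Pg) mulmxA mxtrace_mulC mulmxA mx11_tr -mx11_tr -mxtrace_tr mx11_tr.
by rewrite !trmx_mul trmxK (inv_metric_sym gT Pg) mulmxA.
Qed.

Lemma dif_inner a : dif d (pairing P (dif d a *m (dif d a)^T) g) =
  hess d G a *m P *m dif d a + hess d G a *m P *m dif d a.
Proof.
apply/matrixP => k j; rewrite [LHS]mxE inner_dif.
have -> : d k (((dif d a)^T *m P *m dif d a) 0 0) =
    (map_mx (d k) ((dif d a)^T *m P *m dif d a)) 0 0 by rewrite [RHS]mxE.
rewrite (derivation_mx _ _ (dM k)) (derivation_mx _ _ (dM k)) (d_inv_metric dM halfE gT Pg).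
rewrite -map_trmx; set X := dif d a; set Y := map_mx (d k) X; set GG := G k.
have PT : P^T = P := inv_metric_sym gT Pg.
have HE : (hess d G a *m P *m X) k j = ((Y^T - X^T *m GG^T) *m P *m X) 0 0.
  have rH : row k (hess d G a) = Y^T - X^T *m GG^T.
    rewrite /Y /X /GG; have s i1 i2 i3 : G i1 i2 i3 = G i2 i1 i3 by exact: gam_sym.
    move: G s => GG' s; apply/rowP => i; rewrite !mxE; congr (_ - _).
    by apply: eq_bigr => l _; rewrite !mxE s mulrC.
  by rewrite -rH -!row_mul [RHS]mxE (ord1 j).
have E1 : (X^T *m P *m Y) 0 0 = (Y^T *m P *m X) 0 0.
  by rewrite -[LHS]mx11_tr -mxtrace_tr mx11_tr !trmx_mul trmxK PT mulmxA.
have E2 : (X^T *m P *m GG *m X) 0 0 = (X^T *m GG^T *m P *m X) 0 0.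
  by rewrite -[LHS]mx11_tr -mxtrace_tr mx11_tr !trmx_mul trmxK PT !mulmxA.
rewrite [RHS]mxE HE !(mulmxBl, mulmxDl, mulmxDr, mulmxN, mulNmx) !mulmxA.
move: E1 E2; move: (X^T *m P *m Y) (Y^T *m P *m X) (X^T *m P *m GG *m X) (X^T *m GG^T *m P *m X) => q1 q2 q3 q4.
by rewrite !mxE => -> ->; ring.
Qed.

Lemma inner_dif_inner a :
  pairing P (dif d a *m (dif d (pairing P (dif d a *m (dif d a)^T) g))^T) g =
  pairing P (hess d G a) (dif d a *m (dif d a)^T)
  + pairing P (hess d G a) (dif d a *m (dif d a)^T).
Proof.
rewrite inner_dif dif_inner mulmxDr mxE (pairing_dyad d gT Pg) -!mulmxA.
by [].
Qed.

Variable D : {additive A -> A}.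
Hypothesis dD : derivation D.
Hypothesis DC : forall i a, D (d i a) = d i (D a).

Lemma var_inner a b : D (pairing P (dif d a *m (dif d b)^T) g) =
  - pairing P (map_mx D g) (dif d a *m (dif d b)^T)
  + pairing P (dif d (D a) *m (dif d b)^T) g + pairing P (dif d a *m (dif d (D b))^T) g.
Proof.
rewrite !inner_dif (pairing_dyad d gT Pg).
have -> : D (((dif d a)^T *m P *m dif d b) 0 0) =
    (map_mx D ((dif d a)^T *m P *m dif d b)) 0 0 by rewrite [RHS]mxE.
have Dd c : map_mx D (dif d c) = dif d (D c) by apply/matrixP => i j; rewrite !mxE DC.
rewrite (derivation_mx _ _ dD) (derivation_mx _ _ dD) (derivation_inv dD Pg (mulmx1C Pg)).
rewrite -map_trmx !Dd !(mulmxDl, mulmxDr, mulmxN, mulNmx) !mulmxA.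
move: ((dif d (D a))^T *m P *m _) ((dif d a)^T *m P *m _ *m P *m _) (_ *m P *m dif d (D b)) => q1 q2 q3.
by rewrite !mxE; ring.
Qed.
End MoreRingIdentities.

Section WeightedDivergence.
Variables (A : comPzRingType) (n : nat) (d : 'I_n -> {additive A -> A}) (half : A).
Hypothesis dM : forall i, derivation (d i).
Hypothesis dC : forall i j a, d i (d j a) = d j (d i a).
Hypothesis halfE : (1 + 1) * half = 1.
Variables (g P : 'M[A]_n).
Hypothesis gT : g^T = g.
Hypothesis Pg : P *m g = 1%:M.
Variables (w winv : A).
Hypothesis ww : w * w = \det g.
Hypothesis wV : w * winv = 1.
Local Notation G := (gam d half g P).
Local Notation H a := (hess d G a).
Local Notation dd a b := (dif d a *m (dif d b)^T).

Lemma dyadDr a b b' : dd a (b + b') = dd a b + dd a b'.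
Proof. by rewrite difD linearD/= mulmxDr. Qed.

Lemma dyadDl a b b' : dd (b + b') a = dd b a + dd b' a.
Proof. by rewrite difD mulmxDl. Qed.

Variables (f u : A).
Hypothesis du : forall i, d i u = - (u * d i f).

Lemma dyad_weighted a b : dd a (b * u) = u *: (dd a b - b *: dd a f).
Proof.
apply/matrixP => i j.
by rewrite !mxE !big_ord_recl !big_ord0 !mxE dM du; ring.
Qed.

(** This and the two terms below are divergences of known fluxes with test function b e^-f, expanded
    so that the weight is a common factor. They are stated for the ring; the corresponding functions
    on the manifold are integrated later. *)
Definition laplacian_term b : A :=
  (pairing P (H f) g * b + pairing P (dd f b) g - pairing P (dd f f) g * b) * u.

Lemma laplacian_termD a b : laplacian_term (a + b) = laplacian_term a + laplacian_term b.
Proof. by rewrite /laplacian_term dyadDr pairingDl; ring. Qed.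

Lemma laplacian_term_div b : w * laplacian_term b =
  \sum_k d k ((\sum_i (w * P k i) * d i f) * (b * u)).
Proof.
rewrite (div_laplacian dM dC halfE gT Pg ww wV) dyad_weighted !pairing_lin /laplacian_term.
by ring.
Qed.

Definition bochner_term b : A :=
  ((pairing P (H f) (H f) - pairing P (H f) g * pairing P (H f) g
    + pairing P (ric d G) (dd f f)) * b
   + (pairing P (H f) (dd f b) - b * pairing P (H f) (dd f f))
   - pairing P (H f) g * (pairing P (dd f b) g - b * pairing P (dd f f) g)) * u.

Lemma bochner_termD a b : bochner_term (a + b) = bochner_term a + bochner_term b.
Proof. by rewrite /bochner_term dyadDr pairingDl pairingDr; ring. Qed.

Lemma bochner_term_div b : w * bochner_term b =
  \sum_k d k (w * bochner_flux d half g P f k * (b * u)).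
Proof.
rewrite (div_bochner_flux dM dC halfE gT Pg ww wV) dyad_weighted !pairing_lin /bochner_term.
by ring.
Qed.

Variable D : {additive A -> A}.
Hypothesis dD : derivation D.
Hypothesis DC : forall i a, D (d i a) = d i (D a).
Variable h : 'M[A]_n.
Hypothesis hE : map_mx D g = h.

Definition variation_term b : A :=
  ((D (pairing P (ric d G) g) + pairing P (ric d G) h) * b
   - (pairing P h (H b) - (pairing P h (dd f b) + pairing P h (dd b f))
      + b * (pairing P h (dd f f) - pairing P h (H f)))
   + pairing P h g * (pairing P (H b) g - (pairing P (dd f b) g + pairing P (dd b f) g)
      + b * (pairing P (dd f f) g - pairing P (H f) g))) * u.

Lemma variation_termD a b : variation_term (a + b) = variation_term a + variation_term b.
Proof.
by rewrite /variation_term hessD !dyadDr !dyadDl !pairingDl !pairingDr; ring.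
Qed.

Lemma variation_term_div b : w * variation_term b =
  \sum_k d k (variation_flux d half g P w D (b * u) k).
Proof.
rewrite (div_variation_flux dM dC halfE gT Pg ww wV dD DC) hE (hess_weighted dM G du).
rewrite !pairing_lin /variation_term (pairing_g gT Pg (ric d G)).
by ring.
Qed.

End WeightedDivergence.

Section Operators.
Variables (R : realType) (n : nat) (M : ptopologicalType) (A : smooth_atlas R n M).
Variable k : tensor2 A.

Definition inner_grad (u v : M -> R) : M -> R :=
  contraction k (gradient_dyad u v) k.
Definition laplacian (u : M -> R) : M -> R := contraction k (hessian_tensor k u) k.
Definition scal : M -> R := contraction k (ricci_tensor k) k.
Definition hess_hess (u : M -> R) : M -> R := contraction k (hessian_tensor k u) (hessian_tensor k u).
Definition hess_grad (u v w : M -> R) : M -> R :=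
  contraction k (hessian_tensor k u) (gradient_dyad v w).
Definition ricci_grad (u v : M -> R) : M -> R :=
  contraction k (ricci_tensor k) (gradient_dyad u v).

End Operators.

Section IntegralIdentities.
Variables (R : realType) (n : nat) (M : ptopologicalType).
Variable A : smooth_atlas R n M.
Local Notation U c := (chart_map c @` chart_dom c).
Variables (g h : tensor2 A) (eps : R).
Hypothesis eps0 : 0 < eps.
Hypothesis rgs : forall s : R, `|s| < eps -> riemannian_metric (perturb g h s).
Hypothesis sh : smooth_sym_tensor h.
Hypotheses (hM : hausdorff_space M) (cM : compact [set: M]).
Local Notation gs := (perturb g h).
Local Notation Om c := (open_domain_set (st_domain eps c)).
Local Notation S c := (sfun (st_domain eps c)).
Local Notation half c := (sconst (st_domain eps c) 2^-1).
Local Notation w c := (wc g h eps c).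
Local Notation gg c := (Gc g h eps c).
Local Notation P c := (Pc g h eps c).
Local Notation hc c := (Hc h eps c).
Local Notation G c := (gam (dx eps c) (half c) (gg c) (P c)).
Local Notation Ri c := (ric (dx eps c) (G c)).
Local Notation He c a := (hess (dx eps c) (G c) a).
Local Notation Df c a := (dif (dx eps c) a).
Implicit Types (c : chart A) (p q : M) (x : 'rV[R]_n) (z : R * 'rV[R]_n)
  (u v psi : M -> R) (F : R -> M -> R).

Lemma law_ricci : law_fam eps (fun s => ricci_tensor (gs s)).
Proof. by move=> s se; exact: ricci_tensor_law (rgs se). Qed.

Lemma law_hessian F : smooth_ffam A eps F -> law_fam eps (fun s => hessian_tensor (gs s) (F s)).
Proof.
by move=> sF s se; apply: (hessian_tensor_law (rgs se)); exact: smooth_ffam_fun sF se.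
Qed.

Lemma law_dyad F1 F2 : smooth_ffam A eps F1 -> smooth_ffam A eps F2 ->
  law_fam eps (fun s => gradient_dyad (F1 s) (F2 s) : tensor2 A).
Proof.
move=> s1 s2 s se; apply: gradient_dyad_law; [exact: smooth_ffam_fun s1 se|exact: smooth_ffam_fun s2 se].
Qed.

Lemma law_h : law_fam eps (fun=> h).
Proof. by move=> s se; case: sh => _ _ lh ? ? ? ? ?; exact: lh. Qed.

Let lg : law_fam eps gs := law_metric rgs.
Let rpg c : repr_tensor gs (gg c) := Gc_repr eps0 rgs sh (c := c).
Let rpr c : repr_tensor (fun s => ricci_tensor (gs s)) (Ri c) := ricci_repr eps0 rgs sh (c := c).
Let cr c X Y Xc Yc := @contraction_repr R n M A g h eps eps0 rgs sh c X Y Xc Yc.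

Lemma inner_grad_repr c F1 F2 (a b : S c) : smooth_ffam A eps F1 -> smooth_ffam A eps F2 ->
  repr F1 a -> repr F2 b ->
  repr (fun s => inner_grad (gs s) (F1 s) (F2 s)) (pairing (P c) (Df c a *m (Df c b)^T) (gg c)).
Proof.
move=> s1 s2 r1 r2; apply: cr => //; [exact: law_dyad|exact: (dyad_repr r1 r2)].
Qed.

Lemma laplacian_repr c F (a : S c) : smooth_ffam A eps F -> repr F a ->
  repr (fun s => laplacian (gs s) (F s)) (pairing (P c) (He c a) (gg c)).
Proof. by move=> s1 r1; apply: cr => //; [exact: law_hessian|exact: hessian_repr]. Qed.

Lemma scal_repr c : repr (fun s => scal (gs s)) (pairing (P c) (Ri c) (gg c)).
Proof. by apply: cr => //; exact: law_ricci. Qed.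

Lemma hess_hess_repr c F (a : S c) : smooth_ffam A eps F -> repr F a ->
  repr (fun s => hess_hess (gs s) (F s)) (pairing (P c) (He c a) (He c a)).
Proof. by move=> s1 r1; apply: cr; [exact: law_hessian|exact: law_hessian|exact: hessian_repr|exact: hessian_repr]. Qed.

Lemma hess_grad_repr c F F1 F2 (e a b : S c) :
  smooth_ffam A eps F -> smooth_ffam A eps F1 -> smooth_ffam A eps F2 ->
  repr F e -> repr F1 a -> repr F2 b ->
  repr (fun s => hess_grad (gs s) (F s) (F1 s) (F2 s)) (pairing (P c) (He c e) (Df c a *m (Df c b)^T)).
Proof.
by move=> s s1 s2 r r1 r2; apply: cr; [exact: law_hessian|exact: law_dyad|exact: hessian_repr|exact: (dyad_repr r1 r2)].
Qed.

Lemma ricci_grad_repr c F1 F2 (a b : S c) :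
  smooth_ffam A eps F1 -> smooth_ffam A eps F2 -> repr F1 a -> repr F2 b ->
  repr (fun s => ricci_grad (gs s) (F1 s) (F2 s)) (pairing (P c) (Ri c) (Df c a *m (Df c b)^T)).
Proof.
by move=> s1 s2 r1 r2; apply: cr => //; [exact: law_ricci|exact: law_dyad|exact: (dyad_repr r1 r2)].
Qed.

Lemma h_dyad_repr c F1 F2 (a b : S c) :
  smooth_ffam A eps F1 -> smooth_ffam A eps F2 -> repr F1 a -> repr F2 b ->
  repr (fun s => contraction (gs s) h (gradient_dyad (F1 s) (F2 s))) (pairing (P c) (hc c) (Df c a *m (Df c b)^T)).
Proof.
move=> s1 s2 r1 r2; apply: (cr (X := fun=> h)); [exact: law_h|exact: law_dyad|exact: Hc_repr|exact: (dyad_repr r1 r2)].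
Qed.

Lemma h_hess_repr c F (a : S c) : smooth_ffam A eps F -> repr F a ->
  repr (fun s => contraction (gs s) h (hessian_tensor (gs s) (F s))) (pairing (P c) (hc c) (He c a)).
Proof.
move=> s1 r1; apply: (cr (X := fun=> h)); [exact: law_h|exact: law_hessian|exact: Hc_repr|exact: hessian_repr].
Qed.

Lemma h_trace_repr c : repr (fun s => contraction (gs s) h (gs s)) (pairing (P c) (hc c) (gg c)).
Proof. by apply: (cr (X := fun=> h)) => //; [exact: law_h|exact: Hc_repr]. Qed.

Lemma ricci_h_repr c :
  repr (fun s => contraction (gs s) (ricci_tensor (gs s)) h) (pairing (P c) (Ri c) (hc c)).
Proof. by apply: (cr (Y := fun=> h)) => //; [exact: law_ricci|exact: law_h|exact: Hc_repr]. Qed.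

Lemma derive_expRN c (a u : S c) i : (forall z, Om c z -> u z = expR (- a z)) ->
  dx eps c i u = - (u * dx eps c i a).
Proof.
move=> ua; apply: sfun_eq => z Oz; rewrite dxE// sfunN sfunM dxE// ua//.
rewrite (near_eq_derive (g := fun y => expR ((- a : S c) y))); last first.
  by apply: (near_open_eq (@st_set_open R n M A eps c) Oz) => y Oy; rewrite ua.
have da : differentiable (- a : S c) z by exact: sfun_differentiable.
have de : differentiable (@expR R) ((- a : S c) z) by apply/derivable1_diffP; exact: derivable_expR.
rewrite (@derive_comp_coordinates R _ _ _ _ _ (- a : S c) (@expR R) z (0, delta_mx 0 i) (coordinates_real R))//.
have [_ eE] := is_derive_expR ((- a : S c) z).
rewrite big_ord1/= eE.
have -> : 'D_(0, delta_mx 0 i) (fun y => (- a : S c) y) z = - 'D_(0, delta_mx 0 i) a z.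
  by rewrite -(dxE i (- a) Oz) raddfN sfunN dxE.
by rewrite sfunN mulNr mulrC.
Qed.

Variable f : M -> R.
Hypothesis sf : smooth_fun A f.
Let u0 : M -> R := fun p => expR (- f p).

Lemma weight_smooth : smooth_fun A (fun p => expR (- f p)).
Proof.
have sN : smooth_fun A (fun p => (-1) * f p) by apply: smooth_funM => //; exact: smooth_fun_cst.
have := smooth_fun_comp sN (@smooth_expR R) (fun=> I).
by rewrite (_ : (fun p => expR (-1 * f p)) = (fun p => expR (- f p)))//; apply/funext => p; rewrite mulN1r.
Qed.

Let fc c : S c := to_sfun (st_domain eps c) (fun z => f (chart_inv c z.2)).
Let uc c : S c := to_sfun (st_domain eps c) (fun z => expR (- f (chart_inv c z.2))).

Let stat_repr v c : smooth_fun A v ->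
  repr (fun=> v) (to_sfun (st_domain eps c) (fun z => v (chart_inv c z.2))).
Proof.
move=> sv z Oz; rewrite to_sfunE//.
apply: (@smooth_snd R n (st_set eps c) (U c) (fun x => v (chart_inv c x))); [exact: st_set_open|by move=> y []|exact: sv].
Qed.

Let rf c : repr (fun=> f) (fc c). Proof. exact: stat_repr. Qed.
Let ru c : repr (fun=> u0) (uc c). Proof. exact: stat_repr weight_smooth. Qed.
Let sff : smooth_ffam A eps (fun=> f). Proof. exact: smooth_ffam_static. Qed.
Let stf v : smooth_fun A v -> smooth_ffam A eps (fun=> v). Proof. exact: smooth_ffam_static. Qed.

Let duc c i : dx eps c i (uc c) = - (uc c * dx eps c i (fc c)).
Proof. by apply: derive_expRN => z Oz; rewrite -(ru Oz) -(rf Oz). Qed.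

Variable mu : {measure set (borel M) -> \bar R}.
Hypothesis rmu : riemannian_measure g mu.

Let gT c := Gc_sym eps0 rgs sh c.
Let PV c := PcV eps0 rgs sh c.
Let wM c := wcM eps0 rgs sh c.
Let wV c := wcV eps0 rgs sh c.
Let hE c : map_mx (dt eps c) (gg c) = hc c := dt_metric eps0 rgs sh c.

Lemma weighted_laplacian psi : smooth_fun A psi ->
  \int[mu]_p ((laplacian g f p * psi p + inner_grad g f psi p
               - inner_grad g f f p * psi p) * expR (- f p)) = 0.
Proof.
apply: (divergence_theorem eps0 rgs sh hM cM rmu
  (Phi := fun psi p => (laplacian g f p * psi p + inner_grad g f psi p
               - inner_grad g f f p * psi p) * expR (- f p))
  (e := fun c => laplacian_term (dx eps c) (half c) (gg c) (P c) (fc c) (uc c))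
  (Z := fun c b k => (\sum_i (w c * P c k i) * dx eps c i (fc c)) * (b * uc c))).
- move=> c v b sv rb x Ux; have Oz := st0 eps0 Ux.
  have e1 : laplacian (gs 0) f (chart_inv c x) = _ := laplacian_repr sff (@rf c) Oz.
  have e2 : inner_grad (gs 0) f v (chart_inv c x) = _ :=
    inner_grad_repr sff (stf sv) (@rf c) rb Oz.
  have e3 : inner_grad (gs 0) f f (chart_inv c x) = _ :=
    inner_grad_repr sff sff (@rf c) (@rf c) Oz.
  have e4 : v (chart_inv c x) = _ := rb _ Oz.
  have e5 : expR (- f (chart_inv c x)) = _ := ru Oz.
  rewrite perturb0 in e1 e2 e3.
  cbv beta; rewrite e1 e2 e3 e4 e5 /laplacian_term sfunM sfunB sfunD !sfunM.
  reflexivity.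
- by move=> c a b; exact: laplacian_termD.
- by move=> c b; exact: (laplacian_term_div (@dx_derivation R n M A eps c) (@dxC R n M A eps c)
    (sconst_half _) (gT c) (PV c) (wM c) (wV c) (@duc c)).
- by move=> c b z k b0 _; rewrite !sfunM b0 mul0r mulr0.
Qed.

Lemma weighted_bochner psi : smooth_fun A psi ->
  \int[mu]_p (((hess_hess g f p - laplacian g f p * laplacian g f p + ricci_grad g f f p) * psi p
    + (hess_grad g f f psi p - psi p * hess_grad g f f f p)
    - laplacian g f p * (inner_grad g f psi p - psi p * inner_grad g f f p)) * expR (- f p)) = 0.
Proof.
apply: (divergence_theorem eps0 rgs sh hM cM rmu
  (Phi := fun psi p => ((hess_hess g f p - laplacian g f p * laplacian g f p + ricci_grad g f f p) * psi p
    + (hess_grad g f f psi p - psi p * hess_grad g f f f p)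
    - laplacian g f p * (inner_grad g f psi p - psi p * inner_grad g f f p)) * expR (- f p))
  (e := fun c => bochner_term (dx eps c) (half c) (gg c) (P c) (fc c) (uc c))
  (Z := fun c b k => w c * bochner_flux (dx eps c) (half c) (gg c) (P c) (fc c) k * (b * uc c))).
- move=> c v b sv rb x Ux; have Oz := st0 eps0 Ux.
  have e1 : laplacian (gs 0) f (chart_inv c x) = _ := laplacian_repr sff (@rf c) Oz.
  have e2 : inner_grad (gs 0) f v (chart_inv c x) = _ :=
    inner_grad_repr sff (stf sv) (@rf c) rb Oz.
  have e3 : inner_grad (gs 0) f f (chart_inv c x) = _ :=
    inner_grad_repr sff sff (@rf c) (@rf c) Oz.
  have e4 : v (chart_inv c x) = _ := rb _ Oz.
  have e5 : expR (- f (chart_inv c x)) = _ := ru Oz.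
  have e6 : hess_hess (gs 0) f (chart_inv c x) = _ := hess_hess_repr sff (@rf c) Oz.
  have e7 : ricci_grad (gs 0) f f (chart_inv c x) = _ := ricci_grad_repr sff sff (@rf c) (@rf c) Oz.
  have e8 : hess_grad (gs 0) f f v (chart_inv c x) = _ :=
    hess_grad_repr sff sff (stf sv) (@rf c) (@rf c) rb Oz.
  have e9 : hess_grad (gs 0) f f f (chart_inv c x) = _ :=
    hess_grad_repr sff sff sff (@rf c) (@rf c) (@rf c) Oz.
  rewrite perturb0 in e1 e2 e3 e6 e7 e8 e9.
  cbv beta; rewrite e1 e2 e3 e4 e5 e6 e7 e8 e9 /bochner_term.
  do 8 rewrite ?sfunM ?sfunB ?sfunD.
  reflexivity.
- by move=> c a b; exact: bochner_termD.
- by move=> c b; exact: (bochner_term_div (@dx_derivation R n M A eps c) (@dxC R n M A eps c)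
    (sconst_half _) (gT c) (PV c) (wM c) (wV c) (@duc c)).
- by move=> c b z k b0 _; rewrite !sfunM b0 mul0r mulr0.
Qed.

Let scal_dot c x : U c x ->
  dot (fun s => scal (gs s)) (chart_inv c x) = dt eps c (pairing (P c) (Ri c) (gg c)) (0, x).
Proof. by move=> Ux; apply: (dot_repr eps0 (@scal_repr c) Ux). Qed.

Lemma weighted_variation psi : smooth_fun A psi ->
  \int[mu]_p (((dot (fun s => scal (gs s)) p + contraction g (ricci_tensor g) h p) * psi p
   - (contraction g h (hessian_tensor g psi) p
      - (contraction g h (gradient_dyad f psi) p + contraction g h (gradient_dyad psi f) p)
      + psi p * (contraction g h (gradient_dyad f f) p - contraction g h (hessian_tensor g f) p))
   + contraction g h g p * (laplacian g psi p - (inner_grad g f psi p + inner_grad g psi f p)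
      + psi p * (inner_grad g f f p - laplacian g f p))) * expR (- f p)) = 0.
Proof.
apply: (divergence_theorem eps0 rgs sh hM cM rmu
  (Phi := fun psi p => ((dot (fun s => scal (gs s)) p + contraction g (ricci_tensor g) h p) * psi p
   - (contraction g h (hessian_tensor g psi) p
      - (contraction g h (gradient_dyad f psi) p + contraction g h (gradient_dyad psi f) p)
      + psi p * (contraction g h (gradient_dyad f f) p - contraction g h (hessian_tensor g f) p))
   + contraction g h g p * (laplacian g psi p - (inner_grad g f psi p + inner_grad g psi f p)
      + psi p * (inner_grad g f f p - laplacian g f p))) * expR (- f p))
  (e := fun c => variation_term (dx eps c) (half c) (gg c) (P c) (fc c) (uc c) (dt eps c) (hc c))
  (Z := fun c b k => variation_flux (dx eps c) (half c) (gg c) (P c) (w c) (dt eps c) (b * uc c) k)).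
- move=> c v b sv rb x Ux; have Oz := st0 eps0 Ux.
  have e1 : laplacian (gs 0) f (chart_inv c x) = _ := laplacian_repr sff (@rf c) Oz.
  have e2 : inner_grad (gs 0) f v (chart_inv c x) = _ :=
    inner_grad_repr sff (stf sv) (@rf c) rb Oz.
  have e2' : inner_grad (gs 0) v f (chart_inv c x) = _ :=
    inner_grad_repr (stf sv) sff rb (@rf c) Oz.
  have e3 : inner_grad (gs 0) f f (chart_inv c x) = _ :=
    inner_grad_repr sff sff (@rf c) (@rf c) Oz.
  have e4 : v (chart_inv c x) = _ := rb _ Oz.
  have e5 : expR (- f (chart_inv c x)) = _ := ru Oz.
  have e6 : laplacian (gs 0) v (chart_inv c x) = _ := laplacian_repr (stf sv) rb Oz.
  have e7 : contraction (gs 0) (ricci_tensor (gs 0)) h (chart_inv c x) = _ := ricci_h_repr Oz.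
  have e8 : contraction (gs 0) h (hessian_tensor (gs 0) v) (chart_inv c x) = _ :=
    h_hess_repr (stf sv) rb Oz.
  have e9 : contraction (gs 0) h (hessian_tensor (gs 0) f) (chart_inv c x) = _ :=
    h_hess_repr sff (@rf c) Oz.
  have e10 : contraction (gs 0) h (gradient_dyad f v) (chart_inv c x) = _ :=
    h_dyad_repr sff (stf sv) (@rf c) rb Oz.
  have e11 : contraction (gs 0) h (gradient_dyad v f) (chart_inv c x) = _ :=
    h_dyad_repr (stf sv) sff rb (@rf c) Oz.
  have e12 : contraction (gs 0) h (gradient_dyad f f) (chart_inv c x) = _ :=
    h_dyad_repr sff sff (@rf c) (@rf c) Oz.
  have e13 : contraction (gs 0) h (gs 0) (chart_inv c x) = _ := h_trace_repr Oz.
  rewrite perturb0 in e1 e2 e2' e3 e6 e7 e8 e9 e10 e11 e12 e13.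
  cbv beta; rewrite (scal_dot Ux) e1 e2 e2' e3 e4 e5 e6 e7 e8 e9 e10 e11 e12 e13 /variation_term.
  do 12 rewrite ?sfunM ?sfunB ?sfunD.
  reflexivity.
- by move=> c a b; exact: variation_termD.
- by move=> c b; exact: (variation_term_div (@dx_derivation R n M A eps c) (@dxC R n M A eps c)
    (sconst_half _) (gT c) (PV c) (wM c) (wV c) (@duc c) (@dt_derivation R n M A eps c)
    (@dtC R n M A eps c) (hE c)).
(* The flux contains the test function and its first derivatives only, so it vanishes where these
   do. *)
- move=> c b z k b0 db0.
  have bu : (b * uc c) z = 0 by rewrite sfunM b0 mul0r.
  have dbu i : dx eps c i (b * uc c) z = 0.
    by rewrite (@dx_derivation R n M A eps c i) sfunD !sfunM b0 db0 !mul0r addr0.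
  move: (b * uc c) bu dbu => bb bu dbu.
  have s0 (cf : 'I_n -> S c) : (\sum_i cf i * dx eps c i bb) z = 0.
    by rewrite sfun_sum big1// => i _; rewrite sfunM dbu mulr0.
  rewrite /variation_flux sfunD sfunD sfunM bu mulr0 add0r sfunM.
  by rewrite (s0 (fun i => dt eps c (w c * P c k i))) (s0 (fun i => w c * P c k i)) mul0r addr0.
Qed.

(** Unweighted, unlike its neighbours: the divergence formula is taken with test function 1 and no
    factor e^-f. It rules out a positive constant Laplacian. *)
Lemma laplacian_integral : \int[mu]_p (laplacian g f p) = 0.
Proof.
have key psi : smooth_fun A psi ->
    \int[mu]_p (laplacian g f p * psi p + inner_grad g f psi p) = 0.
  apply: (divergence_theorem eps0 rgs sh hM cM rmu
    (Phi := fun psi p => laplacian g f p * psi p + inner_grad g f psi p)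
    (e := fun c b => pairing (P c) (He c (fc c)) (gg c) * b
       + pairing (P c) (Df c (fc c) *m (Df c b)^T) (gg c))
    (Z := fun c b k => (\sum_i (w c * P c k i) * dx eps c i (fc c)) * b)).
  - move=> c v b sv rb x Ux; have Oz := st0 eps0 Ux.
    have e1 : laplacian (gs 0) f (chart_inv c x) = _ := laplacian_repr sff (@rf c) Oz.
    have e2 : inner_grad (gs 0) f v (chart_inv c x) = _ :=
      inner_grad_repr sff (stf sv) (@rf c) rb Oz.
    have e4 : v (chart_inv c x) = _ := rb _ Oz.
    rewrite perturb0 in e1 e2.
    cbv beta; rewrite e1 e2 e4 sfunD sfunM; reflexivity.
  - by move=> c a b; rewrite dyadDr pairingDl mulrDr addrACA.
  - by move=> c b; rewrite (div_laplacian (@dx_derivation R n M A eps c) (@dxC R n M A eps c)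
    (sconst_half _) (gT c) (PV c) (wM c) (wV c)).
  - by move=> c b z k b0 _; rewrite sfunM b0 mulr0.
transitivity (\int[mu]_p (laplacian g f p * 1 + inner_grad g f (fun=> 1) p)); last first.
  by apply: key; exact: smooth_fun_cst.
apply: eq_integral_fun => p; rewrite mulr1 /inner_grad /contraction.
rewrite (_ : gradient_dyad _ _ _ _ = 0); last first.
  by apply/matrixP => i j; rewrite !mxE /pderiv derive_cst mulr0.
by rewrite -[X in pairing _ X](scale0r 0) pairingZl mul0r addr0.
Qed.

Lemma inner_grad_inner p : inner_grad g f (inner_grad g f f) p = 2 * hess_grad g f f f p.
Proof.
pose c := chart_at A p; pose x := chart_map c p.
have Ux : U c x by apply: chart_image; exact: chart_atP.
have Oz := st0 eps0 Ux.
have rq := inner_grad_repr sff sff (@rf c) (@rf c).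
have sq : smooth_ffam A eps (fun s => inner_grad (gs s) f f).
  by move=> c'; exists (pairing (P c') (Df c' (fc c') *m (Df c' (fc c'))^T) (gg c')); exact: inner_grad_repr.
have e1 : inner_grad (gs 0) f (inner_grad (gs 0) f f) (chart_inv c x) = _ :=
  inner_grad_repr sff sq (@rf c) rq Oz.
have e2 : hess_grad (gs 0) f f f (chart_inv c x) = _ :=
  hess_grad_repr sff sff sff (@rf c) (@rf c) (@rf c) Oz.
rewrite perturb0 in e1 e2; move: e1 e2; rewrite /x /c chart_mapK; last exact: chart_atP.
move=> -> ->; rewrite (inner_dif_inner (@dx_derivation R n M A eps _) (sconst_half _) (gT _) (PV _)).
by rewrite sfunD mulr_natl mulr2n.
Qed.

(** The derivative [dot F] is represented by [dt] of a ring element at time 0 only, so it is not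
    represented as a family, and the pairing must be evaluated on that slice alone. *)
Lemma inner_grad_at0 c (u v : M -> R) (a b : S c) x : smooth_fun A u -> smooth_fun A v ->
  (forall y, U c y -> u (chart_inv c y) = a (0, y)) ->
  (forall y, U c y -> v (chart_inv c y) = b (0, y)) -> U c x ->
  inner_grad g u v (chart_inv c x) = pairing (P c) (Df c a *m (Df c b)^T) (gg c) (0, x).
Proof.
move=> su sv ra rb Ux; have Oz := st0 eps0 Ux.
have -> : inner_grad g u v = inner_grad (gs 0) u v by rewrite perturb0.
rewrite /inner_grad.
have n0 := norm0_lt eps0.
rewrite (contractionE (rgs n0) (gradient_dyad_law su sv) (lg n0) (chart_inv_dom Ux)).
rewrite ev_pairing (Pc_inv eps0 rgs sh Oz) -(rpg Oz); congr (pairing _ _ _).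
apply/matrixP => i j; rewrite evmxE !mxE big_ord_recl big_ord0 addr0 !mxE sfunM chart_invK//.
have sl := @slice_st_continuous R n 0.
congr (_ * _).
  by apply: (pderiv_sfun (slice_st 0) sl i _ Oz) => y [_ Uy]; exact: ra.
by apply: (pderiv_sfun (slice_st 0) sl j _ Oz) => y [_ Uy]; exact: rb.
Qed.

Lemma dot_inner_grad F1 F2 p : smooth_ffam A eps F1 -> smooth_ffam A eps F2 ->
  dot (fun s => inner_grad (gs s) (F1 s) (F2 s)) p =
  - contraction g h (gradient_dyad (F1 0) (F2 0)) p
  + inner_grad g (dot F1) (F2 0) p + inner_grad g (F1 0) (dot F2) p.
Proof.
move=> s1 s2; pose c := chart_at A p; pose x := chart_map c p.
have Ux : U c x by apply: chart_image; exact: chart_atP.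
have pE : chart_inv c x = p by rewrite chart_mapK//; exact: chart_atP.
have Oz := st0 eps0 Ux.
have n0 := norm0_lt eps0.
have [a ra] := s1 c; have [b rb] := s2 c.
have e0 := dot_repr eps0 (inner_grad_repr s1 s2 ra rb) Ux.
have e3 : contraction (gs 0) h (gradient_dyad (F1 0) (F2 0)) (chart_inv c x) = _ :=
  h_dyad_repr s1 s2 ra rb Oz.
have d1 y : U c y -> dot F1 (chart_inv c y) = dt eps c a (0, y) by move=> Uy; exact: dot_repr.
have d2 y : U c y -> dot F2 (chart_inv c y) = dt eps c b (0, y) by move=> Uy; exact: dot_repr.
have r1 y : U c y -> F1 0 (chart_inv c y) = a (0, y) by move=> Uy; exact: (ra _ (st0 eps0 Uy)).
have r2 y : U c y -> F2 0 (chart_inv c y) = b (0, y) by move=> Uy; exact: (rb _ (st0 eps0 Uy)).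
have f1 := smooth_ffam_fun s1 n0; have f2 := smooth_ffam_fun s2 n0.
have e1 := inner_grad_at0 (dot_smooth eps0 s1) f2 d1 r2 Ux.
have e2 := inner_grad_at0 f1 (dot_smooth eps0 s2) r1 d2 Ux.
rewrite perturb0 pE in e3; rewrite pE in e0 e1 e2; rewrite e0 e1 e2 e3.
rewrite (var_inner (gT c) (PV c) (@dt_derivation R n M A eps c) (@dtC R n M A eps c)) hE.
by rewrite !sfunD sfunN.
Qed.
End IntegralIdentities.

Section FamilyCalculus.
Variables (R : realType) (n : nat) (M : ptopologicalType) (A : smooth_atlas R n M).
Variable eps : R.
Hypothesis eps0 : 0 < eps.
Local Notation sfam := (smooth_ffam A eps).
Local Notation Om c := (open_domain_set (st_domain eps c)).
Implicit Types (F : R -> M -> R) (p : M).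

Lemma sfamD F1 F2 : sfam F1 -> sfam F2 -> sfam (fun s p => F1 s p + F2 s p).
Proof.
move=> s1 s2 c; have [a ra] := s1 c; have [b rb] := s2 c; exists (a + b) => z Oz.
by rewrite sfunD -ra// -rb.
Qed.

Lemma sfamM F1 F2 : sfam F1 -> sfam F2 -> sfam (fun s p => F1 s p * F2 s p).
Proof.
move=> s1 s2 c; have [a ra] := s1 c; have [b rb] := s2 c; exists (a * b) => z Oz.
by rewrite sfunM -ra// -rb.
Qed.

Lemma sfam_cst (a : R) : sfam (fun _ _ => a).
Proof. by apply: (@smooth_ffam_static R n M A eps (fun=> a)); exact: smooth_fun_cst. Qed.

Lemma sfam_time : sfam (fun s _ => s).
Proof. by apply: smooth_ffamP => c; exact: smooth_fst. Qed.

Lemma sfam_expRN F : sfam F -> sfam (fun s p => expR (- F s p)).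
Proof.
move=> sF; apply: smooth_ffamP => c; have [a ra] := sF c.
apply: (@eq_smooth_on R _ _ _ (fun z => expR ((- a : sfun (st_domain eps c)) z))).
- exact: st_set_open.
- by move=> z Oz; rewrite sfunN -ra.
apply: (smooth_on_comp_real (@st_set_open R n M A eps c) _ (sfun_smooth (- a)) (@smooth_expR R)).
by [].
Qed.

Lemma sfam_is_derive F p : sfam F -> is_derive (0 : R) 1 (fun s => F s p) (dot F p).
Proof.
move=> sF; pose c := chart_at A p; pose x := chart_map c p.
have Ux : (chart_map c @` chart_dom c) x by apply: chart_image; exact: chart_atP.
have pE : chart_inv c x = p by rewrite chart_mapK//; exact: chart_atP.
have [a ra] := sF c.
have Oz : Om c (0, x) by split=> //=; exact: norm0_lt.
have h := is_derive_time (sfun_differentiable a Oz).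
rewrite -[p in dot F p]pE (dot_repr eps0 ra Ux) dtE//.
apply: near_eq_is_derive h.
by apply: filterS (near_time eps0 Ux) => s Os; rewrite -(ra (s, x))//= pE.
Qed.

Lemma dot_val F p (a : R) : is_derive (0 : R) 1 (fun s => F s p) a -> dot F p = a.
Proof. by case. Qed.

Lemma dotD F1 F2 p : sfam F1 -> sfam F2 ->
  dot (fun s p => F1 s p + F2 s p) p = dot F1 p + dot F2 p.
Proof. move=> s1 s2; apply: dot_val; exact: is_deriveD (sfam_is_derive p s1) (sfam_is_derive p s2). Qed.

Lemma dotM F1 F2 p : sfam F1 -> sfam F2 ->
  dot (fun s p => F1 s p * F2 s p) p = dot F1 p * F2 0 p + F1 0 p * dot F2 p.
Proof.
move=> s1 s2; apply: dot_val.
have := is_deriveM (sfam_is_derive p s1) (sfam_is_derive p s2).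
rewrite (_ : _ *: _ + _ = dot F1 p * F2 0 p + F1 0 p * dot F2 p)//.
by rewrite /GRing.scale/=; ring.
Qed.

Lemma dot_static (u : M -> R) p : dot (fun=> u) p = 0.
Proof. by apply: dot_val; exact: is_derive_cst. Qed.

Lemma dot_expRN F p : sfam F -> dot (fun s p => expR (- F s p)) p = - dot F p * expR (- F 0 p).
Proof.
move=> sF; apply: dot_val.
have dN : is_derive (0 : R) 1 (fun s => - F s p) (- dot F p) := is_deriveN (sfam_is_derive p sF).
have := @is_derive1_comp R (@expR R) (fun s => - F s p) 0 _ _ (is_derive_expR _) dN.
by rewrite mulrC /GRing.scale/= mulrC.
Qed.
End FamilyCalculus.

Section IntegralDerivative.
Variables (R : realType) (n : nat) (M : ptopologicalType) (A : smooth_atlas R n M).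
Variables (g h : tensor2 A) (eps : R).
Hypothesis eps0 : 0 < eps.
Hypothesis rgs : forall s : R, `|s| < eps -> riemannian_metric (perturb g h s).
Hypothesis sh : smooth_sym_tensor h.
Hypotheses (hM : hausdorff_space M) (cM : compact [set: M]).
Local Notation gs := (perturb g h).
Variable mus : R -> {measure set (borel M) -> \bar R}.
Hypothesis rmus : forall s, `|s| < eps -> riemannian_measure (gs s) (mus s).

Lemma volume_rate_smooth : smooth_fun A (volume_rate g h).
Proof.
apply: smooth_funM; first exact: smooth_fun_cst.
have sff : smooth_ffam A eps (fun s => contraction (gs s) h (gs s)).
  by move=> c; exists (pairing (Pc g h eps c) (Hc h eps c) (Gc g h eps c)); exact: h_trace_repr.
exact: (smooth_ffam_fun sff (norm0_lt eps0)).
Qed.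

Lemma integral_derive F : smooth_ffam A eps F ->
  is_derive (0 : R) 1 (fun s => \int[mus s]_p F s p)
    (\int[mus 0]_p (dot F p + F 0 p * volume_rate g h p)).
Proof.
move=> sF; have n0 := norm0_lt eps0.
have [r [rho [K [srho cK Kd rhoK [rho0 rho1]]]]] := partition_of_unity A hM cM.
pose Fp q s p := rho q p * F s p.
have sFp q : smooth_ffam A eps (Fp q) by apply: sfamM => //; exact: smooth_ffam_static.
have cF s q : `|s| < eps -> continuous (Fp q s).
  by move=> se; apply: smooth_fun_continuous (smooth_ffam_fun (sFp q) se).
have loc q := local_integral_derive eps0 rgs sh rmus hM (cK q) (Kd q) (sFp q)
  (fun s p (nK : ~ K q p) => etrans (congr1 ( *%R^~ (F s p)) (rhoK q p nK)) (mul0r _)).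
have sumd : is_derive (0 : R) 1 (fun s => \sum_(q <- r) \int[mus s]_p Fp q s p)
    (\sum_(q <- r) \int[mus 0]_p (dot (Fp q) p + Fp q 0 p * volume_rate g h p)).
  elim: (r) => [|q r' IH].
    rewrite big_nil (_ : (fun s => _) = cst 0); first exact: is_derive_cst.
    by apply/funext => s; rewrite big_nil.
  rewrite big_cons (_ : (fun s => _) = (fun s => \int[mus s]_p Fp q s p) +
    (fun s => \sum_(q <- r') \int[mus s]_p Fp q s p)); first exact: is_deriveD.
  by apply/funext => s; rewrite big_cons.
have E (G : M -> R) p : \sum_(q <- r) rho q p * G p = G p by rewrite -mulr_suml rho1 mul1r.
have -> : \int[mus 0]_p (dot F p + F 0 p * volume_rate g h p) =
    \sum_(q <- r) \int[mus 0]_p (dot (Fp q) p + Fp q 0 p * volume_rate g h p).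
  rewrite -(integral_sum_cont hM cM (rmus n0)); last first.
    move=> q; apply: smooth_fun_continuous; apply: smooth_funD; first exact: (dot_smooth eps0 (sFp q)).
    by apply: smooth_funM volume_rate_smooth; exact: smooth_ffam_fun (sFp q) n0.
  apply: eq_integral_fun => p.
  rewrite -[LHS](E (fun p => dot F p + F 0 p * volume_rate g h p)); apply: eq_bigr => q _.
  rewrite /Fp (dotM (A := A) eps0 p (@smooth_ffam_static R n M A eps (rho q) (srho q)) sF) dot_static mul0r add0r.
  by ring.
apply: near_eq_is_derive sumd.
have : nbhs (0 : R) (ball (0 : R) eps) by exact: nbhsx_ballx.
apply: filterS => s; rewrite /ball/= sub0r normrN => se.
rewrite -(integral_sum_cont hM cM (rmus se)); last by move=> q; exact: cF.
by apply: eq_integral_fun => p; rewrite E.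
Qed.
End IntegralDerivative.

Section DefsLinks.
Variables (R : realType) (n : nat) (M : ptopologicalType) (A : smooth_atlas R n M).
Variable k : tensor2 A.
Hypothesis rk : riemannian_metric k.
Implicit Types (u v : M -> R) (p : M).

Let cp p : chart_dom (chart_at A p) p := chart_atP A p.

Let inv_sym p (i j : 'I_n) : invmx (k (chart_at A p) p) i j = invmx (k (chart_at A p) p) j i.
Proof.
have /matrixP E := inv_metric_sym (metric_sym rk (cp p)) (metric_mulVmx rk (cp p)).
by have := E j i; rewrite mxE.
Qed.

Let ginvE p (i j : 'I_n) : ginv (local_metric k (chart_at A p)) i j (chart_map (chart_at A p) p) =
  invmx (k (chart_at A p) p) i j.
Proof. by rewrite /ginv /local_metric/= chart_mapK. Qed.

Lemma scalar_curvatureE p : scalar_curvature k p = scal k p.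
Proof.
rewrite /scal /contraction/= (pairing_gE (metric_sym rk (cp p)) (metric_mulVmx rk (cp p))).
by apply: eq_bigr => i _; apply: eq_bigr => j _; rewrite ginvE mxE.
Qed.

Lemma norm_grad_sqE u p : norm_grad_sq k u p = inner_grad k u u p.
Proof.
rewrite /inner_grad /contraction/= (pairing_gE (metric_sym rk (cp p)) (metric_mulVmx rk (cp p))).
by apply: eq_bigr => i _; apply: eq_bigr => j _; rewrite ginvE mxE mulrA.
Qed.

Lemma ricci_innerE h p : ricci_inner k h p = contraction k (ricci_tensor k) h p.
Proof.
rewrite /ricci_inner /contraction /inner2 /pairing /=.
do 4 (apply: eq_bigr => ? _).
by rewrite !ginvE mxE.
Qed.

Lemma contractionC X Y p : contraction k X Y p = contraction k Y X p.
Proof.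
have gT := metric_sym rk (cp p); have PV := metric_mulVmx rk (cp p).
rewrite /contraction/= (pairingE gT PV) (pairingE gT PV).
rewrite -[RHS]mxtrace_tr !trmx_mul trmxK (inv_metric_sym gT PV).
by rewrite mxtrace_mulC !mulmxA mxtrace_mulC !mulmxA mxtrace_mulC !mulmxA.
Qed.

Lemma inner_gradC u v p : inner_grad k u v p = inner_grad k v u p.
Proof.
rewrite /inner_grad /contraction/= !(pairing_gE (metric_sym rk (cp p)) (metric_mulVmx rk (cp p))).
rewrite exchange_big/=; apply: eq_bigr => i _; apply: eq_bigr => j _.
by rewrite !mxE inv_sym [_ * pderiv j _ _]mulrC.
Qed.

Lemma contraction_metric p : contraction k k k p = n%:R.
Proof. by rewrite /contraction/= (pairing_gg (metric_sym rk (cp p)) (metric_mulVmx rk (cp p))). Qed.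

Lemma pderiv_smoothM (c : chart A) i u v p : smooth_fun A u -> smooth_fun A v -> chart_dom c p ->
  pderiv i ((fun q => u q * v q) \o chart_inv c) (chart_map c p) =
  pderiv i (u \o chart_inv c) (chart_map c p) * v p + u p * pderiv i (v \o chart_inv c) (chart_map c p).
Proof.
move=> su sv dp; have Ux := chart_image dp.
have du : derivable (u \o chart_inv c) (chart_map c p) (delta_mx 0 i).
  by apply: diff_derivable; exact: (smooth_on_differentiable (su c) Ux).
have dv : derivable (v \o chart_inv c) (chart_map c p) (delta_mx 0 i).
  by apply: diff_derivable; exact: (smooth_on_differentiable (sv c) Ux).
rewrite /pderiv (deriveM du dv)/= chart_mapK// addrC; congr (_ + _).
exact: mulrC.
Qed.

Lemma inner_gradM u v w p : smooth_fun A u -> smooth_fun A v ->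
  inner_grad k w (fun q => u q * v q) p = u p * inner_grad k w v p + v p * inner_grad k w u p.
Proof.
move=> su sv; rewrite /inner_grad /contraction/= -!pairingZl -pairingDl; congr (pairing _ _ _).
by apply/matrixP => i j; rewrite !mxE (pderiv_smoothM _ su sv (cp p)); ring.
Qed.

Lemma inner_grad_cst w (a : R) p : inner_grad k w (fun=> a) p = 0.
Proof.
rewrite /inner_grad /contraction/= (_ : gradient_dyad _ _ _ _ = 0).
  by rewrite -[X in pairing _ X](scale0r 0) pairingZl mul0r.
by apply/matrixP => i j; rewrite !mxE /pderiv derive_cst mulr0.
Qed.

Lemma hess_grad_cst w w' (a : R) p : hess_grad k w w' (fun=> a) p = 0.
Proof.
rewrite /hess_grad /contraction/= (_ : gradient_dyad _ _ _ _ = 0).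
  by rewrite -[X in pairing _ _ X](scale0r 0) pairingZr mul0r.
by apply/matrixP => i j; rewrite !mxE /pderiv derive_cst mulr0.
Qed.

End DefsLinks.

(** * Euler-Lagrange equations *)

Lemma derive_add_cst (R : realType) (V : normedModType R) (F : V -> R) (a : R) (v x : V) :
  'D_v (fun y => F y + a) x = 'D_v F x.
Proof.
rewrite /derive; congr (lim _).
have -> // : (fun t : R => t^-1 *: (((fun y => F y + a) \o shift x) (t *: v) - (F x + a))) =
   (fun t : R => t^-1 *: ((F \o shift x) (t *: v) - F x)).
by apply/funext => t /=; rewrite opprD addrACA subrr addr0.
Qed.

Section RealDerivatives.
Variable R : realType.

Lemma derive_at_min (Psi : R -> R) (D e : R) : 0 < e -> is_derive (0 : R) 1 Psi D ->
  Psi 0 = 0 -> (forall t, `|t| < e -> 0 <= Psi t) -> D = 0.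
Proof.
move=> e0 [dP DE] P0 Pge; apply: contrapT => /eqP D0.
have cv : (fun t : R => t^-1 *: (Psi (t *: 1 + 0) - Psi 0)) @ 0^' --> D.
  by move: dP => /cvg_ex[l cl]; rewrite -DE /derive (cvg_lim _ cl).
have D1 : 0 < `|D| by rewrite normr_gt0.
move/cvgrPdist_lt : cv => /(_ _ D1)[d /= d0 dP'].
pose m := Num.min d e / 2.
have m0 : 0 < m by rewrite divr_gt0// lt_min d0 e0.
have mlt : m < Num.min d e by rewrite /m ltr_pdivrMr// ltr_pMr ?ltr1n// lt_min d0 e0.
have [md me] : m < d /\ m < e by move: mlt; rewrite lt_min => /andP[].
have key (t : R) : `|t| = m -> `|D - t^-1 * Psi t| < `|D|.
  move=> tm; have := dP' t; rewrite /ball/= sub0r normrN tm => /(_ md).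
  rewrite P0 subr0 addr0 [t *: 1]mulr1; apply.
  by rewrite -normr_eq0 tm gt_eqF.
have Pm (t : R) : `|t| = m -> 0 <= Psi t by move=> tm; apply: Pge; rewrite tm.
have [Dp|Dn] : 0 < D \/ D < 0 by apply/orP; rewrite orbC -neq_lt.
  have nm : `|- m| = m by rewrite normrN gtr0_norm.
  have := key _ nm; have := Pm _ nm.
  rewrite invrN mulNr opprK => Pn; have q0 : 0 <= m^-1 * Psi (- m) by rewrite mulr_ge0// invr_ge0 ltW.
  move: (m^-1 * _) q0 => y y0; rewrite (gtr0_norm Dp) ger0_norm; lra.
have nm : `|m| = m by rewrite gtr0_norm.
have := key _ nm; have := Pm _ nm => Pn.
have q0 : 0 <= m^-1 * Psi m by rewrite mulr_ge0// invr_ge0 ltW.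
move: (m^-1 * _) q0 => y y0; rewrite (ltr0_norm Dn) ler0_norm; lra.
Qed.

Lemma is_derive_normalization (n : nat) (T : R -> R) (T' : R) : 0 < T 0 ->
  is_derive (0 : R) 1 T T' ->
  is_derive (0 : R) 1 (fun s => (4 * pi * T s) `^ (- (n%:R / 2)))
    (- (n%:R / 2) / T 0 * T' * (4 * pi * T 0) `^ (- (n%:R / 2))).
Proof.
move=> T0 dT; have p0 : (0 : R) < 4 * pi by rewrite mulr_gt0// pi_gt0.
have x0 : 0 < 4 * pi * T 0 by rewrite mulr_gt0.
set a := - (n%:R / 2); pose L s := 4 * pi * T s.
have dL : is_derive (0 : R) 1 L (4 * pi * T').
  have -> : L = (4 * pi) *: T by [].
  exact: is_deriveZ.
have := is_derive1_comp (is_derive1_powR a x0 : is_derive (L 0) 1 _ _) dL.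
have -> : (L 0) `^ (a - 1) = (L 0) `^ a * (L 0)^-1.
  have L0 : 0 < L 0 by exact: x0.
  by rewrite powRD ?powR_inv1 ?ltW//; apply/implyP => _; rewrite gt_eqF.
have -> : a * ((L 0) `^ a * (L 0)^-1) * (4 * pi * T') = a / T 0 * T' * (4 * pi * T 0) `^ a.
  rewrite /L; move: (powR _ _) => y; move: p0; move: (4 * pi) => z z0; field.
  by rewrite (gt_eqF z0) (gt_eqF T0).
by [].
Qed.
End RealDerivatives.

Lemma is_derive_scale (R : realType) (c x D : R) (F : R -> R) : is_derive x 1 F D ->
  is_derive x 1 (fun s => c * F s) (c * D).
Proof. by move=> dF; have -> : (fun s => c * F s) = c *: F by []; exact: is_deriveZ. Qed.

Section EulerLagrange.
Variables (R : realType) (n : nat) (M : ptopologicalType) (A : smooth_atlas R n M).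
Hypotheses (hM : hausdorff_space M) (cM : compact [set: M]).
Variable dV : tensor2 A -> {measure set (borel M) -> \bar R}.
Hypothesis hdV : forall g' : tensor2 A, riemannian_metric g' -> riemannian_measure g' (dV g').
Variables (k : tensor2 A) (f : M -> R) (tau : R).
Hypothesis rk : riemannian_metric k.
Hypothesis real_nu : realizes_nu dV k f tau.

(** With the zero tensor as direction the family of metrics is constant, and the results on families
    apply to a fixed metric with varying functions. *)
Let z0 : tensor2 A := fun _ _ => 0.
Let sz : smooth_sym_tensor z0.
Proof.
split=> [c p _|c i j|c d p _ _ K]; first exact: trmx0.
  rewrite (_ : (fun x => _) = fun=> 0); first exact: smooth_on_cst.
  by apply/funext => x; rewrite mxE.
by rewrite mulmx0 mul0mx.
Qed.
Let pz s : perturb k z0 s = k.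
Proof. by apply/funext => c; apply/funext => p; rewrite /perturb scaler0 addr0. Qed.
Let e1 : 0 < 1 :> R. Proof. exact: ltr01. Qed.
Let rz s : `|s| < 1 -> riemannian_metric (perturb k z0 s). Proof. by rewrite pz. Qed.
Let mu := dV k.
Let rmu : riemannian_measure k mu. Proof. exact: hdV. Qed.
Let rmz s : `|s| < 1 -> riemannian_measure (perturb k z0 s) mu. Proof. by rewrite pz. Qed.
Let sf : smooth_fun A f. Proof. by case: real_nu. Qed.
Let tau0 : 0 < tau. Proof. by case: real_nu. Qed.
Local Notation sfam := (smooth_ffam A 1).
Local Notation q u := (inner_grad k u u).
Local Notation S := (scal k).
Definition normalization t : R := (4 * pi * t) `^ (- (n%:R / 2)).
Local Notation cn := normalization.

Lemma normalization_gt0 t : 0 < t -> 0 < cn t.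
Proof. by move=> t0; rewrite powR_gt0// !mulr_gt0// pi_gt0. Qed.

(** Mass and functional for pairs that need not satisfy the constraint [Zf = 1], so that the
    function and the scale can be varied freely. *)
Let Zf (u : M -> R) (t : R) : R := cn t * \int[mu]_p expR (- u p).
Let Bf (u : M -> R) (t : R) : R :=
  cn t * \int[mu]_p ((t * (S p + q u p) + u p - n%:R) * expR (- u p)).

Let S_fam : sfam (fun=> S).
Proof.
have h c := scal_repr e1 rz sz (c := c).
by move=> c; exists (pairing (Pc k z0 1 c) (ric (dx 1 c) (gam (dx 1 c) (sconst (st_domain 1 c) 2^-1)
  (Gc k z0 1 c) (Pc k z0 1 c))) (Gc k z0 1 c)) => z Oz; have := h c z Oz; rewrite pz.
Qed.

Let ig_fam (F1 F2 : R -> M -> R) : sfam F1 -> sfam F2 -> sfam (fun s => inner_grad k (F1 s) (F2 s)).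
Proof.
move=> s1 s2 c; have [a ra] := s1 c; have [b rb] := s2 c.
have h := inner_grad_repr e1 rz sz s1 s2 ra rb.
exists (pairing (Pc k z0 1 c) (dif (dx 1 c) a *m (dif (dx 1 c) b)^T) (Gc k z0 1 c)) => z Oz.
by have := h z Oz; rewrite pz.
Qed.

Let fam_smooth F : sfam F -> smooth_fun A (F 0).
Proof. by move=> sF; apply: (smooth_ffam_fun sF); rewrite normr0. Qed.

Let S_smooth : smooth_fun A S. Proof. exact: (fam_smooth S_fam). Qed.
Let ig_smooth u v : smooth_fun A u -> smooth_fun A v -> smooth_fun A (inner_grad k u v).
Proof.
move=> su sv.
exact: (fam_smooth (ig_fam (smooth_ffam_static 1 su) (smooth_ffam_static 1 sv))).
Qed.

Let B_smooth u t : smooth_fun A u ->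
  smooth_fun A (fun p => (t * (S p + q u p) + u p - n%:R) * expR (- u p)).
Proof.
move=> su; apply: smooth_funM (weight_smooth su).
apply: smooth_funD; last exact: smooth_fun_cst.
apply: smooth_funD => //; apply: smooth_funM; first exact: smooth_fun_cst.
by apply: smooth_funD => //; exact: ig_smooth.
Qed.

Let cont_exp u : smooth_fun A u -> continuous (fun p => expR (- u p)).
Proof. by move=> su; apply: smooth_fun_continuous (weight_smooth su). Qed.

Let Zf_gt0 u t : smooth_fun A u -> 0 < t -> 0 < Zf u t.
Proof.
move=> su t0; rewrite mulr_gt0 ?normalization_gt0// lt_neqAle Rintegral_ge0 ?andbT.
  apply/negP => /eqP I0.
  have := integral_eq0_ge0 hM cM rk rmu (cont_exp su) (fun p => expR_ge0 _) (esym I0) point.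
  by apply/eqP; rewrite gt_eqF// expR_gt0.
by move=> p _; exact: expR_ge0.
Qed.

Let W_Bf u t : smooth_fun A u -> W_functional dV k u t = Bf u t.
Proof.
move=> su; rewrite /Bf -(integralZ_cont hM cM rmu); last first.
  by apply: smooth_fun_continuous; exact: B_smooth.
apply: eq_integral_fun => p; rewrite (scalar_curvatureE rk) (norm_grad_sqE rk).
rewrite -/(cn t); move: (cn t) (scal k p) (inner_grad k u u p) (expR _) => c1 c2 c3 c4.
by ring.
Qed.

Let q_shift u (a : R) p : q (fun p => u p + a) p = q u p.
Proof.
rewrite /inner_grad /contraction/=; congr (pairing _ _ _).
apply/matrixP => i j; rewrite !mxE.
have E l : pderiv l ((fun p => u p + a) \o chart_inv (chart_at A p)) (chart_map (chart_at A p) p) =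
    pderiv l (u \o chart_inv (chart_at A p)) (chart_map (chart_at A p) p).
  exact: (derive_add_cst (u \o chart_inv (chart_at A p))).
by rewrite !E.
Qed.

Definition nu : R := W_functional dV k f tau.

(* Normalise an arbitrary pair by adding [ln Z] to the function, and use [ln Z <= Z - 1]. *)
Let competitor u t : smooth_fun A u -> 0 < t -> nu * Zf u t <= Bf u t + Zf u t ^+ 2 - Zf u t.
Proof.
move=> su t0; have Z0 := Zf_gt0 su t0; set Z := Zf u t in Z0 *.
pose v p := u p + ln Z.
have sv : smooth_fun A v by apply: smooth_funD => //; exact: smooth_fun_cst.
have ev p : expR (- v p) = Z^-1 * expR (- u p).
  by rewrite /v opprD expRD (expRN (ln Z)) lnK ?posrE// mulrC.
have nv : normalized dV k v t.
  rewrite /normalized -/(cn t).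
  transitivity (cn t * (Z^-1 * \int[mu]_p expR (- u p))).
    congr (_ * _); rewrite -(integralZ_cont hM cM rmu); last exact: cont_exp.
    by apply: eq_integral_fun => p; rewrite ev.
  by rewrite mulrCA -/(Zf u t) -/Z mulVf// gt_eqF.
have Bv : Bf v t = Z^-1 * Bf u t + ln Z.
  rewrite /Bf.
  have -> : \int[mu]_p ((t * (S p + q v p) + v p - n%:R) * expR (- v p)) =
     Z^-1 * \int[mu]_p ((t * (S p + q u p) + u p - n%:R) * expR (- u p))
     + (Z^-1 * ln Z) * \int[mu]_p expR (- u p).
    rewrite -!(integralZ_cont hM cM rmu); last first.
    - by apply: smooth_fun_continuous; exact: B_smooth.
    - exact: cont_exp.
    rewrite -(integralD_cont hM cM rmu); last first.
    - by apply: continuous_mul; [exact: continuous_cst_fun|exact: cont_exp].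
    - apply: continuous_mul; first exact: continuous_cst_fun.
      by apply: smooth_fun_continuous; exact: B_smooth.
    apply: eq_integral_fun => p; rewrite ev q_shift /v.
    move: (Z^-1) (ln Z) (S p) (q u p) (expR _) => c1 c2 c3 c4 c5; ring.
  rewrite mulrDr mulrCA; congr (_ + _).
  have ZE : cn t * (\int[mu]_p expR (- u p)) = Z by [].
  move: (\int[mu]_p expR (- u p)) (cn t) ZE => J c0 ZE.
  have -> : c0 * (Z^-1 * ln Z * J) = Z^-1 * (c0 * J) * ln Z by ring.
  by rewrite ZE mulVf ?mul1r// gt_eqF.
have h : nu <= Bf v t.
  rewrite -(W_Bf t sv) /nu -lee_fin; have [_ _ _ ->] := real_nu.
  by apply: ereal_inf_lbound; exists v, t.
have l1 : ln Z <= Z - 1.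
  have := @le_ln1Dx R (Z - 1); rewrite addrCA subrr addr0; apply.
  by rewrite ltrBrDl subrr.
have h2 : nu <= Z^-1 * Bf u t + (Z - 1) by apply: le_trans h _; rewrite Bv lerD2l.
have := ler_wpM2r (ltW Z0) h2.
rewrite mulrDl [Z^-1 * _]mulrC -mulrA mulVf ?gt_eqF// mulr1 => h3.
apply: le_trans h3 _; rewrite mulrBl mul1r -expr2 addrA; exact: lexx.
Qed.

Let Zf_f : Zf f tau = 1.
Proof. by case: real_nu. Qed.
Let Bf_f : Bf f tau = nu.
Proof. by rewrite /nu W_Bf. Qed.

Let vr0 p : volume_rate k z0 p = 0.
Proof.
rewrite /volume_rate (_ : contraction _ _ _ _ = 0) ?mulr0//.
by rewrite /contraction/= /z0 -[X in pairing _ X](scale0r 0) pairingZl mul0r.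
Qed.

Let int_derive F : sfam F ->
  is_derive (0 : R) 1 (fun s => \int[mu]_p F s p) (\int[mu]_p dot F p).
Proof.
move=> sF; have := integral_derive e1 rz sz hM cM rmz sF.
have -> // : \int[mu]_p (dot F p + F 0 p * volume_rate k z0 p) = \int[mu]_p dot F p.
by apply: eq_integral_fun => p; rewrite vr0 mulr0 addr0.
Qed.

(** A Lagrange multiplier rule with explicit multiplier. The function B + Z^2 - (1 + nu) Z is
    nonnegative near 0 and vanishes at 0, where Z = 1; its derivative there is B' + (1 - nu) Z'. *)
Let critical (Zs Bs : R -> R) (Z' B' e : R) : 0 < e -> Zs 0 = 1 -> Bs 0 = nu ->
  (forall t, `|t| < e -> nu * Zs t <= Bs t + Zs t ^+ 2 - Zs t) ->
  is_derive (0 : R) 1 Zs Z' -> is_derive (0 : R) 1 Bs B' -> B' + (1 - nu) * Z' = 0.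
Proof.
move=> e0 Z1 B1 le dZ dB.
pose Psi t := Bs t + (Zs t * Zs t + (- (1 + nu)) * Zs t).
apply: (@derive_at_min R Psi _ e e0).
- have dZZ := is_deriveM dZ dZ.
  have dcZ := is_derive_scale (- (1 + nu)) dZ.
  have := is_deriveD dB (is_deriveD dZZ dcZ).
  rewrite (_ : B' + _ = B' + (1 - nu) * Z'); first by [].
  by rewrite Z1 /GRing.scale/=; ring.
- by rewrite /Psi Z1 B1; ring.
- move=> t te; have := le t te; rewrite /Psi expr2 => l.
  have -> : Bs t + (Zs t * Zs t + - (1 + nu) * Zs t) = Bs t + Zs t * Zs t - Zs t - nu * Zs t by ring.
  by rewrite subr_ge0.
Qed.

Definition expectation (F : M -> R) : R := cn tau * \int[dV k]_p (F p * expR (- f p)).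
Local Notation E := expectation.

(** Only the scale is varied. The normalisation has logarithmic derivative -n/(2 tau), and the terms
    with nu cancel in [critical]. Together with [nu_expectation] this amounts to the equation n/2 +
    nu for the mean of f. *)
Lemma euler_lagrange_tau : E (fun p => S p + q f p) = n%:R / 2 / tau.
Proof.
pose I1 := \int[mu]_p ((S p + q f p) * expR (- f p)).
pose I2 := \int[mu]_p ((f p - n%:R) * expR (- f p)).
have cS : continuous (fun p => (S p + q f p) * expR (- f p)).
  apply: smooth_fun_continuous; apply: smooth_funM (weight_smooth sf).
  by apply: smooth_funD => //; exact: ig_smooth.
have cf : continuous (fun p => (f p - n%:R) * expR (- f p)).
  apply: smooth_fun_continuous; apply: smooth_funM (weight_smooth sf).
  by apply: smooth_funD => //; exact: smooth_fun_cst.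
have BE t : Bf f t = cn t * (t * I1 + I2).
  rewrite /Bf; congr (_ * _).
  rewrite /I1 /I2 -(integralZ_cont hM cM rmu)// -(integralD_cont hM cM rmu)//; last first.
    by apply: continuous_mul => //; exact: continuous_cst_fun.
  apply: eq_integral_fun => p.
  move: (S p) (q f p) (expR _) => c1 c2 c3; ring.
pose J := \int[mu]_p expR (- f p).
have dT : is_derive (0 : R) 1 (fun t : R => tau + t * 1) 1 := is_derive_affine tau 1 0.
have T0 : tau + 0 * 1 = tau by ring.
have dc := is_derive_normalization (T := fun t : R => tau + t * 1) n (eq_ind_r (fun x => 0 < x) tau0 T0) dT.
rewrite T0 mulr1 in dc.
set cn' := _ * powR _ _ in dc.
have dZ : is_derive (0 : R) 1 (fun t => Zf f (tau + t * 1)) (cn' * J).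
  have := is_deriveM dc (is_derive_cst J (0 : R) 1).
  rewrite scaler0 add0r => d.
  by have -> : cn' * J = J *: cn' by rewrite mulrC.
have dB : is_derive (0 : R) 1 (fun t => Bf f (tau + t * 1)) (cn' * (tau * I1 + I2) + cn tau * I1).
  have dI : is_derive (0 : R) 1 (fun t => (tau * I1 + I2) + t * I1) I1 := is_derive_affine _ _ 0.
  have := is_deriveM dc dI.
  have -> : (fun t => (4 * pi * (tau + t * 1)) `^ (- (n%:R / 2))) * (fun t => tau * I1 + I2 + t * I1)
     = (fun t => Bf f (tau + t * 1)).
    by apply/funext => t; rewrite BE fctE /cn; congr (_ * _); ring.
  rewrite T0 mul0r addr0 -/(cn tau) => d.
  by have -> : cn' * (tau * I1 + I2) + cn tau * I1 = cn tau *: I1 + (tau * I1 + I2) *: cn' by rewrite addrC [X in _ + X]mulrC.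
have le t : `|t| < tau -> nu * Zf f (tau + t * 1) <= Bf f (tau + t * 1) + Zf f (tau + t * 1) ^+ 2 - Zf f (tau + t * 1).
  move=> tt; apply: competitor => //; rewrite mulr1; move: tt; rewrite ltr_norml => /andP[h _]; lra.
have Z1 : Zf f (tau + 0 * 1) = 1 by rewrite T0.
have B1 : Bf f (tau + 0 * 1) = nu by rewrite T0.
have := critical tau0 Z1 B1 le dZ dB.
have cJ : cn tau * J = 1 by exact: Zf_f.
have cB : cn tau * (tau * I1 + I2) = nu by rewrite -BE.
have -> : cn' = - (n%:R / 2) / tau * cn tau by [].
rewrite -!mulrA cJ cB !mulrA => h.
have -> : E (fun p => S p + q f p) = cn tau * I1 by [].
move: h; move: (cn tau * I1) => y; move: (n%:R / 2) => m h.
have -> : m / tau = m / tau * nu + (1 - nu) * (m / tau) by ring.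
have h' : - m / tau * nu + y + (1 - nu) * (- m / tau) = 0 by rewrite -[RHS]h; ring.
have : y = - (- m / tau * nu + (1 - nu) * (- m / tau)) by apply/eqP; rewrite -subr_eq0 opprK; apply/eqP; rewrite -[RHS]h'; ring.
by move=> ->; ring.
Qed.

(** Only the function is varied, along f + s phi. No integration by parts is performed, so that the
    equation contains only first derivatives of f and can be differentiated along a family of
    metrics. *)
Lemma euler_lagrange_f phi : smooth_fun A phi ->
  E (fun p => 2 * tau * inner_grad k f phi p
      - phi p * (tau * (S p + q f p) + f p - n%:R - nu)) = 0.
Proof.
move=> sphi.
pose ft s p := f p + s * phi p.
have fft : sfam ft.
  apply: sfamD; first exact: smooth_ffam_static.
  by apply: sfamM; [exact: sfam_time|exact: smooth_ffam_static].
have ft0 : ft 0 = f by apply/funext => p; rewrite /ft mul0r addr0.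
have dft p : dot ft p = phi p.
  by apply: dot_val; exact: is_derive_affine.
have fex := sfam_expRN fft.
have fig := ig_fam fft fft.
have dig p : dot (fun s => inner_grad k (ft s) (ft s)) p = 2 * inner_grad k f phi p.
  have := dot_inner_grad e1 rz sz p fft fft.
  rewrite (_ : (fun s => inner_grad (perturb k z0 s) (ft s) (ft s)) = (fun s => inner_grad k (ft s) (ft s))); last first.
    by apply/funext => s; rewrite pz.
  move=> ->; rewrite (_ : dot ft = phi); last exact/funext.
  rewrite ft0 (inner_gradC rk phi f) /contraction/= /z0 -[X in pairing _ X](scale0r 0) pairingZl mul0r.
  by rewrite oppr0 add0r mulr_natl mulr2n.
have fk : sfam (fun s p => tau * (S p + inner_grad k (ft s) (ft s) p) + ft s p + (- n%:R)).
  apply: sfamD; last exact: sfam_cst.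
  apply: sfamD => //; apply: sfamM; first exact: sfam_cst.
  exact: sfamD.
have fB := sfamM fk fex.
have dZ : is_derive (0 : R) 1 (fun s => Zf (ft s) tau) (- E phi).
  have := is_derive_scale (cn tau) (int_derive fex).
  rewrite (_ : cn tau * _ = - E phi); first by [].
  rewrite /E -mulrN; congr (_ * _); rewrite -mulN1r -(integralZ_cont hM cM rmu); last first.
    by apply: smooth_fun_continuous; exact: smooth_funM sphi (weight_smooth sf).
  apply: eq_integral_fun => p.
  by rewrite (dot_expRN e1 p fft) dft ft0 mulN1r mulNr.
have s2 : smooth_fun A (fun p => (2 * tau) * inner_grad k f phi p + phi p).
  by apply: smooth_funD => //; apply: smooth_funM; [exact: smooth_fun_cst|exact: ig_smooth].
have dB : is_derive (0 : R) 1 (fun s => Bf (ft s) tau)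
    (E (fun p => 2 * tau * inner_grad k f phi p + phi p
       - phi p * (tau * (S p + q f p) + f p - n%:R))).
  apply: (is_derive_eq (is_derive_scale (cn tau) (int_derive fB))).
  rewrite /E; congr (_ * _); apply: eq_integral_fun => p.
  rewrite (dotM e1 p fk fex) (dot_expRN e1 p fft) dft ft0.
  have k1 : sfam (fun _ _ => - n%:R) by exact: sfam_cst.
  have k2 : sfam (fun _ _ => tau) by exact: sfam_cst.
  have k3 := sfamD S_fam fig; have k4 := sfamM k2 k3; have k5 := sfamD k4 fft.
  rewrite (dotD e1 p k5 k1) (dotD e1 p k4 fft) (dotM e1 p k2 k3) (dotD e1 p S_fam fig).
  rewrite dig dft !dot_static ft0.
  move: (inner_grad k f phi p) (S p) (q f p) (expR _) => c1 c2 c3 c4; ring.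
have := critical ltr01 (_ : Zf (ft 0) tau = 1) (_ : Bf (ft 0) tau = nu) (fun t t1 => competitor (smooth_ffam_fun fft t1) tau0) dZ dB.
rewrite ft0 => /(_ Zf_f Bf_f) <-.
have sK : smooth_fun A (fun p => 2 * tau * inner_grad k f phi p + phi p
       - phi p * (tau * (S p + q f p) + f p - n%:R)).
  apply: smooth_funD => //.
  rewrite (_ : (fun p => - _) = fun p => (-1) * (phi p * (tau * (S p + q f p) + f p - n%:R))); last first.
    by apply/funext => p; rewrite mulN1r.
  apply: smooth_funM; first exact: smooth_fun_cst.
  apply: smooth_funM => //; apply: smooth_funD; last exact: smooth_fun_cst.
  apply: smooth_funD => //; apply: smooth_funM; first exact: smooth_fun_cst.
  by apply: smooth_funD => //; exact: ig_smooth.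
rewrite /E mulrN mulrCA -mulrBr; congr (_ * _).
rewrite -mulNr -(integralZ_cont hM cM rmu); last first.
  by apply: smooth_fun_continuous; exact: smooth_funM sphi (weight_smooth sf).
rewrite -(integralD_cont hM cM rmu); last first.
- apply: continuous_mul; first exact: continuous_cst_fun.
  by apply: smooth_fun_continuous; exact: smooth_funM sphi (weight_smooth sf).
- by apply: smooth_fun_continuous; exact: smooth_funM sK (weight_smooth sf).
apply: eq_integral_fun => p.
move: (inner_grad k f phi p) (S p) (q f p) (expR _) => c1 c2 c3 c4; ring.
Qed.

Lemma expectation1 : E (fun=> 1) = 1.
Proof.
rewrite -[RHS]Zf_f /Zf /E; congr (_ * _); apply: eq_integral_fun => p.
by rewrite mul1r.
Qed.

Lemma nu_expectation : nu = E (fun p => tau * (S p + q f p) + f p - n%:R).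
Proof. by rewrite -Bf_f. Qed.
End EulerLagrange.

(** * Variation of tau *)

Lemma is_derive_locally_constant (R : realType) (F : R -> R) (D c eps : R) : 0 < eps ->
  is_derive (0 : R) 1 F D -> (forall s, `|s| < eps -> F s = c) -> D = 0.
Proof.
move=> e0 [_ <-] Fc; rewrite (near_eq_derive (g := cst c)) ?derive_cst//.
have : nbhs (0 : R) (ball (0 : R) eps) by exact: nbhsx_ballx.
by apply: filterS => s; rewrite /ball/= sub0r normrN; exact: Fc.
Qed.

Lemma smooth_funB (R : realType) (n : nat) (M : ptopologicalType) (A : smooth_atlas R n M)
    (u v : M -> R) : smooth_fun A u -> smooth_fun A v -> smooth_fun A (fun p => u p - v p).
Proof.
move=> su sv; rewrite (_ : (fun p => u p - v p) = fun p => u p + (-1) * v p).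
  by apply: smooth_funD => //; apply: smooth_funM => //; exact: smooth_fun_cst.
by apply/funext => p; rewrite mulN1r.
Qed.

Lemma smooth_funN (R : realType) (n : nat) (M : ptopologicalType) (A : smooth_atlas R n M)
    (u : M -> R) : smooth_fun A u -> smooth_fun A (fun p => - u p).
Proof.
move=> su; rewrite (_ : (fun p => - u p) = fun p => (-1) * u p).
  by apply: smooth_funM => //; exact: smooth_fun_cst.
by apply/funext => p; rewrite mulN1r.
Qed.

Ltac smooth_tac := repeat first [ assumption | apply: smooth_funB | apply: smooth_funN | apply: smooth_funD
  | apply: smooth_funM | exact: smooth_fun_cst ].

Section Expectation.
Variables (R : realType) (n : nat) (M : ptopologicalType) (A : smooth_atlas R n M).
Hypotheses (hM : hausdorff_space M) (cM : compact [set: M]).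
Variable dV : tensor2 A -> {measure set (borel M) -> \bar R}.
Hypothesis hdV : forall g' : tensor2 A, riemannian_metric g' -> riemannian_measure g' (dV g').
Variables (k : tensor2 A) (f : M -> R) (tau : R).
Hypothesis rk : riemannian_metric k.
Hypothesis sf : smooth_fun A f.
Local Notation E := (expectation dV k f tau).

Let cF F : smooth_fun A F -> continuous (fun p => F p * expR (- f p)).
Proof. by move=> sF; apply: smooth_fun_continuous (smooth_funM sF (weight_smooth sf)). Qed.

Lemma expectation_ext F G : (forall p, F p = G p) -> E F = E G.
Proof. by move=> FG; congr (E _); apply/funext. Qed.

Lemma expectationD F G : smooth_fun A F -> smooth_fun A G ->
  E (fun p => F p + G p) = E F + E G.
Proof.
move=> sF sG; rewrite /expectation -mulrDr; congr (_ * _).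
rewrite -(integralD_cont hM cM (hdV rk) (cF sF) (cF sG)).
by apply: eq_integral_fun => p; rewrite mulrDl.
Qed.

Lemma expectationZ a F : smooth_fun A F -> E (fun p => a * F p) = a * E F.
Proof.
move=> sF; rewrite /expectation mulrCA; congr (_ * _).
rewrite -(integralZ_cont hM cM (hdV rk) a (cF sF)).
by apply: eq_integral_fun => p; rewrite mulrA.
Qed.

Lemma expectationB F G : smooth_fun A F -> smooth_fun A G ->
  E (fun p => F p - G p) = E F - E G.
Proof.
move=> sF sG; rewrite -[in RHS]mulN1r -expectationZ// -expectationD//; last by smooth_tac.
by apply: expectation_ext => p; rewrite mulN1r.
Qed.

Lemma expectation_lin a F G : smooth_fun A F -> smooth_fun A G ->
  E (fun p => a * F p + G p) = a * E F + E G.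
Proof. by move=> sF sG; rewrite expectationD ?expectationZ//; smooth_tac. Qed.

Lemma le_expectation F G : 0 < tau -> smooth_fun A F -> smooth_fun A G ->
  (forall p, F p <= G p) -> E F <= E G.
Proof.
move=> t0 sF sG FG; rewrite ler_wpM2l//; first exact: ltW (normalization_gt0 n t0).
apply: (le_integral_cont hM cM (hdV rk) (cF sF) (cF sG)) => p.
by rewrite ler_wpM2r// expR_ge0.
Qed.

Lemma expectation_eq0 F : 0 < tau -> smooth_fun A F -> (forall p, 0 <= F p) ->
  E F = 0 -> forall p, F p = 0.
Proof.
move=> t0 sF F0 /eqP; rewrite mulf_eq0 gt_eqF ?normalization_gt0//= => /eqP I0 p.
have := integral_eq0_ge0 hM cM rk (hdV rk) (cF sF) _ I0 p.
move=> /(_ _)/eqP; rewrite mulf_eq0 [expR _ == 0]gt_eqF ?expR_gt0// orbF => h.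
by apply/eqP/h => q; rewrite mulr_ge0// expR_ge0.
Qed.
End Expectation.

Section Soliton.
Variables (R : realType) (n : nat) (M : ptopologicalType) (A : smooth_atlas R n M).
Variables (k : tensor2 A) (f : M -> R) (tau : R).
Hypothesis rk : riemannian_metric k.
Hypothesis sol : gradient_shrinking_soliton k f tau.

Lemma soliton_contraction X p : contraction k (ricci_tensor k) X p +
  contraction k (hessian_tensor k f) X p = (1 / (2 * tau)) * contraction k k X p.
Proof.
rewrite /contraction/= -pairingDl -pairingZl; congr (pairing _ _ _).
by apply/matrixP => i j; rewrite !mxE; apply: sol; exact: chart_atP.
Qed.

Lemma soliton_trace p : scal k p + laplacian k f p = n%:R / 2 / tau.
Proof.
by rewrite soliton_contraction (contraction_metric rk) div1r invfM mulrC mulrA.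
Qed.

Lemma soliton_ricci_grad p :
  ricci_grad k f f p + hess_grad k f f f p = (1 / (2 * tau)) * inner_grad k f f p.
Proof. by rewrite soliton_contraction contractionC. Qed.
End Soliton.

(** * The soliton identities and the cancellation *)

Section Main.
Variables (R : realType) (n : nat) (M : ptopologicalType) (A : smooth_atlas R n M).
Variable dV : tensor2 A -> {measure set (borel M) -> \bar R}.
Variables (g h : tensor2 A) (eps : R) (fs : R -> M -> R) (taus : R -> R).
Hypothesis n_gt0 : (0 < n)%N.
Hypotheses (hM : hausdorff_space M) (cM : compact [set: M]).
Hypothesis hdV : forall g' : tensor2 A, riemannian_metric g' -> riemannian_measure g' (dV g').
Hypothesis sh : smooth_sym_tensor h.
Hypothesis eps0 : 0 < eps.
Hypothesis rgs : forall s : R, `|s| < eps -> riemannian_metric (perturb g h s).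
Hypothesis sfam_fs : smooth_ffam A eps fs.
Hypothesis nu_s : forall s : R, `|s| < eps -> realizes_nu dV (perturb g h s) (fs s) (taus s).
Local Notation gs := (perturb g h).
Local Notation f := (fs 0).
Local Notation tau := (taus 0).
Hypothesis sol : gradient_shrinking_soliton g f tau.
Variable dtau : R.
Hypothesis dtauP : is_derive (0 : R) 1 taus dtau.

Let n0 : `|0 : R| < eps. Proof. exact: norm0_lt. Qed.
Let rg : riemannian_metric g. Proof. exact: (metric0 eps0 rgs). Qed.
Let rmu : riemannian_measure g (dV g). Proof. exact: hdV. Qed.
Let tau_gt0 : 0 < tau. Proof. by have [] := nu_s n0. Qed.
Let sfs s : `|s| < eps -> smooth_fun A (fs s).
Proof. by move=> se; have [] := nu_s se. Qed.
Let sf : smooth_fun A f. Proof. exact: sfs. Qed.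
Let real0 : realizes_nu dV g f tau. Proof. by have := nu_s n0; rewrite perturb0. Qed.

Local Notation E := (expectation dV g f tau).
Local Notation n2 := (n%:R / 2 : R).
Local Notation S := (scal g).
Local Notation q := (inner_grad g f f).
Local Notation Lap := (laplacian g f).
Let eta := dot fs.
Let T := contraction g h g.
Let hR := contraction g (ricci_tensor g) h.
Let hH := contraction g h (hessian_tensor g f).
Let hq := contraction g h (gradient_dyad f f).
Let ipe := inner_grad g f eta.
Let Sf s := scal (gs s).
Let qf s := inner_grad (gs s) (fs s) (fs s).
Let dS := dot Sf.
Let ipf s := inner_grad (gs s) (fs s) f.
(** The logarithmic derivative at s = 0 of the measure (4 pi tau)^(-n/2) e^-f dV. *)
Let xi p := 2^-1 * T p - eta p + (- n2 / tau * dtau).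

Let stf u : smooth_fun A u -> smooth_ffam A eps (fun=> u).
Proof. exact: smooth_ffam_static. Qed.
Let fam0 (F : R -> M -> R) : smooth_ffam A eps F -> smooth_fun A (F 0).
Proof. by move=> sF; exact: smooth_ffam_fun sF n0. Qed.
Let fSf : smooth_ffam A eps Sf.
Proof. by move=> c; eexists; exact: (scal_repr eps0 rgs sh (c := c)). Qed.
Let fig F1 F2 : smooth_ffam A eps F1 -> smooth_ffam A eps F2 ->
  smooth_ffam A eps (fun s => inner_grad (gs s) (F1 s) (F2 s)).
Proof.
move=> s1 s2 c; have [a ra] := s1 c; have [b rb] := s2 c.
by eexists; exact: (inner_grad_repr eps0 rgs sh s1 s2 ra rb).
Qed.
Let fqf : smooth_ffam A eps qf. Proof. exact: fig. Qed.
Let fipf : smooth_ffam A eps ipf. Proof. by apply: fig => //; exact: stf. Qed.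
Let sS : smooth_fun A S. Proof. by have := fam0 fSf; rewrite /Sf perturb0. Qed.
Let sig u v : smooth_fun A u -> smooth_fun A v -> smooth_fun A (inner_grad g u v).
Proof. by move=> su sv; have := fam0 (fig (stf su) (stf sv)); rewrite perturb0. Qed.
Let sq : smooth_fun A q. Proof. exact: sig. Qed.
Let seta : smooth_fun A eta. Proof. exact: (dot_smooth eps0). Qed.
Let sipe : smooth_fun A ipe. Proof. exact: sig. Qed.
Let sdS : smooth_fun A dS. Proof. exact: (dot_smooth eps0). Qed.
Let sLap : smooth_fun A Lap.
Proof.
have fl : smooth_ffam A eps (fun s => laplacian (gs s) f).
  by move=> c; have [a ra] := stf sf c; eexists; exact: (laplacian_repr eps0 rgs sh (stf sf) ra).
by have := fam0 fl; rewrite perturb0.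
Qed.
Let sHH : smooth_fun A (hess_hess g f).
Proof.
have fl : smooth_ffam A eps (fun s => hess_hess (gs s) f).
  by move=> c; have [a ra] := stf sf c; eexists; exact: (hess_hess_repr eps0 rgs sh (stf sf) ra).
by have := fam0 fl; rewrite perturb0.
Qed.
Let sHq : smooth_fun A (hess_grad g f f f).
Proof.
have fl : smooth_ffam A eps (fun s => hess_grad (gs s) f f f).
  move=> c; have [a ra] := stf sf c; eexists.
  exact: (hess_grad_repr eps0 rgs sh (stf sf) (stf sf) (stf sf) ra ra ra).
by have := fam0 fl; rewrite perturb0.
Qed.
Let sRq : smooth_fun A (ricci_grad g f f).
Proof.
have fl : smooth_ffam A eps (fun s => ricci_grad (gs s) f f).
  move=> c; have [a ra] := stf sf c; eexists.
  exact: (ricci_grad_repr eps0 rgs sh (stf sf) (stf sf) ra ra).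
by have := fam0 fl; rewrite perturb0.
Qed.
Let sT : smooth_fun A T.
Proof.
have fl : smooth_ffam A eps (fun s => contraction (gs s) h (gs s)).
  by move=> c; eexists; exact: (h_trace_repr eps0 rgs sh (c := c)).
by have := fam0 fl; rewrite perturb0.
Qed.
Let shR : smooth_fun A hR.
Proof.
have fl : smooth_ffam A eps (fun s => contraction (gs s) (ricci_tensor (gs s)) h).
  by move=> c; eexists; exact: (ricci_h_repr eps0 rgs sh (c := c)).
by have := fam0 fl; rewrite perturb0.
Qed.
Let shH : smooth_fun A hH.
Proof.
have fl : smooth_ffam A eps (fun s => contraction (gs s) h (hessian_tensor (gs s) f)).
  by move=> c; have [a ra] := stf sf c; eexists; exact: (h_hess_repr eps0 rgs sh (stf sf) ra).
by have := fam0 fl; rewrite perturb0.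
Qed.
Let shq : smooth_fun A hq.
Proof.
have fl : smooth_ffam A eps (fun s => contraction (gs s) h (gradient_dyad f f)).
  move=> c; have [a ra] := stf sf c; eexists.
  exact: (h_dyad_repr eps0 rgs sh (stf sf) (stf sf) ra ra).
by have := fam0 fl; rewrite perturb0.
Qed.
Let sxi : smooth_fun A xi. Proof. by rewrite /xi; smooth_tac. Qed.

Let ED := expectationD hM cM hdV tau rg sf.
Let EB := expectationB hM cM hdV tau rg sf.
Let EZ := expectationZ hM cM hdV tau rg sf.
Let Eext := @expectation_ext R n M A dV g f tau.

Let E0 F : \int[dV g]_p (F p * expR (- f p)) = 0 -> E F = 0.
Proof. by move=> I0; rewrite /expectation I0 mulr0. Qed.

Let E1 : E (fun=> 1) = 1. Proof. exact: (expectation1 real0). Qed.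
Let Ecst a : E (fun=> a) = a.
Proof. by rewrite -[RHS]mulr1 -[in RHS]E1 -EZ; [apply: Eext => p; rewrite mulr1|exact: smooth_fun_cst]. Qed.

Let by_parts phi : smooth_fun A phi -> E (fun p => inner_grad g f phi p + phi p * (Lap p - q p)) = 0.
Proof.
move=> sp; rewrite -[RHS](E0 (weighted_laplacian eps0 rgs sh hM cM sf rmu sp)).
by apply: Eext => p; ring.
Qed.

Let trace p : S p + Lap p = n2 / tau. Proof. exact: (soliton_trace rg sol). Qed.

Let nu0 := nu dV g f tau.
Let Eqs : E (fun p => S p + q p) = n2 / tau.
Proof. exact: (euler_lagrange_tau hM cM hdV rg real0). Qed.

Let Ef : E f = nu0 + n2.
Proof.
have := nu_expectation hM cM hdV rg real0.
rewrite -/nu0 EB; [|by smooth_tac|by smooth_tac].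
rewrite ED; [|by smooth_tac|by smooth_tac].
rewrite EZ; [|by smooth_tac]; rewrite Eqs Ecst => ->.
by field; rewrite gt_eqF.
Qed.

(* The Euler-Lagrange equation holds pointwise: test its weak form with its own left-hand side. *)
Let pointwise p : tau * (S p + q p) = f p - nu0.
Proof.
pose phi p := tau * (S p + q p) - f p + nu0.
have sphi : smooth_fun A phi by rewrite /phi; smooth_tac.
have el := euler_lagrange_f hM cM hdV rg real0 sphi.
have wl := by_parts sphi.
have sip := sig sf sphi.
have : E (fun p => phi p * phi p) = 0.
  (* Subtracting 2 tau times the integration by parts removes the gradient term. The traced soliton
     equation removes the Laplacian, and what is left is the square of [phi]. *)
  transitivity (E (fun p => (2 * tau * inner_grad g f phi p
      - phi p * (tau * (S p + q p) + f p - n%:R - nu0))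
      + (- (2 * tau)) * (inner_grad g f phi p + phi p * (Lap p - q p)))).
    apply: Eext => x; have -> : Lap x = n2 / tau - S x by rewrite -(trace x) addrC addKr.
    move: (inner_grad g f phi x) => c1; rewrite /phi.
    move: (S x) (q x) (f x) nu0 => c2 c3 c4 c5.
    by field; rewrite gt_eqF.
  rewrite ED; [|by smooth_tac|by smooth_tac].
  by rewrite EZ; [rewrite el wl mulr0 addr0|smooth_tac].
move/(expectation_eq0 hM cM hdV rg sf tau_gt0 (smooth_funM sphi sphi) (fun x => _)).
have sq0 x : 0 <= phi x * phi x by rewrite -expr2 sqr_ge0.
move=> /(_ sq0 p)/eqP; rewrite mulf_eq0 orbb /phi => /eqP h0.
have -> : tau * (S p + q p) = tau * (S p + q p) - f p + nu0 + (f p - nu0) by ring.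
by rewrite h0 add0r.
Qed.

Let L p := Lap p - q p.
Let sL : smooth_fun A L. Proof. by rewrite /L; smooth_tac. Qed.
(** By [Ef] the constant is the mean of f: this is the eigenvalue equation of the drift Laplacian,
    obtained by combining [trace] with [pointwise]. *)
Let LE p : L p = (n2 + nu0 - f p) / tau.
Proof.
have -> : L p = n2 / tau - (S p + q p) by rewrite -(trace p) /L; ring.
have := pointwise p; move=> /(congr1 (fun y => tau^-1 * y)).
rewrite mulrA mulVf ?gt_eqF// mul1r => ->; rewrite mulrC; ring.
Qed.

Lemma mean_scalar_neq0 : E S != 0.
Proof.
apply/eqP => ES0; have t0 : tau != 0 by rewrite gt_eqF.
have m0 : 0 < n2 by rewrite divr_gt0// ltr0n.
have Eq : E q = n2 / tau by rewrite -Eqs ED// ES0 add0r.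
have EL : E L = 0.
  rewrite -[RHS](by_parts (@smooth_fun_cst R n M A 1)); apply: Eext => p.
  by rewrite inner_grad_cst add0r mul1r.
have Elap : E Lap = n2 / tau.
  have -> : E Lap = E (fun p => L p + q p) by apply: Eext => p; rewrite /L subrK.
  by rewrite ED// EL add0r.
(* One factor [L] is affine in f with slope -1/tau, so the second moment reduces to integration by
   parts against f. *)
have ELL : E (fun p => L p * L p) = E q / tau.
  have sip := sig sf sf.
  have h1 : E (fun p => q p + f p * L p) = 0 := by_parts sf.
  transitivity (E (fun p => (n2 + nu0) / tau * L p + tau^-1 * (q p - (q p + f p * L p)))).
    by apply: Eext => p; rewrite {1}LE; field.
  rewrite ED; [|by smooth_tac|by smooth_tac].
  rewrite EZ// EL mulr0 add0r EZ; last by smooth_tac.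
  by rewrite EB; [rewrite h1 subr0 mulrC|smooth_tac|smooth_tac].
have EqL : E (fun p => 2 * hess_grad g f f f p + q p * L p) = 0.
  rewrite -[RHS](by_parts sq); apply: Eext => p.
  by rewrite (inner_grad_inner eps0 rgs sh sf).
(* The soliton equation replaces the Ricci term of Bochner's formula by q/(2 tau) minus the Hessian
   on grad f. The Hessian terms then add up to the integrand of [EqL], which has mean 0. *)
have EHH : E (hess_hess g f) = n2 / (2 * tau ^+ 2).
  have := E0 (weighted_bochner eps0 rgs sh hM cM sf rmu (@smooth_fun_cst R n M A 1)).
  have -> : E (fun p => (hess_hess g f p - Lap p * Lap p + ricci_grad g f f p) * 1
    + (hess_grad g f f (fun=> 1) p - 1 * hess_grad g f f f p)
    - Lap p * (inner_grad g f (fun=> 1) p - 1 * q p)) =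
    E (fun p => (hess_hess g f p - L p * L p) + ((1 / (2 * tau)) * q p
      - (2 * hess_grad g f f f p + q p * L p))).
    apply: Eext => p; rewrite inner_grad_cst hess_grad_cst -(soliton_ricci_grad rg sol p) /L.
    by ring.
  rewrite ED; [|by smooth_tac|by smooth_tac].
  rewrite EB; [|by smooth_tac|by smooth_tac].
  rewrite EB; [|by smooth_tac|by smooth_tac].
  rewrite EqL EZ// ELL Eq => h1.
  by apply/eqP; rewrite -subr_eq0 -[X in _ == X]h1; apply/eqP; field.
have trle p : Lap p * Lap p <= n%:R * hess_hess g f p.
  have dp := chart_atP A p.
  have Ux : (chart_map (chart_at A p) @` chart_dom (chart_at A p)) (chart_map (chart_at A p) p) by exact: chart_image.
  have hs : (hessian_tensor g f (chart_at A p) p)^T = hessian_tensor g f (chart_at A p) p.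
    have [a ra] := stf sf (chart_at A p).
    have := hessian_repr eps0 rgs sh ra (st0 eps0 Ux); rewrite /= perturb0 chart_mapK// => ->.
    rewrite -evmx_tr; congr (evmx _ _); apply: hess_sym; first by move=> *; exact: dxC.
    exact: (Gc_sym eps0 rgs sh).
  rewrite -expr2.
  exact: (pairing_trace_le (metric_sym rg dp) (metric_posdef rg dp) hs).
(* The second moment of Lap f is at most n times the mean of |Hess f|^2, that is (n/2 tau)^2, which
   is the square of its mean. *)
have var0 : E (fun p => (Lap p - n2 / tau) * (Lap p - n2 / tau)) <= 0.
  have -> : E (fun p => (Lap p - n2 / tau) * (Lap p - n2 / tau)) =
      E (fun p => Lap p * Lap p + ((- (2 * n2 / tau)) * Lap p + (n2 / tau) * (n2 / tau))).
    by apply: Eext => p; ring.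
  rewrite ED; [|by smooth_tac|by smooth_tac].
  rewrite ED; [|by smooth_tac|by smooth_tac].
  rewrite (EZ (- (2 * n2 / tau)) sLap) Elap Ecst.
  have : E (fun p => Lap p * Lap p) <= n%:R * E (hess_hess g f).
    rewrite -EZ//; apply: (le_expectation hM cM hdV rg sf tau_gt0) => //; smooth_tac.
  rewrite EHH.
  have -> : n%:R * (n2 / (2 * tau ^+ 2)) = (n2 / tau) * (n2 / tau) by field.
  have -> : - (2 * n2 / tau) * (n2 / tau) = - (2 * ((n2 / tau) * (n2 / tau))) by field.
  move: ((n2 / tau) * (n2 / tau)) => y; lra.
have lapc p : Lap p = n2 / tau.
  have sq0 x : 0 <= (Lap x - n2 / tau) * (Lap x - n2 / tau) by rewrite -expr2 sqr_ge0.
  have sv : smooth_fun A (fun p => (Lap p - n2 / tau) * (Lap p - n2 / tau)) by smooth_tac.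
  have Ev0 : E (fun p => (Lap p - n2 / tau) * (Lap p - n2 / tau)) = 0.
    have := le_expectation hM cM hdV rg sf tau_gt0 (@smooth_fun_cst R n M A 0) sv sq0.
    by rewrite Ecst => Ege; apply/eqP; rewrite eq_le var0 Ege.
  have := expectation_eq0 hM cM hdV rg sf tau_gt0 sv sq0 Ev0 p.
  by move/eqP; rewrite mulf_eq0 orbb subr_eq0 => /eqP.
(* The unweighted integral of the positive constant would be 0. Positivity of n enters here, through
   [m0]. *)
have I0 := laplacian_integral eps0 rgs sh hM cM sf rmu.
have lge p : 0 <= Lap p by rewrite lapc divr_ge0// ltW.
have := integral_eq0_ge0 hM cM rg rmu (smooth_fun_continuous sLap) lge I0 point.
by apply/eqP; rewrite lapc mulf_neq0 ?invr_eq0// gt_eqF.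
Qed.

Let J F s : R := expectation dV (gs s) (fs s) (taus s) (F s).
Let rmus s : `|s| < eps -> riemannian_measure (gs s) (dV (gs s)).
Proof. by move=> se; apply: hdV; exact: rgs. Qed.

Let dJ F : smooth_ffam A eps F ->
  is_derive (0 : R) 1 (J F) (E (fun p => dot F p + F 0 p * xi p)).
Proof.
move=> sF; have se := sfam_expRN sfam_fs; have sFe := sfamM sF se.
have d1 := integral_derive eps0 rgs sh hM cM rmus sFe.
have d2 := is_derive_normalization n tau_gt0 dtauP.
have := is_deriveM d2 d1; rewrite perturb0 => d3.
have sK : smooth_fun A (fun p => dot F p + F 0 p * (2^-1 * T p - eta p)).
  have h1 : smooth_fun A (dot F) := dot_smooth eps0 sF.
  have h2 := fam0 sF; rewrite /T -/T; smooth_tac.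
have s0 := fam0 sF.
apply: (is_derive_eq d3).
transitivity (E (fun p => (dot F p + F 0 p * (2^-1 * T p - eta p)) + (- n2 / tau * dtau) * F 0 p)); last first.
  by apply: Eext => p; rewrite /xi; ring.
rewrite ED; [|by []|by smooth_tac]; rewrite EZ//; congr (_ + _); last first.
  by rewrite [LHS]mulrC /expectation /normalization mulrA.
rewrite /expectation /normalization; congr (_ * _); apply: eq_integral_fun => p.
rewrite (dotM eps0 p sF se) (dot_expRN eps0 p sfam_fs) /volume_rate perturb0 -/T -/eta -/(T p) -/(eta p).
by ring.
Qed.

Let sfam_cst1 : smooth_ffam A eps (fun _ _ => 1). Proof. exact: sfam_cst. Qed.
Let fq : smooth_ffam A eps (fun s p => Sf s p + qf s p). Proof. exact: sfamD. Qed.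
Let ffq : smooth_ffam A eps (fun s p => f p * (Sf s p + qf s p)).
Proof. by apply: sfamM => //; exact: stf. Qed.
Let ff : smooth_ffam A eps (fun s p => f p * fs s p).
Proof. by apply: sfamM => //; exact: stf. Qed.

Let dqf p : dot qf p = - hq p + 2 * ipe p.
Proof.
rewrite /qf (dot_inner_grad eps0 rgs sh p sfam_fs sfam_fs) -/eta (inner_gradC rg eta f).
by rewrite -/hq -/ipe -/(hq p) -/(ipe p); ring.
Qed.

Let dipf p : dot ipf p = - hq p + ipe p.
Proof.
rewrite /ipf (dot_inner_grad eps0 rgs sh p sfam_fs (stf sf)) -/eta (inner_gradC rg eta f).
have -> : dot (fun=> f) = fun=> 0 by apply/funext => x; exact: dot_static.
by rewrite inner_grad_cst addr0.
Qed.

(* The derivatives at s = 0 of the constraint, of the tau-equation, and of the f-equation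
   tested with the fixed function f. *)
Let id1 : E xi = 0.
Proof.
have := is_derive_locally_constant eps0 (dJ sfam_cst1) (c := 1) => hh.
rewrite -[RHS]hh; last by move=> s se; exact: (expectation1 (nu_s se)).
by apply: Eext => p; rewrite dot_static add0r mul1r.
Qed.

Let Sf0 : Sf 0 = S. Proof. by rewrite /Sf perturb0. Qed.
Let qf0 : qf 0 = q. Proof. by rewrite /qf perturb0. Qed.
Let ipf0 : ipf 0 = q. Proof. by rewrite /ipf perturb0. Qed.

Let id2 : E (fun p => dS p + (- hq p + 2 * ipe p) + (S p + q p) * xi p) = - n2 * dtau / tau ^+ 2.
Proof.
have t0 : tau != 0 by rewrite gt_eqF.
have dJq := dJ fq.
have dd := is_deriveM dtauP dJq.
have hh := is_derive_locally_constant eps0 dd (c := n2).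
have := hh _; rewrite /J Sf0 qf0 perturb0 Eqs.
set X := E _ => hh'.
have -> : E (fun p => dS p + (- hq p + 2 * ipe p) + (S p + q p) * xi p) = X.
  by apply: Eext => p; rewrite (dotD eps0 p fSf fqf) dqf.
have e : tau * X + (n2 / tau) * dtau = 0.
  apply: hh' => s se; rewrite fctE (euler_lagrange_tau hM cM hdV (rgs se) (nu_s se)).
  by have [_ ts _ _] := nu_s se; field; rewrite gt_eqF.
apply: (mulfI t0); apply/eqP; rewrite -subr_eq0 -[X in _ == X]e; apply/eqP; by field.
Qed.

Let id3 : E (fun p => 2 * dtau * q p + 2 * tau * ((- hq p + ipe p) + q p * xi p)
   - dtau * (f p * (S p + q p))
   - tau * (f p * (dS p + (- hq p + 2 * ipe p)) + f p * (S p + q p) * xi p)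
   - (f p * eta p + f p * f p * xi p)
   + E f * (eta p + f p * xi p) + (n2 + E f) * (f p * xi p)) = 0.
Proof.
have elf s : `|s| < eps -> 2 * (taus s * J ipf s) + ((- 1) * (taus s * J (fun s p => f p * (Sf s p + qf s p)) s)
   + ((- 1) * J (fun s p => f p * fs s p) s + (n2 + J fs s) * J (fun=> f) s)) = 0.
  move=> se; have sfs' := sfs se; have rs := rgs se.
  have S1 : smooth_fun A (Sf s) := smooth_ffam_fun fSf se.
  have S2 : smooth_fun A (qf s) := smooth_ffam_fun fqf se.
  have S3 : smooth_fun A (ipf s) := smooth_ffam_fun fipf se.
  have D1 := expectationD hM cM hdV (taus s) rs sfs'.
  have Z1 := expectationZ hM cM hdV (taus s) rs sfs'.
  have el := euler_lagrange_f hM cM hdV rs (nu_s se) sf.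
  have nuE := nu_expectation hM cM hdV rs (nu_s se).
  set nus := nu _ _ _ _ in el nuE.
  (* The entropy at time s is replaced by the mean of f(s), which is differentiable by [dJ]; the
     f-equation then involves only quantities with known derivatives. *)
  have nuE2 : nus = J fs s - n2.
    rewrite nuE.
    transitivity (expectation dV (gs s) (fs s) (taus s) (fun p => (taus s * (Sf s p + qf s p) + fs s p) + (- n%:R) * 1)).
      by congr (expectation _ _ _ _ _); apply/funext => p; rewrite mulr1.
    rewrite D1; [|by smooth_tac|by smooth_tac]; rewrite D1; [|by smooth_tac|by smooth_tac].
    rewrite !Z1; [|by smooth_tac|by smooth_tac].
    rewrite (euler_lagrange_tau hM cM hdV rs (nu_s se)) (expectation1 (nu_s se)).
    by have [_ ts _ _] := nu_s se; rewrite /J; field; rewrite gt_eqF.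
  rewrite -[RHS]el.
  transitivity (expectation dV (gs s) (fs s) (taus s) (fun p => (2 * taus s) * ipf s p
     + ((- taus s) * (f p * (Sf s p + qf s p)) + ((- 1) * (f p * fs s p) + (n%:R + nus) * f p)))).
    rewrite !D1; try by smooth_tac.
    rewrite !Z1; try by smooth_tac.
    rewrite nuE2 /J.
    move: (expectation _ _ _ _ _) => y1; move: (expectation _ _ _ _ _) => y2.
    move: (expectation _ _ _ _ _) => y3; move: (expectation _ _ _ _ _) => y4.
    try (move: (expectation _ _ _ _ _) => y5); by field.
  congr (expectation _ _ _ _ _); apply/funext => p; rewrite -/(ipf s p) -/(Sf s p) -/(qf s p).
  by ring.
have d1 := is_derive_scale 2 (is_deriveM dtauP (dJ fipf)).
have d2 := is_derive_scale (- 1) (is_deriveM dtauP (dJ ffq)).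
have d3 := is_derive_scale (- 1) (dJ ff).
have d4 := is_deriveM (is_deriveD (is_derive_cst n2 (0 : R) 1) (dJ sfam_fs)) (dJ (stf sf)).
have hh := is_derive_locally_constant eps0 (is_deriveD d1 (is_deriveD d2 (is_deriveD d3 d4))) (c := 0) elf.
have J0 F G : F 0 = G -> J F 0 = E G by move=> <-; rewrite /J perturb0.
have aE : (cst n2 + J fs) 0 = n2 + E f by rewrite -(J0 fs f).
have F1 : E (fun p => dot ipf p + ipf 0 p * xi p) = E (fun p => (- hq p + ipe p) + q p * xi p).
  by apply: Eext => p; rewrite dipf ipf0.
have F2 : E (fun p => dot (fun s p => f p * (Sf s p + qf s p)) p + f p * (Sf 0 p + qf 0 p) * xi p) =
   E (fun p => f p * (dS p + (- hq p + 2 * ipe p)) + f p * (S p + q p) * xi p).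
  apply: Eext => p; rewrite (dotM eps0 p (stf sf) fq) dot_static mul0r add0r.
  by rewrite (dotD eps0 p fSf fqf) dqf Sf0 qf0.
have F3 : E (fun p => dot (fun s p => f p * fs s p) p + f p * f p * xi p) =
   E (fun p => f p * eta p + f p * f p * xi p).
  by apply: Eext => p; rewrite (dotM eps0 p (stf sf) sfam_fs) dot_static mul0r add0r.
have F4 : E (fun p => dot (fun=> f) p + f p * xi p) = E (fun p => f p * xi p).
  by apply: Eext => p; rewrite dot_static add0r.
rewrite F1 F2 F3 F4 aE (J0 ipf q ipf0) in hh.
rewrite (J0 (fun s p => f p * (Sf s p + qf s p)) (fun p => f p * (S p + q p))) in hh; last first.
  by apply/funext => p; rewrite Sf0 qf0.
rewrite (J0 (fun=> f) f erefl) in hh.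
set a := E f in hh *.
transitivity (E (fun p => (2 * dtau) * q p + ((2 * tau) * ((- hq p + ipe p) + q p * xi p)
   + ((- dtau) * (f p * (S p + q p))
   + ((- tau) * (f p * (dS p + (- hq p + 2 * ipe p)) + f p * (S p + q p) * xi p)
   + ((- 1) * (f p * eta p + f p * f p * xi p)
   + (a * (eta p + f p * xi p) + (n2 + a) * (f p * xi p)))))))).
  by apply: Eext => p; ring.
have Elin := expectation_lin hM cM hdV tau rg sf.
do 6 (rewrite Elin; [|by smooth_tac|by smooth_tac]).
rewrite EZ; last by smooth_tac.
rewrite -[RHS]hh -/eta /GRing.scale/=; clear hh.
move: (E (fun p => (- hq p + ipe p) + q p * xi p)) (E (fun p => f p * (S p + q p))) => y1 y2.
move: (E (fun p => f p * (dS p + (- hq p + 2 * ipe p)) + f p * (S p + q p) * xi p)) => y3.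
move: (E (fun p => f p * eta p + f p * f p * xi p)) (E (fun p => eta p + f p * xi p)) => y4 y5.
move: (E (fun p => f p * xi p)) (E q) a => y6 y7 y8.
by ring.
Qed.

(** The variation formula with test function 1, and next with f, supplies the two means in which the
    variation of scalar curvature occurs: alone in [id2] and multiplied by f in [id3]. *)
Let var1 : E (fun p => (dS p + hR p) - (hq p - hH p) + T p * (q p - Lap p)) = 0.
Proof.
rewrite -[RHS](E0 (weighted_variation eps0 rgs sh hM cM sf rmu (@smooth_fun_cst R n M A 1))).
apply: Eext => p; rewrite -/Sf -/dS -/hR.
have z1 : gradient_dyad f (fun=> 1) (chart_at A p) p = 0 :> 'M[R]_n.
  by apply/matrixP => i j; rewrite !mxE /pderiv derive_cst mulr0.
have z2 : gradient_dyad (fun=> 1) f (chart_at A p) p = 0 :> 'M[R]_n.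
  by apply/matrixP => i j; rewrite !mxE /pderiv derive_cst mul0r.
have z3 : hessian_tensor g (fun=> 1) (chart_at A p) p = 0 :> 'M[R]_n.
  apply/matrixP => i j; rewrite !mxE /hessian.
  have pz l : pderiv l ((fun=> 1 : R) \o chart_inv (chart_at A p)) = fun=> 0.
    by apply/funext => x; rewrite /pderiv derive_cst.
  rewrite pz /pderiv derive_cst big1 ?subr0// => l _.
  by rewrite -/(pderiv l _ _) pz mulr0.
rewrite /inner_grad /laplacian /contraction/= z1 z2 z3.
have zl X Y : pairing X (0 : 'M[R]_n) Y = 0 by rewrite -[X in pairing _ X](scale0r 0) pairingZl mul0r.
have zr X Y : pairing X Y (0 : 'M[R]_n) = 0 by rewrite -[X in pairing _ _ X](scale0r 0) pairingZr mul0r.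
rewrite !zl !zr; have -> : hq p = pairing (invmx (g (chart_at A p) p)) (h (chart_at A p) p)
  (gradient_dyad f f (chart_at A p) p) by [].
have -> : hH p = pairing (invmx (g (chart_at A p) p)) (h (chart_at A p) p)
  (hessian_tensor g f (chart_at A p) p) by [].
have -> : T p = pairing (invmx (g (chart_at A p) p)) (h (chart_at A p) p)
  (g (chart_at A p) p) by [].
move: (pairing _ _ (gradient_dyad f f _ p)) (pairing _ (h _ p) (hessian_tensor g f _ p)) => x1 x2.
move: (pairing _ (h _ p) _) (pairing _ (hessian_tensor g f _ p) _) => x3 x4.
move: (pairing _ _ _) (dS p) (hR p) => x5 x6 x7; ring.
Qed.

Let varf : E (fun p => (dS p + hR p) * f p - (hH p - 2 * hq p + f p * (hq p - hH p))
   + T p * (Lap p - 2 * q p + f p * (q p - Lap p))) = 0.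
Proof.
rewrite -[RHS](E0 (weighted_variation eps0 rgs sh hM cM sf rmu sf)).
apply: Eext => p; rewrite -/Sf -/dS -/hR -/hq -/hH -/T -/(hq p) -/(hH p) -/(T p) -/(hR p) -/(dS p).
by ring.
Qed.

Let bpeta : E (fun p => ipe p + eta p * L p) = 0. Proof. exact: by_parts. Qed.
Let bpf : E (fun p => q p + f p * L p) = 0. Proof. exact: by_parts. Qed.
(** Integration by parts against the product f eta removes the term f <grad f, grad eta> of [id3],
    at the price of q eta and f eta L. *)
Let bpfeta : E (fun p => f p * ipe p + eta p * q p + f p * eta p * L p) = 0.
Proof.
have sfe : smooth_fun A (fun p => f p * eta p) by smooth_tac.
rewrite -[RHS](by_parts sfe); apply: Eext => p.
by rewrite (inner_gradM g f p sf seta).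
Qed.

Let solh p : hR p + hH p = T p / (2 * tau).
Proof.
have := soliton_contraction sol h p.
rewrite (contractionC rg (hessian_tensor g f) h) (contractionC rg g h) -/(hR p) -/(hH p) -/(T p) => ->.
by rewrite mulrC div1r.
Qed.

Lemma dtau_mean : tau * E hR = dtau * E S.
Proof.
have t0 : tau != 0 by rewrite gt_eqF.
pose af := E f; have nuE : nu0 = af - n2 by rewrite /af Ef addrK.
suff : E (fun p => tau * hR p + (- dtau) * S p) = 0.
  rewrite (expectation_lin hM cM hdV tau rg sf); [|by []|by smooth_tac].
  by rewrite EZ// mulNr => /eqP; rewrite subr_eq0 => /eqP.
have Elin := expectation_lin hM cM hdV tau rg sf.
pose I3 p := 2 * dtau * q p + 2 * tau * ((- hq p + ipe p) + q p * xi p)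
   - dtau * (f p * (S p + q p))
   - tau * (f p * (dS p + (- hq p + 2 * ipe p)) + f p * (S p + q p) * xi p)
   - (f p * eta p + f p * f p * xi p)
   + af * (eta p + f p * xi p) + (n2 + af) * (f p * xi p).
pose V2 p := (dS p + hR p) * f p - (hH p - 2 * hq p + f p * (hq p - hH p))
   + T p * (Lap p - 2 * q p + f p * (q p - Lap p)).
pose we p := ipe p + eta p * L p.
pose wfe p := f p * ipe p + eta p * q p + f p * eta p * L p.
pose I2 p := dS p + (- hq p + 2 * ipe p) + (S p + q p) * xi p.
pose V1 p := (dS p + hR p) - (hq p - hH p) + T p * (q p - Lap p).
pose wf p := q p + f p * L p.
(* The coefficients are forced: every monomial other than R and <Rc, h> has to cancel. *)
transitivity (E (fun p => 1 * I3 p + (tau * V2 p + ((- (2 * tau * af)) * we p + ((2 * tau) * wfe p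
  + (((af - 1) * tau) * I2 p + ((- ((af - 1) * tau)) * V1 p + (((2 * n2 - 1) * dtau) * wf p
  + ((- ((af - 1) * n2) - af ^+ 2) * xi p + (((2 * n2 * af - 1) * dtau / tau) * f p
  + (n2 * (af - 1) * dtau / tau - (2 * n2 * af - 1) * dtau / tau * af)))))))))));
  last first.
  have s3 : smooth_fun A I3 by rewrite /I3; smooth_tac.
  have sv2 : smooth_fun A V2 by rewrite /V2; smooth_tac.
  have swe : smooth_fun A we by rewrite /we; smooth_tac.
  have swfe : smooth_fun A wfe by rewrite /wfe; smooth_tac.
  have s2 : smooth_fun A I2 by rewrite /I2; smooth_tac.
  have sv1 : smooth_fun A V1 by rewrite /V1; smooth_tac.
  have swf : smooth_fun A wf by rewrite /wf; smooth_tac.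
  (* Of the ten combined quantities only [I2], f and the constant have a mean that need not vanish.
     The constant subtracts the mean of the f-term and offsets the value given by [id2]. *)
  do 9 (rewrite Elin; [|by []|by smooth_tac]).
  rewrite Ecst id1 -/af.
  have -> : E I3 = 0 by exact: id3.
  have -> : E V2 = 0 by exact: varf.
  have -> : E we = 0 by exact: bpeta.
  have -> : E wfe = 0 by exact: bpfeta.
  have -> : E I2 = - n2 * dtau / tau ^+ 2 by exact: id2.
  have -> : E V1 = 0 by exact: var1.
  have -> : E wf = 0 by exact: bpf.
  by field.
apply: Eext => p.
have hS : S p = (f p - (af - n2)) / tau - q p.
  rewrite -nuE; have := pointwise p; move=> /(congr1 (fun y => y / tau)) <-.
  by field.
have hL : Lap p = n2 / tau - S p by rewrite -(trace p) addrC addKr.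
have hHE : hH p = T p / (2 * tau) - hR p by rewrite -(solh p) addrC addKr.
(* After the pointwise relations eliminate the scalar curvature, the Laplacian and the pairing of
   [h] with the Hessian, eight independent quantities remain, and the integrands agree as rational
   expressions in them. *)
rewrite /I3 /V2 /we /wfe /I2 /V1 /wf /L hHE hL hS /xi.
move: (f p) (q p) (eta p) (T p) (hR p) (hq p) (ipe p) (dS p).
move=> x1 x2 x3 x4 x5 x6 x7 x8.
by field.
Qed.
End Main.

Theorem lemma2p4 (R : realType) (n : nat) (M : ptopologicalType)
    (A : smooth_atlas R n M)
    (dV : tensor2 A -> {measure set (borel M) -> \bar R})
    (g h : tensor2 A) (f : M -> R) (tau eps : R)
    (fs : R -> M -> R) (taus : R -> R) :
  (0 < n)%N ->
  hausdorff_space M ->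
  compact [set: M] ->
  (forall g' : tensor2 A, riemannian_metric g' ->
     riemannian_measure g' (dV g')) ->
  riemannian_metric g ->
  smooth_fun A f ->
  0 < tau ->
  gradient_shrinking_soliton g f tau ->
  normalized dV g f tau ->
  smooth_sym_tensor h ->
  0 < eps ->
  (forall s : R, `|s| < eps -> riemannian_metric (perturb g h s)) ->
  smooth_family A eps fs taus ->
  (forall s : R, `|s| < eps ->
     realizes_nu dV (perturb g h s) (fs s) (taus s)) ->
  fs 0 = f ->
  taus 0 = tau ->
  derive1 taus 0 =
    tau * ((\int[dV g]_p (ricci_inner g h p * expR (- f p)))
           / (\int[dV g]_p (scalar_curvature g p * expR (- f p)))).
Proof.
move=> n0 hM cM hdV rg _ tau0 sol _ sh e0 rgs [sfs stau] nus f0 t0; subst f tau.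
have sfam : smooth_ffam A eps fs by apply: smooth_ffamP => c; exact: sfs.
have dT : is_derive (0 : R) 1 taus (derive1 taus 0).
  have h0 : `|0 : R| < eps by rewrite normr0.
  have d0 : derivable taus 0 1 by apply: diff_derivable; exact: (stau [::] 0 h0).
  by rewrite derive1E; apply: DeriveDef.
have H1 := dtau_mean hM cM hdV sh e0 rgs sfam nus sol dT.
have H2 := mean_scalar_neq0 n0 hM cM hdV sh e0 rgs nus sol.
have -> : \int[dV g]_p (ricci_inner g h p * expR (- fs 0 p)) =
    \int[dV g]_p (contraction g (ricci_tensor g) h p * expR (- fs 0 p)).
  by apply: eq_integral_fun => p; rewrite ricci_innerE.
have -> : \int[dV g]_p (scalar_curvature g p * expR (- fs 0 p)) =
    \int[dV g]_p (scal g p * expR (- fs 0 p)).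
  by apply: eq_integral_fun => p; rewrite (scalar_curvatureE rg).
(* The means carry the normalisation factor that the conclusion lacks; non-vanishing of the mean of
   R says that both this factor and the denominator can be cancelled. *)
move: H1 H2; rewrite /expectation mulf_eq0 negb_or.
move: (\int[dV g]_p (contraction g (ricci_tensor g) h p * _)) => I1.
move: (\int[dV g]_p (scal g p * _)) (normalization _ _) => I2 c H1 /andP[c0 I0].
apply: (mulIf I0); apply: (mulfI c0).
have -> : c * (taus 0 * (I1 / I2) * I2) = taus 0 * (c * I1) by field.
by rewrite H1; ring.
Qed.
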